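(* For all but a finite number of rational integers $t$, the roots of $$x^7-5x^6-3x^5+8x^4+6x^3-3x^2-4x-1+4tx^3(x+1)$$ generate a Galois extension $K_t$ of $\mathbb{Q}$ with Galois group $\mathrm{PGL}_3(2)$, and the roots of $$(y+1)(y^7-y^6-11y^5+y^4+41y^3+25y^2-34y-29)-t(2y+3)^2$$ generate an unramified extension of $K_t$ that is Galois over $K_t$ with Galois group elementary abelian of order $2^3$.
   Context: $\mathrm{PGL}_3(2)=\mathrm{PGL}_3(\mathbb{F}_2)=\mathrm{GL}_3(\mathbb{F}_2)$ is the simple group of order $168$. Unramified means unramified at all places, finite and infinite. *)

(* Defs.v *)
From HB Require Import structures.
From mathcomp Require Import all_boot all_order all_fingroup all_algebra.
From mathcomp Require Import all_solvable all_field.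

Set Implicit Arguments.
Unset Strict Implicit.
Unset Printing Implicit Defensive.

Import Order.TTheory GRing.Theory Num.Theory.
Local Open Scope ring_scope.

Definition septic (t : int) : {poly rat} :=
  'X^7 - 5 * 'X^6 - 3 * 'X^5 + 8 * 'X^4 + 6 * 'X^3 - 3 * 'X^2 - 4 * 'X - 1
  + 4 * t%:~R * 'X^3 * ('X + 1).

Definition octic (t : int) : {poly rat} :=
  ('X + 1) * ('X^7 - 'X^6 - 11 * 'X^5 + 'X^4 + 41 * 'X^3 + 25 * 'X^2
              - 34 * 'X - 29)
  - t%:~R * (2 * 'X + 3) ^+ 2.

(* rs lists all the roots in L of the monic polynomial p, with multiplicity;
   in particular p splits over L. *)
Definition is_root_list (L : fieldExtType rat) (p : {poly rat}) (rs : seq L) :=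
  map_poly (in_alg L) p = \prod_(x <- rs) ('X - x%:P).

(* v restricted to M^* is a normalized discrete valuation of M, i.e. a finite
   place of the number field M. The values of v at 0 (where the valuation is
   +oo) and outside M are irrelevant. *)
Definition normalized_valuation (L : fieldExtType rat) (M : {subfield L})
    (v : L -> int) : Prop :=
  [/\ forall x y, x \in M -> y \in M -> x != 0 -> y != 0 ->
        v (x * y) = v x + v y,
      forall x y, x \in M -> y \in M -> x != 0 -> y != 0 -> x + y != 0 ->
        Num.min (v x) (v y) <= v (x + y)
    & forall n : int, exists x, [/\ x \in M, x != 0 & v x = n]].

(* For a normalized valuation v of a finite extension M of K, e is the index
   of the value group v(K^* ) in v(M^* ) = Z. *)
Definition ramification_index (L : fieldExtType rat) (K : {subfield L})
    (v : L -> int) (e : nat) : Prop :=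
  forall n : int,
    (exists x, [/\ x \in K, x != 0 & v x = n]) <-> (e%:Z %| n)%Z.

(* Residue fields are finite, hence perfect, so that being unramified at a
   finite place only means that the ramification index is 1. *)
Definition unramified_finite (L : fieldExtType rat) (K M : {subfield L}) :=
  forall v : L -> int, normalized_valuation M v -> ramification_index K v 1.

(* An infinite place of M is a complex embedding of M up to conjugation; its
   image consists of algebraic numbers, so algC serves as the codomain. No
   complex place of M may lie over a real place of K. *)
Definition unramified_infinite (L : fieldExtType rat) (K M : {subfield L}) :=
  forall s : {rmorphism subvs_of M -> algC},
    (forall x : subvs_of M, vsval x \in K -> s x \is Num.real) ->
    forall x : subvs_of M, s x \is Num.real.

Definition unramified (L : fieldExtType rat) (K M : {subfield L}) : Prop :=
  unramified_finite K M /\ unramified_infinite K M.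

(* Main.v *)
(* Put s = 4t.  For a root w of the "dual" septic sept (1 - s), the septic
   sept s splits over Q(w) into the cubic [line w] and a quartic, and vice versa:
   the roots of the two septics are the points and the lines of a Fano plane, and
   they generate the same field K.  The octic is A^2 - (w + 1) B^2 over Q(w), so
   M is obtained from K by adjoining the square roots of the units w + 1.
   Since w + 1 is a square modulo 4, M/K is unramified at the finite places;
   and K has no real place, because real roots of the septic would force t to
   be small, by the power sums of their inverses.
   The discriminant of the septics is P(s)^2, and P(s) = 7 mod 8 has a prime
   factor p outside {2, 3, 11, 17} with odd exponent.  P(s) times a unit is a
   square times a factor prime to p, so some inertia group over p is non-trivial,
   and its elements act on the roots as involutions, since no three roots
   coincide modulo p.  The dual septic is irreducible modulo 2, which yields
   elements of order 7.  A normal subgroup of Gal(M/Q), seen on the 8 roots of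
   the octic, is then trivial, or transitive on 7 or on 8 of them; for the
   elementary abelian group E = Gal(M/K) only the trivial and the regular cases
   remain, and in the former either the octic has a rational root (so t = 0 or
   t = 13), or an inertial involution has no fixed root, so that the octic is a
   square modulo p, which is absurd.  So E is regular, hence self-centralizing,
   and Gal(K/Q) = Gal(M/Q)/E embeds into GL_3(2).  As a group of even
   permutations of 7 letters with elements of order 2 and 7, it has order 168. *)

From HB Require Import structures.
Require Import Defs.
From mathcomp Require Import all_boot all_order all_fingroup all_algebra.
From mathcomp Require Import all_solvable all_field all_character.
From mathcomp Require Import ring zify.
From mathcomp Require boolp classical_sets.

Set Implicit Arguments.
Unset Strict Implicit.
Unset Printing Implicit Defensive.

Import Order.TTheory GRing.Theory Num.Theory.
Local Open Scope ring_scope.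

(** * The dual septics *)

(** Hilbert irreducibility may leave out infinitely many t, so the groups are determined for each t
    separately, from irreducibility modulo 2 and from inertia at one well-chosen prime. In the
    pencil of septics, over each of the four zeros of P two pairs of roots collide and three roots
    stay simple. The exceptional primes 2, 3, 11, 17 are those dividing the constants of the two
    Bezout identities that express this pattern. The exponent of p in P has to be odd because
    inertia is extracted from an element whose square is p times a factor prime to p. A prime over p
    is just a predicate on L, and being unramified at the finite places is proved for an arbitrary
    valuation, by carrying an element of value 1 down a tower of quadratic extensions. Identities
    between polynomials are reduced to their values by [pchar0_polyP], so that [ring] and [field]
    decide them. *)

Lemma pchar0_polyP (F : fieldType) (p q : {poly F}) :
  [pchar F] =i pred0 -> (forall x, p.[x] = q.[x]) -> p = q.
Proof.
move=> F0 eqpq; apply/eqP; rewrite -subr_eq0; apply/negP=> /negP nz.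
pose rs := [seq n%:R : F | n <- iota 0 (size (p - q))].
have /(max_poly_roots nz): all (root (p - q)) rs.
  by apply/allP=> x _; rewrite rootE hornerD hornerN eqpq subrr.
have -> : uniq rs.
  rewrite map_inj_uniq ?iota_uniq // => m n /eqP; wlog le_mn: m n / (m <= n)%N.
    by move=> IH eqmn; case/orP: (leq_total m n) => /IH; [apply | move=> <- //; rewrite eq_sym].
  rewrite -subr_eq0 -oppr_eq0 opprB -natrB //.
  by rewrite (proj1 (pcharf0P F)) // subn_eq0 => le_nm; apply/eqP; rewrite eqn_leq le_mn.
by rewrite size_map size_iota ltnn => /(_ isT).
Qed.

Definition sept (R : comNzRingType) (s : R) : {poly R} :=
  Poly [:: -1; -4; -3; 6 + s; 8 + s; -3; -5; 1].

(* The roots of [line w] are the three points on the line w of the Fano plane,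
   those of [coline w] are the other four points. *)
Definition line (F : fieldType) (w : F) : {poly F} :=
  Poly [:: - (w + 1); w ^+ 2 - 2 * w - 4 - w^-1; - (w + 2 + w^-1); 1].
Definition coline (F : fieldType) (w : F) : {poly F} :=
  Poly [:: (w + 1)^-1; (w + 1 - w^-1) / (w + 1); w - 3 + w^-2; w - 3 + w^-1; 1].

Definition septE (R : comNzRingType) (s x : R) : R :=
 x ^+7 - 5 * x ^+ 6 - 3 * x ^+5 + 8 * x ^+ 4 + 6 * x ^+3 - 3 * x ^+2 - 4 * x - 1
  + s * (x ^+ 3 * (x + 1)).

Lemma horner_sept (R : comNzRingType) (s x : R) : (sept s).[x] = septE s x.
Proof. by rewrite /sept horner_Poly /= /septE; ring. Qed.

(** The equation is linear in s, so the curve is parametrized by w and every identity on it becomes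
    one between rational functions of w. The coefficient of s vanishes at 0 and -1 only, where
    [septE] takes the value -1. *)
Lemma sept_param (F : fieldType) (s w : F) : septE s w = 0 ->
  [/\ w != 0, w + 1 != 0 & s = - septE 0 w / (w ^+ 3 * (w + 1))].
Proof.
move=> sw.
have w0 : w != 0.
  apply: contra_eqN sw => /eqP ->; have -> : septE s 0 = -1 by rewrite /septE; ring.
  by rewrite oppr_eq0 oner_eq0.
have w1 : w + 1 != 0.
  apply: contra_eqN sw; rewrite addr_eq0 => /eqP ->; have -> : septE s (- 1) = -1 by rewrite /septE; ring.
  by rewrite oppr_eq0 oner_eq0.
split=> //.
apply: (mulIf (mulf_neq0 (expf_neq0 3 w0) w1)).
rewrite mulfVK ?mulf_neq0 ?expf_neq0 //.
transitivity (- septE 0 w + septE s w); first by rewrite /septE; ring.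
by rewrite sw addr0.
Qed.

Lemma sept_line (F : fieldType) (s w : F) : [pchar F] =i pred0 ->
  root (sept s) w -> sept (1 - s) = line w * coline w.
Proof.
move=> F0; rewrite rootE horner_sept => /eqP/sept_param[w0 w1 ->].
apply: pchar0_polyP => // x; rewrite horner_sept hornerM /line /coline !horner_Poly /= /septE.
by field; rewrite w0 w1.
Qed.

Definition octE (R : comNzRingType) (t y : R) : R :=
  (y + 1) * (y ^+ 7 - y ^+ 6 - 11 * y ^+ 5 + y ^+ 4 + 41 * y ^+ 3 + 25 * y ^+ 2
              - 34 * y - 29)
  - t * (2 * y + 3) ^+ 2.

Definition qA (F : fieldType) (w y : F) :=
  y ^+ 4 + (2 * w - 4) * y ^+ 2 + (2 / w - 1 + 2 * w) * y + (w ^- 2 + 7 / w + 5 - 3 * w) / 2.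
Definition qB (F : fieldType) (w y : F) :=
  - 2 * y ^+ 3 - (1 + w^-1) * y ^+ 2 + (- w^-1 + 6 + 5 * w - w ^+ 2) / (w + 1) * y
  + (w ^- 2 + 3 / w + 14 + 6 * w - 3 * w ^+ 2) / 2 / (w + 1).

Lemma octic_split (F : fieldType) (t w y : F) : 2 != 0 :> F ->
  root (sept (1 - 4 * t)) w -> octE t y = qA w y ^+ 2 - (w + 1) * qB w y ^+ 2.
Proof.
move=> n2; rewrite rootE horner_sept => /eqP/sept_param[w0 w1 Ds].
have n4 : 4 != 0 :> F by rewrite (_ : 4 = 2 * 2 :> F) ?mulf_neq0 //; ring.
have -> : t = (1 - (- septE 0 w / (w ^+ 3 * (w + 1)))) / 4.
  by rewrite -Ds; field.
rewrite /octE /qA /qB /septE; field.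
by rewrite w0 w1 n2 n4.
Qed.

(* [sqrt_disc s ^+ 2] is the discriminant of [sept s] and of [sept (1 - s)]. *)
Definition sqrt_disc (R : comNzRingType) (u : R) : R :=
  27 * u ^+ 4 - 54 * u ^+ 3 - 5967 * u ^+ 2 + 5994 * u - 1417.

(* On the curve [septE s x = 0] the derivative of s with respect to x vanishes
   exactly at the zeros of [crit]. *)
Definition crit (R : comNzRingType) (x : R) : R :=
  3 * x ^+ 8 - 6 * x ^+ 7 - 18 * x ^+ 6 - 6 * x ^+ 5 + 2 * x ^+ 4 + 6 * x ^+ 3
  + 15 * x ^+ 2 + 12 * x + 3.
Definition crit' (R : comNzRingType) (x : R) : R :=
  24 * x ^+ 7 - 42 * x ^+ 6 - 108 * x ^+ 5 - 30 * x ^+ 4 + 8 * x ^+ 3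
  + 18 * x ^+ 2 + 30 * x + 12.
(** In characteristic 0, over each of the four zeros of [sqrt_disc] lie two double points, zeros of
    [crit], and three simple points. The latter are the twelve zeros of this polynomial. *)
Definition disc_cofactor (R : comNzRingType) (x : R) : R :=
  3 * x ^+ 12 - 48 * x ^+ 11 + 246 * x ^+ 10 - 318 * x ^+ 9 - 595 * x ^+ 8
  + 662 * x ^+ 7 + 747 * x ^+ 6 - 262 * x ^+ 5 - 439 * x ^+ 4 - 66 * x ^+ 3
  + 54 * x ^+ 2 + 24 * x + 3.

(* So no three roots of the septic coincide modulo a prime outside {2, 3, 11, 17}. *)
Lemma crit_crit_deriv_bezout (R : comNzRingType) (x : R) :
  (- ((1 * 1000 + 280) * 1000 + 702) - ((1 * 1000 + 284) * 1000 + 162) * x ^+ 1 + (119 * 1000 + 384) * x ^+ 2 - ((1 * 1000 + 108) * 1000 + 572) * x ^+ 3 + ((4 * 1000 + 998) * 1000 + 738) * x ^+ 4 + ((3 * 1000 + 915) * 1000 + 552) * x ^+ 5 - ((1 * 1000 + 649) * 1000 + 568) * x ^+ 6) * crit x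
  + ((321 * 1000 + 765) + (797 * 1000 + 330) * x ^+ 1 + (379 * 1000 + 221) * x ^+ 2 + (44 * 1000 + 755) * x ^+ 3 + (157 * 1000 + 329) * x ^+ 4 - (901 * 1000 + 986) * x ^+ 5 - (540 * 1000 + 993) * x ^+ 6 + (206 * 1000 + 196) * x ^+ 7) * crit' x = 2 * 3 * 11 * 17 ^+ 2.
Proof. by rewrite /crit /crit'; ring. Qed.

(** Hence the cofactor does not vanish at a critical point modulo a prime outside {3, 11, 17}. Large
    coefficients are written in base 1000 because numerals are unary natural numbers. *)
Lemma crit_disc_cofactor_bezout (R : comNzRingType) (x : R) :
  ((94 * 1000 + 742) + (471 * 1000 + 574) * x ^+ 1 + (584 * 1000 + 848) * x ^+ 2 - ((3 * 1000 + 211) * 1000 + 84) * x ^+ 3 - ((5 * 1000 + 945) * 1000 + 671) * x ^+ 4 + ((5 * 1000 + 440) * 1000 + 18) * x ^+ 5 + ((10 * 1000 + 926) * 1000 + 741) * x ^+ 6 - ((5 * 1000 + 785) * 1000 + 814) * x ^+ 7 - ((5 * 1000 + 233) * 1000 + 746) * x ^+ 8 + ((3 * 1000 + 343) * 1000 + 596) * x ^+ 9 - (621 * 1000 + 867) * x ^+ 10 + (37 * 1000 + 986) * x ^+ 11) * crit x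
  + (- (85 * 1000 + 205) - (168 * 1000 + 902) * x ^+ 1 - (59 * 1000 + 948) * x ^+ 2 - (30 * 1000 + 352) * x ^+ 3 - (2 * 1000 + 838) * x ^+ 4 + (196 * 1000 + 446) * x ^+ 5 + (90 * 1000 + 63) * x ^+ 6 - (37 * 1000 + 986) * x ^+ 7) * disc_cofactor x = 3 ^+ 2 * 11 * 17 ^+ 2.
Proof. by rewrite /crit /disc_cofactor; ring. Qed.

Definition sept'E (R : comNzRingType) (s x : R) : R :=
 7 * x ^+6 - 30 * x ^+ 5 - 15 * x ^+4 + 32 * x ^+ 3 + 18 * x ^+2 - 6 * x - 4
  + s * (4 * x ^+ 3 + 3 * x ^+ 2).

Lemma sqrt_disc_sept (F : fieldType) (s w : F) : septE s w = 0 ->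
  sqrt_disc s * (w ^+ 10 * (w + 1) ^+ 2) = sept'E s w ^+ 2 * disc_cofactor w.
Proof.
move=> /sept_param[w0 w1 ->]; rewrite /sqrt_disc /sept'E /disc_cofactor /septE; field.
by rewrite w0 w1.
Qed.

Lemma crit_sept (R : comNzRingType) (s w : R) :
  crit w = w * (w + 1) * sept'E s w - (4 * w + 3) * septE s w.
Proof. by rewrite /crit /sept'E /septE; ring. Qed.

Definition oct_disc_cofactor (R : comNzRingType) (y : R) : R :=
 48*y^+16 - 192*y^+15 - 960 * y^+14 + 3360*y^+13 +(10 * 1000 + 800)*y^+12 -(23 * 1000 + 808)*y^+11
 -(79 * 1000 + 200)*y^+10+(68 * 1000 + 976)*y^+9+(351 * 1000 + 380)*y^+8+(38 * 1000 + 256)*y^+7-(816 * 1000 + 840)*y^+6-(658 * 1000 + 584)*y^+5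
 +(710 * 1000 + 640)*y^+4+(1134 * 1000 + 648)*y^+3+(70 * 1000 + 740)*y^+2-(572 * 1000 + 184)*y-(257 * 1000 + 553).
Definition oct'E (R : comNzRingType) (t y : R) : R :=
   8*y^+7 - 72 * y^+5 - 50*y^+4 + 168*y^+3+198*y^+2-18*y-63 - t*(8*y+12).

(** The octic is linear in t, and takes the value 1/256 at - 3/2, where the coefficient of t
    vanishes; so t is a rational function of y. By the identity, a multiple root of the octic would
    make [sqrt_disc (4 * t)] vanish, which yields separability. *)
Lemma sqrt_disc_oct (F : fieldType) (t y : F) : 2 != 0 :> F -> octE t y = 0 -> 2*y+3 != 0 /\
  sqrt_disc (4 * t) * (2 * y + 3) ^+ 6 = oct'E t y ^+ 2 * oct_disc_cofactor y.
Proof.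
move=> n2 oy.
have y0 : 2 * y + 3 != 0.
  apply: contra_eqN oy => /eqP y0.
  have -> : y = - (3 / 2) by apply: (mulfI n2); rewrite -[LHS]addr0 -{1}(subrr 3) addrA y0; field.
  have -> : octE t (- (3/2)) = (2^-1) ^+ 8 by rewrite /octE; field.
  by rewrite expf_neq0 ?invr_eq0.
split=> //.
have -> : t = octE 0 y / (2 * y + 3) ^+ 2.
  apply: (mulIf (expf_neq0 2 y0)); rewrite mulfVK ?expf_neq0 //.
  transitivity (octE 0 y - octE t y); first by rewrite /octE; ring.
  by rewrite oy subr0.
rewrite /sqrt_disc /oct'E /oct_disc_cofactor /octE; field.
by rewrite y0.
Qed.

Lemma disc3 (R : comNzRingType) (a b c : R) :
  let e1 := a + b + c in let e2 := a * b + a * c + b * c in let e3 := a * b * c in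
  ((b - a) * (c - a) * (c - b)) ^+ 2
  = e1 ^+ 2 * e2 ^+ 2 - 4 * e2 ^+ 3 - 4 * e1 ^+ 3 * e3 + 18 * e1 * e2 * e3
    - 27 * e3 ^+ 2.
Proof. by cbv zeta beta; ring. Qed.

Lemma disc4 (R : comNzRingType) (a b c d : R) :
  let e1 := a + b + c + d in
  let e2 := a * b + a * c + a * d + b * c + b * d + c * d in
  let e3 := a * b * c + a * b * d + a * c * d + b * c * d in
  let e4 := a * b * c * d in
  ((b - a) * (c - a) * (d - a) * (c - b) * (d - b) * (d - c)) ^+ 2
  = 256 * e4 ^+ 3 - 192 * e1 * e3 * e4 ^+ 2 - 128 * e2 ^+ 2 * e4 ^+ 2
    + 144 * e2 * e3 ^+ 2 * e4 - 27 * e3 ^+ 4 + 144 * e1 ^+ 2 * e2 * e4 ^+ 2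
    - 6 * e1 ^+ 2 * e3 ^+ 2 * e4 - 80 * e1 * e2 ^+ 2 * e3 * e4
    + 18 * e1 * e2 * e3 ^+ 3 + 16 * e2 ^+ 4 * e4 - 4 * e2 ^+ 3 * e3 ^+ 2
    - 27 * e1 ^+ 4 * e4 ^+ 2 + 18 * e1 ^+ 3 * e2 * e3 * e4
    - 4 * e1 ^+ 3 * e3 ^+ 3 - 4 * e1 ^+ 2 * e2 ^+ 3 * e4
    + e1 ^+ 2 * e2 ^+ 2 * e3 ^+ 2.
Proof. by cbv zeta beta; ring. Qed.

Lemma norm3 (R : comNzRingType) (a b c u v w : R) :
  let e1 := a + b + c in let e2 := a * b + a * c + b * c in let e3 := a * b * c in
  let N x := u * x ^+ 2 + v * x + w in
  N a * N b * N c
  = u ^+ 3 * e3 ^+ 2 + u ^+ 2 * v * e2 * e3 + u ^+ 2 * w * (e2 ^+ 2 - 2 * e1 * e3)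
    + u * v ^+ 2 * e1 * e3 + u * v * w * (e1 * e2 - 3 * e3)
    + u * w ^+ 2 * (e1 ^+ 2 - 2 * e2) + v ^+ 3 * e3 + v ^+ 2 * w * e2
    + v * w ^+ 2 * e1 + w ^+ 3.
Proof. by cbv zeta beta; ring. Qed.

(** Division with remainder of the quartic by the cubic. At a root of the cubic only the quadratic
    remainder survives, and [norm3] gives its product over the three roots, which is the resultant
    of the cubic and the quartic. *)
Lemma quartic_mod_cubic (R : comNzRingType) (a b c d1 d2 d3 d4 z : R) :
  let e1 := a + b + c in let e2 := a * b + a * c + b * c in let e3 := a * b * c in
  let f1 := d1 + d2 + d3 + d4 in
  let f2 := d1 * d2 + d1 * d3 + d1 * d4 + d2 * d3 + d2 * d4 + d3 * d4 in
  let f3 := d1 * d2 * d3 + d1 * d2 * d4 + d1 * d3 * d4 + d2 * d3 * d4 in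
  let f4 := d1 * d2 * d3 * d4 in
  (d1 - z) * (d2 - z) * (d3 - z) * (d4 - z)
  = (e1 ^+ 2 - e2 - f1 * e1 + f2) * z ^+ 2
    + (e3 - e1 * e2 + f1 * e2 - f3) * z + (e1 * e3 - f1 * e3 + f4)
    + (z + e1 - f1) * ((z - a) * (z - b) * (z - c)).
Proof. by cbv zeta beta; ring. Qed.

(* The roots of [line x] and of [coline x] kept apart, so that the discriminant
   is the product of theirs and of the square of their resultant. *)
Definition vdm7 (R : comNzRingType) (a b c d1 d2 d3 d4 : R) : R :=
  ((b - a) * (c - a) * (c - b))
  * ((d2 - d1) * (d3 - d1) * (d4 - d1) * (d3 - d2) * (d4 - d2) * (d4 - d3))
  * (((d1 - a) * (d2 - a) * (d3 - a) * (d4 - a))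
  * ((d1 - b) * (d2 - b) * (d3 - b) * (d4 - b))
  * ((d1 - c) * (d2 - c) * (d3 - c) * (d4 - c))).

Lemma disc_sept (F : fieldType) (s x a b c d1 d2 d3 d4 : F) : septE s x = 0 ->
  a + b + c = x + 2 + x^-1 -> a * b + a * c + b * c = x ^+ 2 - 2 * x - 4 - x^-1 ->
  a * b * c = x + 1 ->
  d1 + d2 + d3 + d4 = - (x - 3 + x^-1) ->
  d1 * d2 + d1 * d3 + d1 * d4 + d2 * d3 + d2 * d4 + d3 * d4 = x - 3 + x^-2 ->
  d1 * d2 * d3 + d1 * d2 * d4 + d1 * d3 * d4 + d2 * d3 * d4
    = - ((x + 1 - x^-1) / (x + 1)) ->
  d1 * d2 * d3 * d4 = (x + 1)^-1 ->
  vdm7 a b c d1 d2 d3 d4 ^+ 2 = sqrt_disc s ^+ 2.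
Proof.
move=> sx e1 e2 e3 f1 f2 f3 f4.
rewrite /vdm7 2![in LHS]exprMn disc3 disc4.
rewrite (quartic_mod_cubic a b c _ _ _ _ a) (quartic_mod_cubic a b c _ _ _ _ b).
rewrite (quartic_mod_cubic a b c _ _ _ _ c) !subrr !(mulr0, mul0r, addr0).
rewrite norm3 e1 e2 e3 f1 f2 f3 f4.
have [x0 x1 ->] := sept_param sx; rewrite /sqrt_disc /septE; field.
by rewrite x0 x1.
Qed.

Lemma pchar_numfield (L : fieldExtType rat) : [pchar L] =i pred0.
Proof. by move=> p; rewrite (fmorph_pchar (in_alg L)) pchar_num. Qed.

(** A primitive element is sent to a complex root of its minimal polynomial. The embedding provides
    a field where the dual septic splits before its roots are known to lie in L. *)
Lemma numfield_embedding (L : fieldExtType rat) :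
  exists iota : {rmorphism L -> algC}, True.
Proof.
have sepL : separable 1 {:L}.
  by apply/separableP => y _; apply: pcharf0_separable; apply: pchar_numfield.
have defL := eq_adjoin_separable_generator sepL (sub1v _).
set th := separable_generator _ _ in defL.
have /polyOver1P[m Dm] := minPolyOver 1 th.
pose QC := map_poly (ratr : rat -> algC).
have [z /eqP mz] : exists z : algC, root (QC m) z.
  apply: closed_rootP; rewrite size_map_poly -(size_map_poly (in_alg L)) -Dm.
  by rewrite size_minPoly.
have rep (x : L) : exists p, (map_poly (in_alg L) p).[th] == x.
  have: x \in <<1; th>>%VS by rewrite -defL memvf.
  by case/Fadjoin_polyP=> _ /polyOver1P[p ->] ->; exists p.
pose f x := (QC (xchoose (rep x))).[z].
have fE p x : (map_poly (in_alg L) p).[th] = x -> f x = (QC p).[z].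
  move=> px; rewrite /f; set q := xchoose _.
  have qx : (map_poly (in_alg L) q).[th] = x by apply/eqP: (xchooseP (rep x)).
  have : minPoly 1 th %| map_poly (in_alg L) (q - p).
    apply: minPoly_dvdp; first exact: alg_polyOver.
    by rewrite rootE rmorphB /= hornerD hornerN px qx subrr.
  rewrite Dm dvdp_map => /dvdpP[r Dr].
  apply/eqP; rewrite -subr_eq0 -hornerN -hornerD -rmorphB Dr rmorphM /= hornerM.
  by rewrite mz mulr0.
have repE x := eqP (xchooseP (rep x)).
have fB : zmod_morphism f.
  move=> x y; rewrite (fE (xchoose (rep x) - xchoose (rep y))).
    by rewrite /QC rmorphB /= hornerD hornerN.
  by rewrite rmorphB /= hornerD hornerN !repE.
have fM : monoid_morphism f.
  split=> [|x y]; first by rewrite (fE 1) /QC ?rmorph1 ?hornerC.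
  rewrite (fE (xchoose (rep x) * xchoose (rep y))).
    by rewrite /QC rmorphM /= hornerM.
  by rewrite rmorphM /= hornerM !repE.
pose fB' := GRing.isZmodMorphism.Build _ _ f fB.
pose fM' := GRing.isMonoidMorphism.Build _ _ f fM.
by exists (HB.pack f fB' fM' : {rmorphism L -> algC}).
Qed.

Lemma Poly_rcons1 (R : nzRingType) (c : seq R) :
  size (Poly (rcons c 1)) = (size c).+1 /\ Poly (rcons c 1) \is monic.
Proof.
have DP : Poly (rcons c 1) = rcons c 1 :> seq R.
  by apply: (@PolyK _ 0); rewrite last_rcons oner_eq0.
by rewrite monicE /lead_coef DP size_rcons nth_rcons ltnn eqxx.
Qed.

Lemma map_sept (R S : comNzRingType) (f : {rmorphism R -> S}) (s : R) :
  map_poly f (sept s) = sept (f s).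
Proof.
apply/polyP=> i; rewrite coef_map /sept !coef_Poly.
by do 8![case: i => [|i] /=; first by (rewrite rmorphN1 || rewrite rmorphN rmorph_nat || rewrite rmorphD rmorph_nat || rewrite rmorph1)];
  rewrite !nth_nil rmorph0.
Qed.

Lemma size_sept (R : comNzRingType) (s : R) : size (sept s) = 8.
Proof. exact: (Poly_rcons1 [:: -1; -4; -3; 6 + s; 8 + s; -3; -5]).1. Qed.

Lemma monic_sept (R : comNzRingType) (s : R) : sept s \is monic.
Proof. exact: (Poly_rcons1 [:: -1; -4; -3; 6 + s; 8 + s; -3; -5]).2. Qed.

Lemma monic_line (F : fieldType) (w : F) : line w \is monic.
Proof. exact: (Poly_rcons1 [:: - (w + 1); w ^+ 2 - 2 * w - 4 - w^-1; - (w + 2 + w^-1)]).2. Qed.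

Lemma dvdp_prod_monic (F : fieldType) (p : {poly F}) (rs : seq F) : p \is monic ->
  p %| \prod_(x <- rs) ('X - x%:P) -> exists m, p = \prod_(x <- mask m rs) ('X - x%:P).
Proof.
move=> mp /dvdp_prod_XsubC[m]; rewrite eqp_monic ?monic_prod_XsubC // => /eqP.
by exists m.
Qed.

Definition splits (R : comNzRingType) (p : {poly R}) (rs : seq R) :=
  p = \prod_(x <- rs) ('X - x%:P).

(** For a complex root z of the dual septic, [line z] divides the septic, so its three roots come
    from [xs]. Its constant coefficient - (z + 1) then expresses z as the image of an element of the
    field generated by [xs]. *)
Lemma dual_roots (L : fieldExtType rat) (s : L) (xs : seq L) :
  splits (sept s) xs ->
  exists ws, splits (sept (1 - s)) ws /\ {subset ws <= <<1 & xs>>%VS}.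
Proof.
move=> Dxs; have [iota _] := numfield_embedding L.
have [zs Dzs] := closed_field_poly_normal (sept (1 - iota s)).
rewrite (monicP (monic_sept _)) scale1r in Dzs.
have zsP z : z \in zs -> exists w, (w \in <<1 & xs>>%VS) && (iota w == z).
  rewrite -root_prod_XsubC -Dzs => /(sept_line (pchar_num _)).
  rewrite subKr -map_sept Dxs rmorph_prod => Dl.
  have: line z %| \prod_(x <- map iota xs) ('X - x%:P).
    rewrite big_map; under eq_bigr do rewrite -map_polyXsubC.
    by rewrite Dl dvdp_mulIl.
  case/(dvdp_prod_monic (monic_line z)) => m; rewrite -map_mask big_map => Dm.
  have := congr1 (fun p : {poly algC} => p.[0]) Dm.
  rewrite horner_Poly horner_prod /= !(mulr0, add0r) => z1.
  exists (- 1 - \prod_(x <- mask m xs) (- x)); apply/andP; split.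
    rewrite rpredB ?rpredN ?rpred1 // big_seq rpred_prod // => x /mem_mask xx.
    by rewrite rpredN seqv_sub_adjoin.
  rewrite rmorphB rmorphN1 rmorph_prod (eq_bigr (fun x => ('X - (iota x)%:P).[0])).
    by rewrite -z1 opprK addrC addrK.
  by move=> x _; rewrite hornerXsubC sub0r rmorphN.
have [ws [Dws wsP]] : exists ws, map iota ws = zs /\ {subset ws <= <<1 & xs>>%VS}.
  elim: (zs) (zsP) => [_|z zs' IH zP]; first by exists [::].
  have [|ws [Dws wsP]] := IH; first by move=> y yz; apply: zP; rewrite inE yz orbT.
  have [w /andP[wK /eqP wz]] := zP z (mem_head _ _).
  exists (w :: ws); split; first by rewrite /= wz Dws.
  by move=> y; rewrite inE => /predU1P[->|/wsP].
exists ws; split=> //; apply: (map_poly_inj iota).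
rewrite map_sept rmorphB rmorph1 Dzs -Dws big_map rmorph_prod.
by apply: eq_bigr => w _; rewrite /= map_polyXsubC.
Qed.

(** * Irreducibility of the dual septic modulo 2 *)

Lemma F2_neq0D (x y : 'F_2) : (x + y != 0) = (x != 0) (+) (y != 0).
Proof. by move: x y => [[|[|//]] ?] [[|[|//]] ?]. Qed.

Lemma F2_neq0M (x y : 'F_2) : (x * y != 0) = (x != 0) && (y != 0).
Proof. by rewrite mulf_eq0 negb_or. Qed.

(* Coefficients of a product in F_2[X], with [true] for 1. *)
Definition conv2 (a b : nat -> bool) n :=
  foldr addb false [seq a j && b (n - j)%N | j <- iota 0 n.+1].

(** An exhaustive search, which interleaves the coefficients of the two factors so that the
    equations in low degree cut the branches early. *)
Lemma conv2_sept (a b : nat -> bool) :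
  (forall k, (3 < k)%N -> a k = false) -> (forall k, (6 < k)%N -> b k = false) ->
  (forall n, (n < 10)%N -> conv2 a b n =
     nth false [:: true; false; true; true; true; true; true; true] n) -> False.
Proof.
move=> a0 b0 E.
move: (E 0 isT) (E 1 isT) (E 2 isT) (E 3 isT) (E 4 isT) (E 5 isT) (E 6 isT) (E 7 isT).
move: (E 8 isT) (E 9 isT).
have := (a0 4 isT, a0 5 isT, a0 6 isT, a0 7 isT, a0 8 isT, a0 9 isT).
have := (b0 7 isT, b0 8 isT, b0 9 isT) => -[[b7 b8] b9] [[[[[a4 a5] a6] a7] a8] a9].
cbv; rewrite a4 a5 a6 a7 a8 a9 b7 b8 b9.
case: (a 0) => //; case: (b 0) => //; case: (a 1); case: (b 1) => //;
  case: (a 2); case: (b 2) => //; case: (a 3); case: (b 3) => //;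
  case: (b 4) => //; case: (b 5) => //; case: (b 6) => //.
Qed.

Lemma sept_no_small_factor_F2 (q r : {poly 'F_2}) :
  q * r = sept 1 -> (size q <= 4)%N -> (size r <= 7)%N -> False.
Proof.
move=> qr sq sr.
apply: (@conv2_sept (fun i => q`_i != 0) (fun i => r`_i != 0)).
- by move=> k k4; rewrite nth_default ?eqxx // (leq_trans sq).
- by move=> k k4; rewrite nth_default ?eqxx // (leq_trans sr).
move=> n n10; transitivity ((q * r)`_n != 0).
  rewrite coefM (big_morph (fun x : 'F_2 => x != 0) F2_neq0D (erefl _)).
  rewrite (eq_bigr _ (fun j _ => F2_neq0M _ _)) /conv2 foldrE big_map.
  by rewrite -(big_mkord xpredT (fun j => (q`_j != 0) && (r`_(n - j) != 0))) /index_iota subn0.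
by rewrite qr coef_Poly; do 10![case: n n10 => [|n] //= n10].
Qed.

(** As 1 - 4 t is 1 modulo 2, one polynomial over F_2 serves all t. Of two proper factors of a
    septic one has degree at most 3, and the leading coefficients, being units, keep the degrees
    modulo 2. *)
Lemma irreducible_sept (t : int) : irreducible_poly (sept (1 - 4 * t%:~R : rat)).
Proof.
set p : {poly int} := sept (1 - 4 * t).
have -> : sept (1 - 4 * t%:~R) = map_poly intr p :> {poly rat}.
  by rewrite map_sept rmorphB rmorph1 rmorphM.
split=> [|q q1]; first by rewrite size_map_poly_id0 ?size_sept ?(monicP (monic_sept _)).
case/dvdpP_rat_int=> p1 [a a0 Dq] [r Dp].
have mp1 : lead_coef p1 * lead_coef r = 1.
  by rewrite -lead_coefM -Dp (monicP (monic_sept _)).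
have [p10 r0] : p1 != 0 /\ r != 0.
  by apply/andP; rewrite -!lead_coef_eq0 -negb_or -mulf_eq0 mp1.
have szM : (size p1 + size r = 9)%N.
  have := size_mul p10 r0; rewrite -Dp size_sept.
  by move: p10; rewrite -size_poly_gt0; case: (size p1) => // m _; rewrite !addSn /= => <-.
have u2 (z z' : int) : z * z' = 1 -> (z%:~R : 'F_2) != 0.
  move=> zz; apply: contra_eq_neq (congr1 (fun z => z%:~R : 'F_2) zz) => /= z0.
  by rewrite rmorphM /= z0 mul0r.
pose f2 := map_poly (intr : int -> 'F_2).
have szp1 : size (f2 p1) = size p1 by rewrite size_map_poly_id0 ?(u2 _ _ mp1).
have szr : size (f2 r) = size r.
  by rewrite size_map_poly_id0 ?(u2 _ (lead_coef p1)) // mulrC.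
have E : f2 p1 * f2 r = sept 1.
  rewrite /f2 -rmorphM /= -Dp /p map_sept rmorphB rmorph1 rmorphM /=.
  by rewrite (_ : 4%:~R = 0) ?mul0r ?subr0 //; apply/val_inj.
have szp1' : size p1 != 1%N by rewrite -(size_rat_int_poly p1) -(size_scale _ a0) -Dq.
have p1_gt0 : (0 < size p1)%N by rewrite size_poly_gt0.
have r_gt0 : (0 < size r)%N by rewrite size_poly_gt0.
have [r1|r1] := eqVneq (size r) 1%N.
  have /size_poly1P[c c0 Dr] : size r == 1%N by rewrite r1.
  rewrite Dp Dq Dr rmorphM /= map_polyC mulrC mul_polyC.
  by rewrite (eqp_trans (eqp_scale _ a0)) // eqp_sym eqp_scale // intr_eq0.
case: (leqP (size p1) 4) => sp.
  by have [] := sept_no_small_factor_F2 E; rewrite ?szp1 ?szr //; lia.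
by have [] := @sept_no_small_factor_F2 (f2 r) (f2 p1); rewrite ?szp1 ?szr 1?mulrC //; lia.
Qed.

(** * Galois groups as groups of permutations of the roots *)

Lemma galois_splits (L : splittingFieldType rat) (p : {poly rat}) (rs : seq L) :
  splits (map_poly (in_alg L) p) rs -> uniq rs -> galois 1 <<1 & rs>>.
Proof.
move=> Dp Urs; apply/splitting_galoisField; exists (map_poly (in_alg L) p); split.
- exact: alg_polyOver.
- by rewrite Dp separable_prod_XsubC.
by exists rs; rewrite ?Dp ?eqpxx.
Qed.

Lemma sept_in_alg (L : fieldExtType rat) (a : rat) : sept a%:A = map_poly (in_alg L) (sept a).
Proof. by rewrite map_sept. Qed.

Section DualSeptic.
Variables (L : splittingFieldType rat) (t : int) (ws : seq L).
Let q : rat := 1 - 4 * t%:~R.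
Hypothesis Dws : splits (sept (1 - 4 * t%:~R)) ws.

Lemma dual_alg : sept (1 - 4 * t%:~R) = map_poly (in_alg L) (sept q).
Proof. by rewrite -sept_in_alg /q -in_algE rmorphB rmorph1 rmorphM rmorph_nat rmorph_int. Qed.

Lemma dual_size : size ws = 7.
Proof. by have := size_sept (1 - 4 * t%:~R : L); rewrite Dws size_prod_XsubC => -[]. Qed.

Lemma dual_minPoly w : w \in ws -> minPoly 1 w = map_poly (in_alg L) (sept q).
Proof.
move=> ww; have rw : root (map_poly (in_alg L) (sept q)) w.
  by rewrite -dual_alg Dws root_prod_XsubC.
have [_ irr] := irreducible_sept t.
have /polyOver1P[m Dm] := minPolyOver 1 w.
have dv : m %| sept q.
  by rewrite -(dvdp_map (in_alg L)) -Dm minPoly_dvdp // alg_polyOver.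
apply/eqP; rewrite -eqp_monic ?monic_minPoly ?map_monic ?monic_sept //.
rewrite Dm eqp_map irr // -(size_map_poly (in_alg L)) -Dm size_minPoly.
by rewrite eqSS /adjoin_degree.
Qed.

Lemma dual_uniq : uniq ws.
Proof.
have: (0 < size ws)%N by rewrite dual_size.
case Ews: ws => [//|w ws'] _; rewrite -Ews -separable_prod_XsubC -Dws dual_alg.
rewrite -(@dual_minPoly w) ?Ews ?mem_head //.
exact: pcharf0_separable (@pchar_numfield L) w.
Qed.

Lemma dual_dim : (7 %| \dim <<1 & ws>>)%N.
Proof.
have: (0 < size ws)%N by rewrite dual_size.
case Ews: ws => [//|w ws'] _; rewrite -Ews.
have ww : w \in ws by rewrite Ews mem_head.
have /field_dimS : (<<1; w>> <= <<1 & ws>>)%VS by rewrite sub_adjoin1v seqv_sub_adjoin.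
apply: dvdn_trans; rewrite dim_Fadjoin dimv1 muln1.
have := size_minPoly 1 w; rewrite dual_minPoly // size_map_poly size_sept.
by move=> /eqP; rewrite eqSS => /eqP <-.
Qed.

Lemma dual_galois : galois 1 <<1 & ws>>.
Proof. by apply: (@galois_splits L (sept q)); [rewrite -dual_alg | apply: dual_uniq]. Qed.

End DualSeptic.

Lemma gal_perm (L : splittingFieldType rat) (K : {subfield L}) n (rs : n.-tuple L) :
  uniq rs -> {subset rs <= K} ->
  {in 'Gal(K / 1)%g, forall (g : gal_of K) i, g (tnth rs i) \in rs} ->
  exists f : {morphism 'Gal(K / 1)%g >-> 'S_n},
    {in 'Gal(K / 1)%g, forall (g : gal_of K) i, tnth rs (f g i) = g (tnth rs i)}.
Proof.
move=> Urs sK stab.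
pose F (g : gal_of K) i := odflt i [pick j | tnth rs j == g (tnth rs i)].
have FE g i : g \in 'Gal(K / 1)%g -> tnth rs (F g i) = g (tnth rs i).
  move=> Gg; rewrite /F; case: pickP => [j /eqP //|nj].
  by have /tnthP[j Dj] := stab g Gg i; have := nj j; rewrite -Dj eqxx.
have tI : injective (tnth rs) by apply/injectiveP; rewrite /injectiveb /dinjectiveb map_tnth_enum.
have rK i : tnth rs i \in K by rewrite sK ?mem_tnth.
have FI g : g \in 'Gal(K / 1)%g -> injective (F g).
  move=> Gg i j Fij; apply: tI; have := congr1 (tnth rs) Fij.
  by rewrite !FE //; apply: fmorph_inj.
pose f (g : gal_of K) : 'S_n := odflt 1%g (insub (finfun (F g)) : option 'S_n).
have fE g i : g \in 'Gal(K / 1)%g -> f g i = F g i.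
  move=> Gg; rewrite /f insubT => [|?].
    by apply/injectiveP=> a b; rewrite !ffunE; apply: FI.
  by rewrite -pvalE /= ffunE.
have fM : {in 'Gal(K / 1)%g &, {morph f : g h / (g * h)%g}}.
  move=> g h Gg Gh; apply/permP=> i; rewrite permM !fE ?groupM //.
  by apply: tI; rewrite !FE ?groupM // galM.
exists (Morphism fM) => g Gg i /=; by rewrite fE // FE.
Qed.

Lemma gal_fix_adjoin (L : splittingFieldType rat) (K : {subfield L}) (rs : seq L)
    (g : gal_of K) : {subset rs <= K} -> {in rs, forall x, g x = x} ->
  g \in 'Gal(K / <<1 & rs>>)%g.
Proof.
move=> sK fix_g; rewrite -sub1set.
apply: (subset_trans (galois_connection_subset [set g])); apply: galS.
apply/Fadjoin_seqP; split; first exact: sub1v.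
by move=> x xr; apply/fixedFieldP; [apply: sK | move=> h /set1P->; apply: fix_g].
Qed.

Definition vdm (R : comNzRingType) n (rs : n.-tuple R) : R :=
  \det (Vandermonde n (\row_j tnth rs j)).

Lemma vdm_neq0 (F : fieldType) n (rs : n.-tuple F) : uniq rs -> vdm rs != 0.
Proof.
move=> Urs; rewrite /vdm det_Vandermonde; apply/prodf_neq0 => i _; apply/prodf_neq0 => j ij.
rewrite !mxE subr_eq0; apply: contraTneq ij => /eqP; rewrite !(tnth_nth 0) nth_uniq ?size_tuple //.
by move/eqP=> ->; rewrite ltnn.
Qed.

Lemma numfield_natr_eq0 (L : fieldExtType rat) n : (n%:R == 0 :> L) = (n == 0)%N.
Proof. by move/pcharf0P: (@pchar_numfield L) => ->. Qed.

(** The Vandermonde determinant is multiplied by the sign of the permutation; being rational and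
    non-zero, it allows no sign -1. *)
Lemma gal_perm_even (L : splittingFieldType rat) (K : {subfield L}) n (rs : n.-tuple L)
    (f : {morphism 'Gal(K / 1)%g >-> 'S_n}) : uniq rs ->
  {in 'Gal(K / 1)%g, forall (g : gal_of K) i, tnth rs (f g i) = g (tnth rs i)} ->
  vdm rs \in 1%VS ->
  {in 'Gal(K / 1)%g, forall g : gal_of K, ~~ odd_perm (f g)}.
Proof.
move=> Urs fE d1 g Gg; have d0 := vdm_neq0 Urs.
have gd : g (vdm rs) = vdm rs by rewrite (fixed_gal (sub1v K) Gg).
have : g (vdm rs) = (-1) ^+ odd_perm (f g) * vdm rs.
  rewrite /vdm -[LHS](det_map_mx (gal_repr g)).
  rewrite [X in \det X](_ : _ = col_perm (f g) (Vandermonde n (\row_j tnth rs j))).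
    by rewrite col_permE det_mulmx det_perm odd_permV mulrC.
  by apply/matrixP=> i j; rewrite !mxE rmorphXn /= fE.
rewrite gd; case: (odd_perm _) => // /eqP; rewrite mulN1r -subr_eq0 opprK -mulr2n.
by rewrite -mulr_natr mulf_eq0 (negPf d0) numfield_natr_eq0.
Qed.

Lemma vdm7E (R : comNzRingType) (a b c d1 d2 d3 d4 : R) :
  vdm [tuple a; b; c; d1; d2; d3; d4] = vdm7 a b c d1 d2 d3 d4.
Proof.
rewrite /vdm det_Vandermonde /vdm7.
under eq_bigr do rewrite big_mkcond /= !big_ord_recl big_ord0 /= !mxE.
rewrite !big_ord_recl big_ord0 /= /tnth /=.
rewrite !(mul1r, mulr1).
ring.
Qed.

Lemma splits_cubic (F : fieldType) (a b c e0 e1 e2 : F) : [pchar F] =i pred0 ->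
  splits (Poly [:: e0; e1; e2; 1]) [:: a; b; c] ->
  [/\ e0 = - (a * b * c), e1 = a * b + a * c + b * c & e2 = - (a + b + c)].
Proof.
move=> F0; rewrite /splits !big_cons big_nil mulr1.
rewrite [RHS](_ : _ = Poly [:: - (a * b * c); a * b + a * c + b * c; - (a + b + c); 1]).
  move/polyP=> E; have := (E 0, E 1, E 2); rewrite !coef_Poly /= => -[[-> ->] ->].
  by [].
by apply: pchar0_polyP => // x; rewrite !hornerM !hornerXsubC horner_Poly /=; ring.
Qed.

Lemma splits_quartic (F : fieldType) (a b c d e0 e1 e2 e3 : F) : [pchar F] =i pred0 ->
  splits (Poly [:: e0; e1; e2; e3; 1]) [:: a; b; c; d] ->
  [/\ e0 = a * b * c * d, e1 = - (a * b * c + a * b * d + a * c * d + b * c * d),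
      e2 = a * b + a * c + a * d + b * c + b * d + c * d & e3 = - (a + b + c + d)].
Proof.
move=> F0; rewrite /splits !big_cons big_nil mulr1.
rewrite [RHS](_ : _ = Poly [:: a * b * c * d; - (a * b * c + a * b * d + a * c * d + b * c * d);
      a * b + a * c + a * d + b * c + b * d + c * d; - (a + b + c + d); 1]).
  move/polyP=> E; have := (E 0, E 1, E 2, E 3).
  by rewrite !coef_Poly /= => -[[[-> ->] ->] ->].
by apply: pchar0_polyP => // x; rewrite !hornerM !hornerXsubC horner_Poly /=; ring.
Qed.

Lemma monic_coline (F : fieldType) (w : F) : coline w \is monic.
Proof.
exact: (Poly_rcons1 [:: (w + 1)^-1; (w + 1 - w^-1) / (w + 1); w - 3 + w^-2; w - 3 + w^-1]).2.
Qed.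

Lemma splits_monic_dvd (F : fieldType) (p q : {poly F}) rs : splits q rs ->
  p \is monic -> p %| q -> exists2 rs', splits p rs' & {subset rs' <= rs}.
Proof.
move=> -> mp /(dvdp_prod_monic mp)[m Dm]; exists (mask m rs) => // => y; apply: mem_mask.
Qed.

(** The roots are reordered, those of [line x] before those of [coline x], to fit [vdm7]. *)
Lemma vdm_sept (L : fieldExtType rat) (s x : L) (ws0 : seq L) :
  root (sept s) x -> splits (sept (1 - s)) ws0 ->
  exists ws : 7.-tuple L, splits (sept (1 - s)) ws /\ vdm ws ^+ 2 = sqrt_disc s ^+ 2.
Proof.
move=> rx Dws0; have F0 := @pchar_numfield L; have E := sept_line F0 rx.
have [|A DA _] := splits_monic_dvd Dws0 (monic_line x); first by rewrite E dvdp_mulr.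
have [|B DB _] := splits_monic_dvd Dws0 (monic_coline x); first by rewrite E dvdp_mull.
have sA : size A = 3.
  have := (Poly_rcons1 [:: - (x + 1); x ^+ 2 - 2 * x - 4 - x^-1; - (x + 2 + x^-1)]).1.
  by rewrite -/(line x) [line x]DA size_prod_XsubC => -[].
have sB : size B = 4.
  have := (Poly_rcons1 [:: (x + 1)^-1; (x + 1 - x^-1) / (x + 1); x - 3 + x^-2; x - 3 + x^-1]).1.
  by rewrite -/(coline x) [coline x]DB size_prod_XsubC => -[].
case: A DA sA => [|a [|b [|c []]]] //= DA _; case: B DB sB => [|d1 [|d2 [|d3 [|d4 []]]]] //= DB _.
exists [tuple a; b; c; d1; d2; d3; d4]; split.
  by rewrite /splits E [line x]DA [coline x]DB -big_cat.
have [e0 e1 e2] := splits_cubic F0 DA; have [f0 f1 f2 f3] := splits_quartic F0 DB.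
rewrite vdm7E; apply: (@disc_sept _ s x).
- by apply/eqP; rewrite -horner_sept -rootE.
- by rewrite -[LHS]opprK -e2 opprK.
- by rewrite -e1.
- by rewrite -[LHS]opprK -e0 opprK.
- by rewrite -[LHS]opprK -f3.
- by rewrite -f2.
- by rewrite -[LHS]opprK -f1.
by rewrite -f0.
Qed.

(** * Primes and inertia *)

Notation algint := (integralOver (intr : int -> _)).

(** By Gauss's lemma X - a is proportional to an integral factor of the monic polynomial [p], whose
    leading coefficient is a unit. *)
Lemma algint_rat (L : fieldExtType rat) (x : L) :
  algint x -> x \in 1%VS -> exists n : int, x = n%:~R.
Proof.
case=> p mp px /vlineP[a Dx].
have : 'X - a%:P %| map_poly (intr : int -> rat) p.
  rewrite dvdp_XsubCl -(fmorph_root (in_alg L)) /= -Dx.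
  by rewrite -map_poly_comp; congr (root _ _): px; apply: eq_map_poly => z /=; rewrite scaler_int.
case/dvdpP_rat_int=> p1 [c c0 Dp1] [r Dp].
have u : lead_coef p1 * lead_coef r = 1 by rewrite -lead_coefM -Dp (monicP mp).
have : lead_coef p1 \is a GRing.unit by apply/unitrP; exists (lead_coef r); rewrite mulrC u.
have c1 : c * (lead_coef p1)%:~R = 1.
  have := congr1 lead_coef Dp1; rewrite lead_coefXsubC lead_coefZ.
  by rewrite lead_coef_map_inj //; apply: intr_inj.
have ca : - a = c * (p1`_0)%:~R.
  by have := congr1 (fun p : {poly rat} => p`_0) Dp1; rewrite coefB coefX coefC coefZ coef_map sub0r.
rewrite qualifE /= => /orP[] /eqP l1.
  exists (- p1`_0); move: c1; rewrite l1 mulr1 => c1.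
  by rewrite Dx -[a]opprK ca c1 mul1r rmorphN /= scaleNr scaler_int.
exists (p1`_0); move: c1; rewrite l1 rmorphN1 mulrN1 => /(canRL (@opprK _)) c1.
by rewrite Dx -[a]opprK ca c1 mulN1r opprK scaler_int.
Qed.

(* The trace on the algebraic integers of L of a set m satisfying this is a prime
   ideal over p; m itself need not consist of algebraic integers. *)
Definition prime_over (L : fieldExtType rat) (p : nat) (m : L -> Prop) :=
  [/\ m p%:R, ~ m 1, forall x y, m x -> m y -> m (x + y),
      forall x y, algint x -> m y -> m (x * y)
    & forall x y, algint x -> algint y -> m (x * y) -> m x \/ m y].

(** An ideal of the ring of algebraic integers of L that is maximal among the proper ideals
    containing p is prime; Zorn's lemma provides one. *)
Lemma prime_over_exists (L : fieldExtType rat) (p : nat) : prime p ->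
  exists m : L -> Prop, prime_over p m.
Proof.
(* Only non-empty sets are asked to contain p, so that the empty set, as the union of the empty
   chain, qualifies. A maximal set is non-empty all the same, since the multiples of p form a larger
   candidate: 1/p is not an algebraic integer. *)
move=> pr_p; pose P (A : L -> Prop) :=
  [/\ forall x, A x -> algint x /\ A p%:R, ~ A 1, forall x y, A x -> A y -> A (x + y)
    & forall x y, algint x -> A y -> A (x * y)].
have [F FP totF|A [[AO A1 AD AM] maxA]] := @classical_sets.Zorn_bigcup L P.
  split=> [x [X FX Xx]|[X FX]|x y [X FX Xx] [Y FY Yy]|x y Ox [Y FY Yy]].
  - by have [/(_ x Xx)[Ox Xp] _ _ _] := FP X FX; split=> //; exists X.
  - by have [] := FP X FX.
  - have [XY|YX] := totF X Y FX FY.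
      by exists Y => //; have [_ _ YD _] := FP Y FY; apply: YD => //; apply: XY.
    by exists X => //; have [_ _ XD _] := FP X FX; apply: XD => //; apply: YX.
  by exists Y => //; have [_ _ _ YM] := FP Y FY; apply: YM.
have Op : algint (p%:R : L) by apply: integral_nat.
have Ap : A p%:R.
  have [//|nA] := boolp.pselect (A p%:R).
  have A0 x : ~ A x by move=> Ax; apply: nA; have [] := AO x Ax.
  case: (maxA (fun x => exists2 y, algint y & x = y * p%:R)).
    split=> [x /A0 //|sub]; apply: (A0 p%:R); apply: sub.
    by exists 1; [apply: integral1 | rewrite mul1r].
  split=> [_ [y Oy ->]|[y Oy y1]|_ _ [y Oy ->] [z Oz ->]|x _ Ox [y Oy ->]].
  - split; first exact: integral_mul.
    by exists 1; [apply: integral1 | rewrite mul1r].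
  - have p0 : p%:R != 0 :> L by rewrite numfield_natr_eq0 -lt0n prime_gt0.
    have Dy : y = (p%:R^-1)%:A.
      apply: (mulIf p0); rewrite -y1 -in_algE fmorphV rmorph_nat mulVf //.
    have [|n Dn] := algint_rat Oy; first by rewrite Dy memvZ ?mem1v.
    have : (n * p%:Z)%:~R = 1%:~R :> rat.
      apply: (fmorph_inj (in_alg L)); rewrite rmorph1 rmorph_int rmorphM /= -Dn.
      exact: esym y1.
    move/intr_inj => /(congr1 absz); rewrite abszM absz1 => /eqP.
    by rewrite muln_eq1 => /andP[_ ]; rewrite absz_nat => /eqP p1; rewrite p1 in pr_p.
  - by exists (y + z); [apply: integral_add | rewrite mulrDl].
  by exists (x * y); [apply: integral_mul | rewrite mulrA].
exists A; split=> // x y Ox Oy Axy.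
have [Ax|nAx] := boolp.pselect (A x); [by left | right].
(* The ideal generated by [A] and x. If it contains 1, then y lies in [A]; otherwise it contradicts
   the maximality of [A]. *)
pose B z := exists2 a, A a & exists2 r, algint r & z = a + r * x.
have [B1|nB1] := boolp.pselect (B 1).
  have [a Aa [r Or D1]] := B1; rewrite -[y]mul1r D1 mulrDl -mulrA.
  by apply: AD; [rewrite mulrC; apply: AM | apply: AM].
have A0 : A 0 by rewrite -(mul0r p%:R); apply: AM => //; apply: integral0.
case: (maxA B); split.
- by move=> a Aa; exists a => //; exists 0; [apply: integral0 | rewrite mul0r addr0].
- move=> sub; apply: nAx; apply: sub; exists 0 => //; exists 1; first exact: integral1.
  by rewrite mul1r add0r.
- move=> _ [a Aa [r Or ->]]; split.
    by apply: integral_add; [have [] := AO a Aa | apply: integral_mul].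
  by exists p%:R => //; exists 0; [apply: integral0 | rewrite mul0r addr0].
- by [].
- move=> _ _ [a Aa [r Or ->]] [b Ab [s Os ->]]; exists (a + b); first exact: AD.
  by exists (r + s); [apply: integral_add | rewrite mulrDl addrACA].
move=> z _ Oz [a Aa [r Or ->]]; exists (z * a); first exact: AM.
by exists (z * r); [apply: integral_mul | rewrite mulrDr mulrA].
Qed.

Lemma algint_rmorph (L L' : fieldExtType rat) (f : {rmorphism L -> L'}) x :
  algint x -> algint (f x).
Proof.
case=> p mp px; exists p => //; have := px; rewrite -(fmorph_root f) -map_poly_comp.
by congr (root _ _); apply: eq_map_poly => z /=; rewrite rmorph_int.
Qed.

Section PrimeOver.
Variables (L : splittingFieldType rat) (p : nat) (m : L -> Prop).
Hypotheses (pr_p : prime p) (mP : prime_over p m).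

Let mp : m p%:R. Proof. by case: mP. Qed.

Let m1 : ~ m 1. Proof. by case: mP. Qed.

Let mD x y : m x -> m y -> m (x + y). Proof. by case: mP => _ _ + _ _; apply. Qed.

Let mMl x y : algint x -> m y -> m (x * y). Proof. by case: mP => _ _ _ + _; apply. Qed.

Let mM x y : algint x -> algint y -> m (x * y) -> m x \/ m y.
Proof. by case: mP => _ _ _ _; apply. Qed.

Lemma prime_over0 : m 0.
Proof. by rewrite -(mul0r p%:R); apply: mMl => //; apply: integral0. Qed.

Lemma prime_overN x : m x -> m (- x).
Proof. by rewrite -mulN1r; apply: mMl; apply: integral_opp; apply: integral1. Qed.

Lemma prime_over_int (n : int) : m n%:~R -> (p %| n)%Z.
Proof.
move=> mn; apply/idPn => pn; apply: m1.
have cop : coprimez n p.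
  by rewrite coprimez_sym coprimezE absz_nat prime_coprime // -dvdz_nat //=.
have [u [v]] := Bezoutz n p; rewrite (eqP cop) => E.
have -> : 1 = u%:~R * n%:~R + v%:~R * p%:R :> L.
  by rewrite -[p%:R]/(p%:Z%:~R) -!rmorphM -rmorphD /= E.
by apply: mD; apply: mMl => //; apply: (integral_id intr).
Qed.

Lemma prime_over_prod (I : eqType) (r : seq I) (F : I -> L) :
  {in r, forall i, algint (F i) /\ ~ m (F i)} ->
  algint (\prod_(i <- r) F i) /\ ~ m (\prod_(i <- r) F i).
Proof.
elim: r => [|i r IH] Fr; first by rewrite big_nil; split=> //; apply: integral1.
have [|OF nF] := IH; first by move=> j jr; apply: Fr; rewrite inE jr orbT.
have [Oi ni] := Fr i (mem_head _ _); rewrite big_cons; split.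
  exact: integral_mul.
by case/mM.
Qed.

Lemma prime_over_expn x n : algint x -> m (x ^+ n) -> m x.
Proof.
move=> Ox; elim: n => [//|n IH]; rewrite exprS => /mM[] //.
by elim: n {IH} => [|n IH]; rewrite ?exprS; [apply: integral1 | apply: integral_mul].
Qed.

(* If no g <> 1 were inertial, products of differences h (c_g) - g (c_g) would give
   a dual basis up to a p-unit u: u x = sum_i a_i Tr (b_i x).  For x = gam all these
   traces lie in p Z, so that u * gam is divisible by p, contradicting the shape of
   gam ^+ 2. *)
Lemma inertia_exists (K : {subfield L}) (gam rho : L) (n : int) :
  galois 1 K -> gam \in K -> algint rho -> ~ m rho -> ~~ (p %| n)%Z ->
  gam ^+ 2 = p%:R * n%:~R * rho ->
  exists2 g : gal_of K, g \in 'Gal(K / 1)%g & g != 1%g /\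
    forall c, c \in K -> algint c -> m (g c - c).
Proof.
move=> galK gamK Orho nmrho pn Dgam; apply: boolp.contrapT => noI.
have p0 : p%:R != 0 :> L by rewrite numfield_natr_eq0 -lt0n prime_gt0.
have /boolp.choice[c cP] : forall g : gal_of K, exists c : L,
    [/\ c \in K, algint c & g != 1%g -> ~ m (g c - c)].
  move=> g; apply: boolp.contrapT => nc; apply: noI; exists g.
    by rewrite gal_kHom ?sub1v // k1AHom.
  split.
    apply/eqP => g1; apply: nc; exists 0; rewrite mem0v g1 eqxx; split=> //.
    exact: integral0.
  move=> c Kc Oc; apply: boolp.contrapT => ncc; apply: nc; exists c; split=> //.
have Og (g : gal_of K) x : algint x -> algint (g x) by apply: (algint_rmorph (gal_repr g)).
(* Multiplies out the product into a sum of terms a * h b in which a and b do not depend on h. *)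
have expand (s : seq (gal_of K)) : exists P : seq (L * L),
   [/\ {in P, forall ab, [/\ ab.2 \in K, algint ab.1 & algint ab.2]}
     & forall h : gal_of K, \sum_(ab <- P) ab.1 * h ab.2 = \prod_(g <- s) (h (c g) - g (c g))].
  elim: s => [|g s [P [PK IH]]].
    exists [:: (1, 1)]; split=> [ab|h]; last by rewrite big_nil big_seq1 /= rmorph1 mulr1.
    by rewrite inE => /eqP->; split; [exact: mem1v | exact: integral1 | exact: integral1].
  exists ([seq (ab.1, c g * ab.2) | ab <- P] ++ [seq (- g (c g) * ab.1, ab.2) | ab <- P]).
  have [Kc Oc _] := cP g; split=> [ab|h].
    rewrite mem_cat => /orP[] /mapP[[a b] /PK[/= Kb Oa Ob] ->]; split=> //=.
    - exact: rpredM.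
    - exact: integral_mul.
    by apply: integral_mul => //; apply: integral_opp; apply: Og.
  rewrite big_cons -IH big_cat !big_map /= mulrBl !mulr_sumr -sumrN.
  congr (_ + _); apply: eq_bigr => ab _; first by rewrite rmorphM mulrCA.
  by rewrite mulNr mulNr mulrA.
pose s := [seq g <- enum 'Gal(K / 1)%g | g != 1%g].
have [P [PK PE]] := expand s.
pose u := \prod_(g <- s) ((1 : gal_of K)%g (c g) - g (c g)).
have [Ou nmu] : algint u /\ ~ m u.
  apply: prime_over_prod => g; rewrite mem_filter gal_id => /andP[g1 _].
  have [_ Oc ncc] := cP g; split; first by apply: integral_sub => //; apply: Og.
  by move/prime_overN; rewrite opprB; apply: ncc.
have PE0 (h : gal_of K) : h \in 'Gal(K / 1)%g -> \sum_(ab <- P) ab.1 * h ab.2 = u *+ (h == 1%g).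
  move=> Gh; rewrite PE; have [->//|h1] := eqVneq h 1%g.
  apply/eqP; rewrite prodf_seq_eq0; apply/hasP; exists h; last by rewrite /= subrr.
  by rewrite mem_filter h1 mem_enum.
have TrE x : x \in K -> \sum_(ab <- P) ab.1 * galTrace 1 K (ab.2 * x) = u * x.
  move=> Kx; under eq_bigr do rewrite mulr_sumr.
  rewrite exchange_big (bigD1 (1 : gal_of K)%g) ?group1 //= [X in _ + X]big1 => [|h /andP[Gh h1]].
    rewrite addr0 (eq_bigr (fun ab => ab.1 * (1 : gal_of K)%g ab.2 * x)).
      by rewrite -mulr_suml PE0 ?group1 // eqxx.
    by move=> ab _; rewrite !gal_id mulrA.
  rewrite (eq_bigr (fun ab => ab.1 * h ab.2 * h x)).
    by rewrite -mulr_suml PE0 // (negPf h1) mulr0n mul0r.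
  by move=> ab _; rewrite rmorphM mulrA.
have Ogam : algint gam.
  have mon : 'X^2 - (gam ^+ 2)%:P \is monic by apply: monicXnsubC.
  apply: (integral_root_monic mon); first by rewrite rootE !hornerE subrr.
  apply/integral_poly => i; rewrite coefB coefXn coefC.
  apply: integral_sub; first exact: integral_nat.
  case: (i == 0)%N; last exact: integral0.
  rewrite Dgam; apply: integral_mul => //; apply: integral_mul; first exact: integral_nat.
  exact: (integral_id intr).
(* Every conjugate of [gam] has a square divisible by p; hence the traces below are rational
   integers in m. *)
have mgam (h : gal_of K) : m (h gam).
  apply: (@prime_over_expn _ 2); first exact: Og.
  rewrite -rmorphXn Dgam !rmorphM rmorph_nat rmorph_int -mulrA mulrC; apply: mMl => //.
  by apply: integral_mul; [apply: (integral_id intr) | apply: Og].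
have TrP ab : ab \in P -> exists z : int, galTrace 1 K (ab.2 * gam) = p%:R * z%:~R.
  move=> abP; have [Kb _ Ob] := PK ab abP.
  have [n1 Dn1] : exists n1 : int, galTrace 1 K (ab.2 * gam) = n1%:~R.
    apply: algint_rat; last by rewrite (mem_galTrace galK) ?rpredM.
    rewrite /galTrace; elim/big_ind: _ => [|y z|h _]; [exact: integral0 | exact: integral_add | ].
    by apply: Og; apply: integral_mul.
  have : m n1%:~R.
    rewrite -Dn1 /galTrace; elim/big_ind: _ => [|y z|h _]; [exact: prime_over0 | exact: mD | ].
    by rewrite rmorphM; apply: mMl; [apply: Og | apply: mgam].
  case/prime_over_int/dvdzP => z Dz; exists z.
  by rewrite Dn1 Dz rmorphM mulrC.
have [d Od Dd] : exists2 d, algint d & u * gam = p%:R * d.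
  rewrite -TrE //; elim: (P) PK TrP => [|ab P' IH] PK' TrP'.
    by exists 0; [apply: integral0 | rewrite big_nil mulr0].
  have [||d Od Dd] := IH; first by move=> y yP; apply: PK'; rewrite inE yP orbT.
    by move=> y yP; apply: TrP'; rewrite inE yP orbT.
  have [_ Oa _] := PK' ab (mem_head _ _); have [z Dz] := TrP' ab (mem_head _ _).
  exists (ab.1 * z%:~R + d).
    by apply: integral_add => //; apply: integral_mul => //; apply: (integral_id intr).
  by rewrite big_cons Dd Dz mulrDr mulrCA.
(* Squaring [u * gam = p * d] and dividing by p leaves a product in m of three factors u^2, n and
   rho, none of which is in m. *)
have E : p%:R * d ^+ 2 = u ^+ 2 * (n%:~R * rho).
  apply: (mulfI p0); rewrite [RHS]mulrCA (mulrA p%:R n%:~R) -Dgam -exprMn Dd exprMn.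
  by rewrite mulrA -expr2.
have : m (u ^+ 2 * (n%:~R * rho)).
  by rewrite -E mulrC; apply: mMl => //; rewrite expr2; apply: integral_mul.
have On : algint (n%:~R : L) by apply: (integral_id intr).
have Ou2 : algint (u ^+ 2) by rewrite expr2; apply: integral_mul.
move=> mu; case: (mM Ou2 (integral_mul On Orho) mu) => [/(prime_over_expn Ou)//|].
by move=> mnr; case: (mM On Orho mnr) => // /prime_over_int; apply/negP.
Qed.

End PrimeOver.

(** * Prime factors of numbers that are 7 modulo 8 *)

Section OddValuation.
Local Open Scope nat_scope.

(** The primes 3, 11 and 17 are 3, 3 and 1 modulo 8, and odd squares are 1, so all the factors lie
    in the subgroup {1, 3} of the units modulo 8. The induction splits off the least prime factor if
    it is exceptional, and its square otherwise. *)
Lemma odd_valuation_mod8 n : odd n ->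
  (forall p, prime p -> p \notin [:: 2; 3; 11; 17] -> ~~ odd (logn p n)) ->
  n %% 8 \in [:: 1; 3].
Proof.
have [k] := ubnP n; elim: k n => // k IH n le_nk odd_n ev.
have n0 : 0 < n by case: n odd_n {le_nk ev}.
have [n1|n1] := leqP n 1; first by have -> : n = 1 by lia.
have step d n' : n = d * n' -> 1 < d -> odd d -> d %% 8 \in [:: 1; 3] ->
   (forall p, prime p -> p \notin [:: 2; 3; 11; 17] -> ~~ odd (logn p d)) ->
   n %% 8 \in [:: 1; 3].
  move=> Dn d1 oddd d8 evd.
  have n'0 : 0 < n' by case: n' Dn n0 => // ->; rewrite muln0.
  have : n' %% 8 \in [:: 1; 3].
    apply: IH => [||p pp pN]; first by rewrite (leq_trans _ (_ : n <= k)) // Dn ltn_Pmull.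
      by move: odd_n; rewrite Dn oddM => /andP[].
    have := ev p pp pN; rewrite Dn lognM ?(ltnW d1) // oddD (negPf (evd p pp pN)).
    by [].
  rewrite Dn -modnMm; move: d8; rewrite !inE => /orP[] /eqP -> /orP[] /eqP -> //.
set p := pdiv n; have pp : prime p by apply: pdiv_prime.
have oddp : odd p.
  by apply: contraLR odd_n; rewrite -!dvdn2 => ep; apply: dvdn_trans ep (pdiv_dvd n).
have [pS|pN] := boolP (p \in [:: 2; 3; 11; 17]).
  have /dvdnP[n' Dn] := pdiv_dvd n; rewrite mulnC in Dn.
  apply: (step p n') => //; first exact: prime_gt1.
    by move: pS oddp; rewrite !inE => /or4P[] /eqP ->.
  move=> q qq qN; rewrite lognE qq prime_gt0 //=; case: ifP => // qp.
  by move: qp; rewrite dvdn_prime2 // => /eqP qp; rewrite qp pS in qN.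
have /dvdnP[n' Dn] : p ^ 2 %| n.
  rewrite pfactor_dvdn //; have := ev p pp pN.
  have : 0 < logn p n by rewrite logn_gt0 mem_primes pp n0 pdiv_dvd.
  by case: (logn p n) => [|[]].
rewrite mulnC in Dn.
apply: (step (p ^ 2) n') => //.
- by rewrite -{1}(exp1n 2) ltn_exp2r // prime_gt1.
- by rewrite oddX oddp.
- rewrite -modnXm; have : p %% 8 < 8 by apply: ltn_pmod.
  have : odd (p %% 8) by move: oddp; rewrite {1}(divn_eq p 8) oddD oddM andbF.
  by case: (p %% 8) => [|[|[|[|[|[|[|[|]]]]]]]].
by move=> q qq qN; rewrite lognX oddM.
Qed.

Lemma odd_valuation_prime n : n %% 8 = 7 ->
  exists p, [/\ prime p, p \notin [:: 2; 3; 11; 17] & odd (logn p n)].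
Proof.
move=> n7; have n0 : 0 < n by case: n n7.
have odd_n : odd n by rewrite (divn_eq n 8) n7 oddD oddM andbF.
have [/hasP[p]|nh] := boolP (has (fun p => (p \notin [:: 2; 3; 11; 17]) && odd (logn p n)) (primes n)).
  by rewrite mem_primes => /and3P[pp _ _] /andP[pN o]; exists p.
suff: 7 \in [:: 1; 3] by [].
rewrite -n7; apply: odd_valuation_mod8 => // p pp pN; apply/negP => o.
case/hasP: nh; exists p; last by rewrite pN.
by rewrite -logn_gt0; case: (logn p n) o.
Qed.

End OddValuation.

(** * Roots of the septic that coincide modulo a prime *)

Definition sept''E (R : comNzRingType) (s x : R) : R :=
 42 * x ^+ 5 - 150 * x ^+ 4 - 60 * x ^+ 3 + 96 * x ^+ 2 + 36 * x - 6
  + s * (12 * x ^+ 2 + 6 * x).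

Lemma deriv_Poly_nth (R : nzRingType) (c : seq R) :
  (Poly c)^`() = Poly (mkseq (fun i => c`_i.+1 *+ i.+1) (size c).-1).
Proof.
apply/polyP=> i; rewrite coef_deriv !coef_Poly.
have [li|li] := ltnP i (size c).-1; first by rewrite nth_mkseq.
rewrite [in RHS]nth_default ?size_mkseq // nth_default ?mul0rn //.
by case: (size c) li.
Qed.

Lemma sept_deriv (R : comNzRingType) (s x : R) :
  (sept s)^`().[x] = sept'E s x /\ (sept s)^`()^`().[x] = sept''E s x.
Proof.
rewrite /sept !deriv_Poly_nth !horner_Poly /= /sept'E /sept''E.
by split; ring.
Qed.

Lemma algint_deriv_prod (L : fieldExtType rat) (a : L) (r : seq L) : algint a ->
  {in r, forall b, algint b} ->
  algint (\prod_(b <- r) (a - b)) /\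
  algint (\prod_(b <- r) ('X - b%:P))^`().[a].
Proof.
move=> Oa; elim: r => [_|b r IH Or].
  by rewrite !big_nil derivC horner0; split; [apply: integral1 | apply: integral0].
have [|OP OD] := IH; first by move=> c cr; apply: Or; rewrite inE cr orbT.
have Oab : algint (a - b) by apply: integral_sub => //; apply: Or; apply: mem_head.
rewrite !big_cons; split; first exact: integral_mul.
rewrite derivM derivXsubC mul1r hornerD hornerM hornerXsubC horner_prod.
under eq_bigr do rewrite hornerXsubC.
by apply: integral_add => //; apply: integral_mul.
Qed.

Section CriticalPoints.
Variables (L : splittingFieldType rat) (p : nat) (m : L -> Prop).
Hypotheses (pr_p : prime p) (mP : prime_over p m).
Let mD x y : m x -> m y -> m (x + y). Proof. by case: mP => _ _ + _ _; apply. Qed.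

Let mMl x y : algint x -> m y -> m (x * y). Proof. by case: mP => _ _ _ + _; apply. Qed.

Lemma double_root (r : seq L) a b : uniq r -> a \in r -> b \in r -> a != b ->
  {in r, forall c, algint c} -> m (a - b) ->
  m (\prod_(c <- r) ('X - c%:P))^`().[a].
Proof.
move=> Ur ar br ab Or mab; rewrite (big_rem a) //= (big_rem b) /=; last first.
  by rewrite mem_rem_uniq // inE eq_sym ab.
rewrite derivM derivXsubC mul1r hornerD !hornerM !hornerXsubC subrr mul0r addr0.
rewrite mulrC; apply: mMl => //.
rewrite horner_prod; under eq_bigr do rewrite hornerXsubC.
apply: (algint_deriv_prod (Or a ar) _).1 => c cr; apply: Or.
by apply: mem_rem (mem_rem cr).
Qed.

Lemma triple_root (r : seq L) a b c : uniq r -> a \in r -> b \in r -> c \in r ->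
  a != b -> a != c -> b != c -> {in r, forall c, algint c} -> m (a - b) -> m (a - c) ->
  m (\prod_(c <- r) ('X - c%:P))^`()^`().[a].
Proof.
move=> Ur ar br cr ab ac bc Or mab mac.
have Ura : uniq (rem a r) by apply: rem_uniq.
have bra : b \in rem a r by rewrite mem_rem_uniq // inE eq_sym ab.
have crab : c \in rem b (rem a r).
  by rewrite mem_rem_uniq // inE eq_sym bc mem_rem_uniq // inE eq_sym ac.
rewrite (big_rem a) //= (big_rem b) //= (big_rem c) //=.
set G := \prod_(_ <- _) _.
have [OG OG'] : algint G.[a] /\ algint G^`().[a].
  rewrite {1}/G horner_prod; under eq_bigr do rewrite hornerXsubC.
  apply: algint_deriv_prod => [|d dr]; apply: Or => //.
  by apply: mem_rem (mem_rem (mem_rem dr)).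
have -> : ('X - a%:P) * (('X - b%:P) * (('X - c%:P) * G)) =
   ('X - a%:P) * ('X - b%:P) * ('X - c%:P) * G by rewrite !mulrA.
have D1 : (1 : {poly L})^`() = 0 by apply: derivC.
have H1 : (1 : {poly L}).[a] = 1 by apply: hornerC.
rewrite !(derivM, derivD, derivN, derivX, derivC, D1) oppr0 addr0.
rewrite !(hornerM, hornerD, hornerN, hornerX, hornerC, horner0, H1).
have Oab : algint (a - b) by apply: integral_sub; apply: Or.
rewrite (_ : _ + _ = 2 * G.[a] * (a - b) + (2 * G.[a] + 2 * G^`().[a] * (a - b)) * (a - c)); last first.
  ring.
have O2 : algint (2 : L) by apply: integral_nat.
apply: mD; apply: mMl => //; first exact: integral_mul.
by apply: integral_add; do ?[apply: integral_mul].
Qed.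

Lemma bad_prime_notin (e : nat) n1 n2 n3 n4 : p \notin [:: 2; 3; 11; 17]%N ->
  ~ m (2 ^+ n1 * 3 ^+ n2 * 11 ^+ n3 * 17 ^+ n4).
Proof.
move=> pN /=; rewrite -!natrX -!natrM => /(prime_over_int (n := Posz _) pr_p mP).
rewrite dvdzE /= !Euclid_dvdM // !Euclid_dvdX //.
by move: pN; rewrite !inE; do 4![rewrite dvdn_prime2 //; case: eqP => //= _].
Qed.

End CriticalPoints.

(** Division of [septE] by w and by w + 1 leaves the remainder -1 both times, its value at 0 and at
    -1. So w and w + 1 are units. *)
Lemma sept_units (R : comNzRingType) (s w : R) : septE s w = 0 ->
  w * (w ^+ 6 - 5 * w ^+ 5 - 3 * w ^+ 4 + 8 * w ^+ 3 + 6 * w ^+ 2 - 3 * w - 4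
       + s * (w ^+ 2 * (w + 1))) = 1 /\
  (w + 1) * (w ^+ 6 - 6 * w ^+ 5 + 3 * w ^+ 4 + 5 * w ^+ 3 + w ^+ 2 - 4 * w + s * w ^+ 3) = 1.
Proof.
rewrite /septE => sw.
by split; apply/eqP; rewrite -subr_eq0; apply/eqP; rewrite -[RHS]sw; ring.
Qed.

Lemma algint_sept (L : fieldExtType rat) (z : int) (w : L) : root (sept z%:~R) w -> algint w.
Proof.
move=> rw; exists (sept z); first exact: monic_sept.
by rewrite map_sept.
Qed.

Lemma sqrt_disc_sym (R : comNzRingType) (u : R) : sqrt_disc (1 - u) = sqrt_disc u.
Proof. by rewrite /sqrt_disc; ring. Qed.

Lemma sqrt_disc_rmorph (R S : comNzRingType) (f : {rmorphism R -> S}) u : f (sqrt_disc u) = sqrt_disc (f u).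
Proof.
rewrite /sqrt_disc rmorphB; congr (_ - _); last by rewrite rmorph_nat.
rewrite rmorphD; congr (_ + _); last by rewrite rmorphM rmorph_nat.
rewrite rmorphB; congr (_ - _); last by rewrite rmorphM rmorph_nat rmorphXn.
rewrite rmorphB; congr (_ - _); last by rewrite rmorphM rmorph_nat rmorphXn.
by rewrite rmorphM rmorph_nat rmorphXn.
Qed.

(** The sign matters: a negative value would have absolute value 1 modulo 8, which forces no prime
    factor of the required kind. *)
Lemma sqrt_disc_mod8 (t : int) : (0 <= sqrt_disc (4 * t))%R ->
  exists N : nat, sqrt_disc (4 * t) = N%:Z /\ (N %% 8 = 7)%N.
Proof.
move=> P0; exists `|sqrt_disc (4 * t)|%N; split; first by rewrite gez0_abs.
have E : sqrt_disc (4 * t) = 8 * (864 * t ^+ 4 - 432 * t ^+ 3 - 11934 * t ^+ 2 + 2997 * t - 178) + 7.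
  by rewrite /sqrt_disc; ring.
move: P0; rewrite E; lia.
Qed.

Lemma algintX (L : fieldExtType rat) (x : L) n : algint x -> algint (x ^+ n).
Proof.
move=> Ox; elim: n => [|n IH]; first exact: integral1.
by rewrite exprS; apply: integral_mul.
Qed.

Ltac algint_tac :=
  repeat lazymatch goal with
  | |- integralOver _ (_ + _) => apply: integral_add
  | |- integralOver _ (- _) => apply: integral_opp
  | |- integralOver _ (_ * _) => apply: integral_mul
  | |- integralOver _ (_ ^+ _) => apply: algintX
  | |- integralOver _ (_%:R) => exact: integral_nat
  | |- integralOver _ 1 => exact: integral1
  | |- integralOver _ _ => assumption
  end.

Ltac mem_tac :=
  repeat lazymatch goal with
  | |- is_true (_ + _ \in _) => apply: rpredD
  | |- is_true (- _ \in _) => rewrite rpredN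
  | |- is_true (_ * _ \in _) => apply: rpredM
  | |- is_true (_ ^+ _ \in _) => apply: rpredX
  | |- is_true (_%:R \in _) => exact: rpred_nat
  | |- is_true (1 \in _) => exact: rpred1
  | |- is_true (_ \in _) => assumption
  end.

Section Inertia.
Variables (L : splittingFieldType rat) (t : int) (ws : 7.-tuple L).
Hypotheses (Dws : splits (sept (1 - 4 * t%:~R)) ws)
  (vdm_ws : vdm ws ^+ 2 = sqrt_disc (4 * t%:~R) ^+ 2) (P0 : 0 <= sqrt_disc (4 * t)).
Let K : {subfield L} := <<1 & ws>>%AS.
Let s : L := 1 - 4 * t%:~R.

Let Os : algint s.
Proof.
rewrite /s; apply: integral_sub; first exact: integral1.
by apply: integral_mul; [apply: integral_nat | apply: (integral_id intr)].
Qed.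

Let rws w : w \in ws -> septE s w = 0.
Proof. by rewrite -root_prod_XsubC -Dws rootE horner_sept => /eqP. Qed.

Let Ows w : w \in ws -> algint w.
Proof.
rewrite -root_prod_XsubC -Dws => rw; apply: (@algint_sept _ (1 - 4 * t)).
by rewrite rmorphB rmorph1 rmorphM.
Qed.

(* A root a that coincides with another one modulo m is a zero of the derivative,
   whose square is, up to units and the cofactor, the discriminant. *)
Lemma inertial_involution : exists p m,
  [/\ prime p, p \notin [:: 2; 3; 11; 17]%N, prime_over p m &
  exists2 g : gal_of K, g \in 'Gal(K / 1)%g & [/\ g != 1%g,
    forall c, c \in K -> algint c -> m (g c - c) & {in ws, forall w, g (g w) = w}]].
Proof.
have [N [DN N7]] := sqrt_disc_mod8 P0; have [p [pp pN oddp]] := odd_valuation_prime N7.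
have N0 : (0 < N)%N by case: (N) N7.
have [m mP] := @prime_over_exists L p pp; exists p, m; split=> //.
have [mp m1 mD mMl mM] := mP.
have PN : sqrt_disc (4 * t%:~R) = N%:R :> L.
  by rewrite -[RHS]/(N%:Z%:~R) -DN (sqrt_disc_rmorph intr); congr sqrt_disc; rewrite rmorphM rmorph_nat.
have [n' n'p DNp] : exists2 n', ~~ (p %| n')%N & N = (p ^ logn p N * n')%N.
  exists (N %/ p ^ logn p N)%N; last by rewrite mulnC divnK // pfactor_dvdnn.
  apply/negP => pd; have := pfactor_dvdn (logn p N).+1 pp N0.
  rewrite ltnn => /negP; apply; case/dvdnP: pd => c Dc; apply/dvdnP; exists c.
  by rewrite expnS mulnA -Dc divnK ?pfactor_dvdnn.
have nbad n1 n2 n3 n4 := @bad_prime_notin L p m pp mP 0 n1 n2 n3 n4 pN.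
(* If the roots were distinct modulo m, [vdm ws] would not lie in m, although its square is
   divisible by p. *)
have [a [b [aw bw ab mab]]] : exists a b, [/\ a \in ws, b \in ws, a != b & m (a - b)].
  apply: boolp.contrapT => nab.
  have nf (i j : 'I_7) : i != j -> algint (tnth ws j - tnth ws i) /\ ~ m (tnth ws j - tnth ws i).
    move=> ij; split; first by apply: integral_sub; apply: Ows; apply: mem_tnth.
    move=> mij; apply: nab; exists (tnth ws j), (tnth ws i); split; rewrite ?mem_tnth //.
    by rewrite !(tnth_nth 0) nth_uniq ?size_tuple ?(dual_uniq Dws) // eq_sym.
  have [Ov] : algint (vdm ws) /\ ~ m (vdm ws).
    rewrite /vdm det_Vandermonde; apply: (prime_over_prod mP) => i _.
    rewrite -big_filter; apply: (prime_over_prod mP) => j; rewrite mem_filter !mxE => /andP[ij _].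
    by apply: nf; rewrite neq_ltn ij.
  apply; apply: (prime_over_expn mP (n := 2)) => //; rewrite vdm_ws PN.
  have /dvdnP[c ->] : (p %| N)%N by rewrite DNp dvdn_mulr // dvdn_exp //; case: logn oddp.
  by rewrite expr2 natrM; apply: (mMl); [algint_tac | apply: (mMl) => //; algint_tac].
have Uws := dual_uniq Dws.
have mF' : m (sept'E s a).
  by rewrite -(sept_deriv s a).1 Dws; apply: (double_root mP _ _ bw).
have mcrit : m (crit a).
  rewrite (crit_sept s) rws // mulr0 subr0; apply: (mMl) => //.
  by apply: integral_mul; [apply: Ows | apply: integral_add; [apply: Ows | apply: integral1]].
have nrest : ~ m (disc_cofactor a).
  move=> mr; apply: (nbad 0 2 1 2); rewrite expr0 mul1r expr1 -(crit_disc_cofactor_bezout a).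
  have Oa := Ows aw.
  by apply: (mD); apply: (mMl) => //; algint_tac.
have Oa := Ows aw; have [ua ua1] := sept_units (rws aw).
have nu x y : algint y -> x * y = 1 -> ~ m x.
  by move=> Oy xy mx; apply: m1; rewrite -xy mulrC; apply: (mMl).
have nma : ~ m a by apply: (nu) ua; algint_tac.
have nma1 : ~ m (a + 1) by apply: (nu) ua1; algint_tac.
set U := a ^+ 10 * (a + 1) ^+ 2.
have Orest : algint (disc_cofactor a) by rewrite /disc_cofactor; algint_tac.
have OU : algint U by rewrite /U; algint_tac.
have nU : ~ m U.
  have O1 : algint (a + 1) by algint_tac.
  by case/mM; [algint_tac | algint_tac | move/(prime_over_expn mP Oa) | move/(prime_over_expn mP O1)].
have aK : a \in K by rewrite seqv_sub_adjoin.
have natK n : n%:R \in K by rewrite rpred_nat.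
pose e := (logn p N)./2.
have De : (p ^ logn p N = p * (p ^ e) ^ 2)%N.
  by rewrite -{1}(odd_double_half (logn p N)) oddp expnD -muln2 expnM.
have p0 : p%:R != 0 :> L by rewrite numfield_natr_eq0 -lt0n prime_gt0.
have sK : s \in K by rewrite /s rpredB ?rpred1 ?rpredM ?rpred_int ?natK.
(* By [sqrt_disc_sept] the square of F'(a)^2 times the cofactor is N U, where F' is [sept'E]; more
   precisely F'(a)^2 * [disc_cofactor a] = N U. Multiplying by the cofactor and dividing by p^(2e)
   makes the left side a square and the right side p n' times an element outside m. *)
have [||||||g Gg [g1 gI]] := @inertia_exists L p m pp mP K (sept'E s a * disc_cofactor a / (p ^ e)%:R) (U * disc_cofactor a) n'.
- exact: (dual_galois Dws).
- rewrite rpredM ?rpredV ?natK // rpredM //.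
    by rewrite /sept'E; mem_tac.
  by rewrite /disc_cofactor; mem_tac.
- exact: integral_mul.
- by case/mM.
- by [].
- have E : sept'E s a ^+ 2 * disc_cofactor a = N%:R * U.
    by rewrite -(sqrt_disc_sept (rws aw)) /s sqrt_disc_sym PN.
  rewrite !exprMn exprVn -natrX [disc_cofactor a ^+ 2]expr2 mulrA E.
  rewrite [in LHS]DNp De !natrM; field.
  by rewrite natrX expf_neq0.
exists g => //; split=> // w ww.
have gws x : x \in ws -> g x \in ws.
  rewrite -!root_prod_XsubC -Dws => rx.
  have := rx; rewrite -(fmorph_root (gal_repr g)) map_sept.
  by rewrite rmorphB rmorph1 rmorphM rmorph_nat rmorph_int.
(* Otherwise w, [g w] and [g (g w)] are three distinct roots congruent modulo m, so that the first
   and the second derivative of the septic both lie in m at [g w]. *)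
apply/eqP/negPn/negP => ggw.
have wK x : x \in ws -> x \in K by move=> xw; rewrite seqv_sub_adjoin.
have gw : g w != w by apply: contra ggw => /eqP gw; rewrite !gw.
have gwI x : m (x - g x) <-> m (g x - x).
  by split=> /(prime_overN mP); rewrite opprB.
have mgw : m (g w - w) by apply: gI; [apply: wK | apply: Ows].
have mggw : m (g w - g (g w)).
  by apply/gwI/gI; [apply/wK/gws | apply/Ows/gws].
have mF1 : m (sept'E s (g w)).
  rewrite -(sept_deriv s (g w)).1 Dws.
  by apply: (double_root mP Uws (gws _ ww) ww).
have mF2 : m (sept''E s (g w)).
  rewrite -(sept_deriv s (g w)).2 Dws.
  apply: (triple_root mP Uws (gws _ ww) ww (gws _ (gws _ ww))) => //.
    by apply: contra gw => /eqP/(fmorph_inj (gal_repr g))/eqP; rewrite eq_sym.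
  by rewrite eq_sym.
have Ogw := Ows (gws _ ww).
apply: (nbad 1 1 1 2); rewrite !expr1 -(crit_crit_deriv_bezout (g w)).
have D1 : crit (g w) = (g w) * (g w + 1) * sept'E s (g w).
  by rewrite (crit_sept s) rws ?gws // mulr0 subr0.
(* The derivative of the identity [crit_sept]; its remaining term is - 4 times the septic, which
   vanishes at the root [g w]. *)
have D2 : crit' (g w) = (2 * g w + 1 - (4 * g w + 3)) * sept'E s (g w)
    + (g w * (g w + 1)) * sept''E s (g w).
  rewrite -[LHS]addr0 -(mulr0 4) -{1}(rws (gws _ ww)) /crit' /sept'E /sept''E /septE.
  ring.
apply: (mD); apply: (mMl); [algint_tac | | algint_tac | ].
  by rewrite D1; apply: (mMl) => //; algint_tac.
by rewrite D2; apply: (mD); apply: (mMl) => //; algint_tac.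
Qed.

End Inertia.

(** * Permutation groups of degree 7 and 8 *)

Section PermutationGroups.
Local Open Scope nat_scope.
Local Open Scope group_scope.

Lemma order7_orbit (T : finType) (s : {perm T}) i0 : #[s] = 7 -> s i0 != i0 ->
  #|porbit s i0| = 7.
Proof.
move=> os si0; have : #|porbit s i0| %| 7.
  by rewrite -os /order porbitE; apply: dvdn_orbit.
case/primeP: (isT : prime 7) => _ /[apply] /pred2P[] // /eqP/cards1P[j Dj].
have : s i0 \in porbit s i0 by rewrite -{1}(expg1 s) mem_porbit.
have := porbit_id s i0; by rewrite Dj !inE => /eqP ij /eqP sj; rewrite sj ij eqxx in si0.
Qed.

Lemma order7_perm8 (s : 'S_8) : #[s] = 7 ->
  exists y0, s y0 = y0 /\ forall i j, i != y0 -> j != y0 -> exists k, j = (s ^+ k) i.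
Proof.
move=> os; have [i0 si0] : exists i0, s i0 != i0.
  apply/existsP; apply: contraTT isT => /existsPn nf; move: os.
  by rewrite (_ : s = 1) ?order1 //; apply/permP=> i; rewrite perm1; apply/eqP/negPn/nf.
have c7 := order7_orbit os si0.
have /eqP/cards1P[y0 Dy0] : #|~: porbit s i0| = 1%N.
  by rewrite cardsCs setCK c7 card_ord.
have inO i : (i != y0) = (i \in porbit s i0) by rewrite -[RHS]negbK -in_setC Dy0 inE.
exists y0; split.
  apply/eqP/negPn/negP; rewrite inO => /porbitP[k Dk].
  have : y0 \in porbit s i0.
    apply/porbitP; exists (k + 6)%N; rewrite expgD permM -Dk -permM -expgS.
    by have := expg_order s; rewrite os => ->; rewrite perm1.
  by rewrite -inO eqxx.
move=> i j; rewrite !inO => ii jj; apply/porbitP.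
by have /eqP-> : porbit s i == porbit s i0 by rewrite eq_porbit_mem.
Qed.

Section NormalOrbits.
Variables (gT : finGroupType) (G N : {group gT}) (T : finType).
Variables (f : {morphism G >-> {perm T}}) (x : gT).
Hypotheses (Gx : x \in G) (nN : N <| G) (fx7 : f x ^+ 7 = 1).
Let sNG := subsetP (normal_sub nN).

Definition same_orbit i j := exists2 y, y \in N & f y i = j.

Lemma same_orbit_refl i : same_orbit i i.
Proof. by exists 1; rewrite ?group1 // morph1 perm1. Qed.

Lemma same_orbit_trans i j k : same_orbit i j -> same_orbit j k -> same_orbit i k.
Proof.
move=> [y Ny <-] [z Nz <-]; exists (y * z); first exact: groupM.
by rewrite morphM ?sNG // permM.
Qed.

Lemma same_orbit_sym i j : same_orbit i j -> same_orbit j i.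
Proof.
move=> [y Ny <-]; exists y^-1; first by rewrite groupV.
by rewrite morphV ?sNG // permK.
Qed.

Lemma same_orbit_shift k i j : same_orbit i j -> same_orbit ((f x ^+ k) i) ((f x ^+ k) j).
Proof.
have Gy : x ^+ k \in G by apply: groupX.
move=> [z Nz <-]; exists (z ^ (x ^+ k)).
  by rewrite memJ_norm // (subsetP (normal_norm nN)).
by rewrite -morphX // morphJ ?permJ //; apply: sNG.
Qed.

(** By normality the relation is preserved by [f x], so it propagates in steps of k. As k is prime
    to 7, with inverse k^5 by Fermat, these steps reach every power. *)
Lemma same_orbit_cycle i k : same_orbit i ((f x ^+ k) i) -> (f x ^+ k) i != i ->
  forall l, same_orbit i ((f x ^+ l) i).
Proof.
move=> ik nik l; have k7 : coprime 7 k.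
  rewrite prime_coprime //; apply: contra nik => /dvdnP[d ->].
  by rewrite mulnC expgM fx7 expg1n perm1.
have step e : same_orbit i ((f x ^+ (k * e)) i).
  elim: e => [|e IH]; first by rewrite muln0 perm1; apply: same_orbit_refl.
  apply: same_orbit_trans IH _; have := same_orbit_shift (k * e) ik.
  by rewrite -permM -expgD mulnS.
have E : k * (k ^ 5 * l) = l %[mod 7].
  rewrite mulnA -expnS -modnMml (_ : k ^ 6 %% 7 = 1 %% 7)%N ?modnMml ?mul1n //.
  by apply: (@Euler_exp_totient k 7); rewrite coprime_sym.
by have := step (k ^ 5 * l)%N; rewrite -(expg_mod _ fx7) E expg_mod.
Qed.

End NormalOrbits.

(** The element [f x] fixes one point y0, permutes the other seven cyclically, and permutes the
    orbits of N. If N moves y0, the orbit of y0 is carried around the whole cycle; if N fixes y0 but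
    moves another point, [same_orbit_cycle] applies. *)
Lemma normal_degree8 (gT : finGroupType) (G N : {group gT}) (f : {morphism G >-> 'S_8}) x :
  x \in G -> #[f x] = 7 -> N <| G ->
  [\/ forall y, y \in N -> f y = 1,
      exists2 y0, (forall y, y \in N -> f y y0 = y0) &
        (forall i j, i != y0 -> j != y0 -> same_orbit N f i j)
   | forall i j, same_orbit N f i j].
Proof.
move=> Gx ox nN.
have fx7 : f x ^+ 7 = 1 by have := expg_order (f x); rewrite ox.
have [y0 [fix0 tr]] := order7_perm8 ox.
have fix0k k : (f x ^+ k) y0 = y0 by elim: k => [|k IH]; rewrite ?perm1 // expgSr permM IH.
have [/existsP[y /andP[Ny yy0]]|/existsPn nf] := boolP [exists y, (y \in N) && (f y y0 != y0)].
  have H j : same_orbit N f y0 j.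
    have [->|jy0] := eqVneq j y0; first exact: same_orbit_refl.
    have [k ->] := tr _ _ yy0 jy0.
    by rewrite -{1}(fix0k k); apply: same_orbit_shift => //; exists y.
  by constructor 3 => i j; apply: (same_orbit_trans nN) (H j); apply: (same_orbit_sym nN).
have fixN y : y \in N -> f y y0 = y0.
  by move=> Ny; have := nf y; rewrite Ny /= negbK => /eqP.
have [/existsP[y /existsP[i /andP[Ny yi]]]|/existsPn nf'] :=
    boolP [exists y, exists i, (y \in N) && (f y i != i)].
  constructor 2; exists y0 => //.
  have iy0 : i != y0 by apply: contra yi => /eqP ->; rewrite fixN.
  have fyy0 : f y i != y0.
    by apply: contra iy0 => /eqP E; rewrite -(inj_eq (@perm_inj _ (f y))) E fixN.
  have [k Dk] := tr _ _ iy0 fyy0.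
  have H j : j != y0 -> same_orbit N f i j.
    move=> jy0; have [l ->] := tr _ _ iy0 jy0.
    by apply: (same_orbit_cycle Gx nN fx7 (k := k)); rewrite -Dk //; exists y.
  by move=> j1 j2 /H H1 /H H2; apply: (same_orbit_trans nN) H2; apply: (same_orbit_sym nN).
constructor 1 => y Ny; apply/permP=> i; rewrite perm1; apply/eqP.
by have /existsPn/(_ i) := nf' y; rewrite Ny negbK.
Qed.

Lemma same_orbit_dvd (gT : finGroupType) (G N : {group gT}) (T : finType)
    (f : {morphism G >-> {perm T}}) (i : T) : N \subset G ->
  (forall j, same_orbit N f i j) -> #|T| %| #|N|.
Proof.
move=> sNG tr; apply: dvdn_trans (dvdn_morphim f N).
have -> : #|T| = #|orbit 'P (f @* N) i|.
  rewrite -cardsT; apply: eq_card => j; rewrite inE; apply/esym/orbitP.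
  have [y Ny Dj] := tr j; exists (f y); last exact: Dj.
  by apply: mem_morphim => //; apply: (subsetP sNG).
exact: dvdn_orbit.
Qed.

Lemma order7_perm7 (s : 'S_7) : #[s] = 7 -> forall i j, exists k, j = (s ^+ k) i.
Proof.
move=> os; have [i0 si0] : exists i0, s i0 != i0.
  apply/existsP; apply: contraTT isT => /existsPn nf; move: os.
  by rewrite (_ : s = 1) ?order1 //; apply/permP=> i; rewrite perm1; apply/eqP/negPn/nf.
have c7 := order7_orbit os si0.
have inO i : i \in porbit s i0.
  have : porbit s i0 == setT by rewrite eqEcard subsetT cardsT c7 card_ord.
  by move/eqP->; rewrite inE.
move=> i j; apply/porbitP.
by have /eqP-> : porbit s i == porbit s i0 by rewrite eq_porbit_mem.
Qed.

Lemma normal_degree7 (gT : finGroupType) (G N : {group gT}) (f : {morphism G >-> 'S_7}) x :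
  x \in G -> #[f x] = 7 -> N <| G -> ~~ (7 %| #|N|) -> forall y, y \in N -> f y = 1.
Proof.
move=> Gx ox nN n7 y Ny; apply/permP=> i; rewrite perm1; apply/eqP/negPn/negP=> yi.
have fx7 : f x ^+ 7 = 1 by have := expg_order (f x); rewrite ox.
have tr := order7_perm7 ox; have [k Dk] := tr i (f y i).
case/negP: n7; rewrite -(card_ord 7); apply: (same_orbit_dvd (normal_sub nN) (f := f) (i := i)) => j.
have [l ->] := tr i j.
by apply: (same_orbit_cycle Gx nN fx7 (k := k)); rewrite -Dk //; exists y.
Qed.

(** Such a u is a reflection of the heptagon: it fixes a point i0, exchanges s^l i0 with s^(-l) i0,
    and so is a product of three transpositions. *)
Lemma inverting_odd (s u : 'S_7) : #[s] = 7 -> s ^ u = s^-1 -> odd_perm u.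
Proof.
move=> os su; have s7 : s ^+ 7 = 1 by have := expg_order s; rewrite os.
have tr := order7_perm7 os; pose i : 'I_7 := ord0; have [k Dk] := tr i (u i).
have us l j : u ((s ^+ l) j) = (s ^- l) (u j).
  by rewrite -permJ conjXg su expgVn.
(* As u maps s^l i to s^(k - l) i, a fixed point needs 2 l = k modulo 7, hence l = 4 k. *)
pose i0 := (s ^+ (4 * k)) i.
have ui0 : u i0 = i0.
  rewrite us Dk -permM; congr (fun_of_perm _ i).
  apply: (mulIg (s ^+ (4 * k))); rewrite mulgKV -expgD.
  by rewrite -[LHS]mulg1 -(expg1n _ k) -s7 -expgM -expgD; congr (_ ^+ _); lia.
pose p l := (s ^+ l) i0.
have up l : (l <= 7)%N -> u (p l) = p (7 - l)%N.
  move=> l7; rewrite /p us ui0; congr (fun_of_perm _ i0).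
  by apply: (mulIg (s ^+ l)); rewrite mulVg -expgD subnK.
have sub j : j \in [seq p l | l <- iota 0 7].
  have [l Dl] := tr i0 j; apply/mapP; exists (l %% 7)%N.
    by rewrite mem_iota ltn_pmod.
  by rewrite Dl /p expg_mod.
have Up : uniq [seq p l | l <- iota 0 7].
  apply: (leq_size_uniq (enum_uniq 'I_7)); last by rewrite size_map size_iota size_enum_ord.
  by move=> j _; apply: sub.
have neq a b : (a < 7)%N -> (b < 7)%N -> (p a == p b) = (a == b).
  move=> a7 b7; apply/eqP/eqP => [|-> //] pab; apply/eqP.
  have := nth_uniq i0 (s := [seq p l | l <- iota 0 7]) (i := a) (j := b).
  rewrite size_map size_iota => <- //.
  by rewrite !(nth_map 0) ?size_iota // !nth_iota // !add0n pab.
have -> : u = tperm (p 1%N) (p 6) * (tperm (p 2) (p 5) * tperm (p 3) (p 4)).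
  apply/permP=> j; have /mapP[l] := sub j; rewrite mem_iota => /= l7 ->.
  rewrite up ?(ltnW l7) // !permM.
  have tE a b c : (a < 7)%N -> (b < 7)%N -> (c < 7)%N ->
      tperm (p a) (p b) (p c) = p (if c == a then b else if c == b then a else c).
    move=> a7 b7 c7; case: tpermP => [/eqP|/eqP|/eqP + /eqP]; rewrite ?neq //.
    - by move=> ->.
    - by move=> /eqP ->; rewrite eqxx; case: eqP => // ->.
    by move=> /negPf-> /negPf->.
  have p7 : p 7 = p 0 by rewrite /p s7.
  by do 7?[case: l l7 => [|l] l7; first by rewrite !tE //= p7].
by rewrite !odd_permM !odd_tperm !neq.
Qed.

Lemma centralizer_order7 (s u : 'S_7) : #[s] = 7 -> commute s u -> u \in <[s]>.
Proof.
move=> os su; have tr := order7_perm7 os; have [k Dk] := tr ord0 (u ord0).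
apply/cycleP; exists k; apply/permP=> j; have [l ->] := tr ord0 j.
have /(congr1 (fun v : 'S_7 => v ord0)) := commuteX2 l 1%N su; rewrite expg1 !permM => ->.
by rewrite Dk -!permM -!expgD addnC.
Qed.

(** Distinct subgroups of order p meet trivially, and each contributes p - 1 elements of order p. *)
Lemma card_order_prime (gT : finGroupType) (G : {group gT}) p :
  prime p -> logn p #|G| = 1%N ->
  (#|'Syl_p(G)| * p.-1 <= #|[set x in G | #[x] == p]|)%N.
Proof.
move=> pp l1; have oS (S : {group gT}) : S \in 'Syl_p(G) -> S \subset G /\ #|S| = p.
  by rewrite inE => sylS; rewrite (pHall_sub sylS) (card_Hall sylS) p_part l1.
pose D := [set gval S :\ 1 | S in 'Syl_p(G)].
have sz : #|D| = #|'Syl_p(G)|.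
  apply: card_in_imset => S1 S2 /oS _ /oS _ E; apply/group_inj.
  by rewrite -(setD1K (group1 S1)) E (setD1K (group1 S2)).
have tiD : trivIset D.
  apply/trivIsetP => _ _ /imsetP[S1 H1 ->] /imsetP[S2 H2 ->] neq.
  have [_ o1] := oS S1 H1; have [_ o2] := oS S2 H2.
  have: S1 :&: S2 == 1.
    apply: contraNT neq => nt; apply/eqP; congr (_ :\ _).
    have pS1 : prime #|S1| by rewrite o1.
    have : S1 \subset S2.
      by apply: contraNT nt => /(prime_TIg pS1) ->.
    by move=> s12; apply/eqP; rewrite eqEcard s12 o1 o2 leqnn.
  move=> /eqP S12; rewrite -setI_eq0; apply/eqP/setP=> x; rewrite !inE.
  apply/negP => /andP[/andP[x1 xS1] /andP[_ xS2]].
  have : x \in S1 :&: S2 by rewrite inE xS1.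
  by rewrite S12 inE (negPf x1).
have <- : #|cover D| = (#|'Syl_p(G)| * p.-1)%N.
  have /eqP <- := tiD; rewrite (eq_bigr (fun=> p.-1)).
    by rewrite sum_nat_const sz.
  move=> _ /imsetP[S HS ->]; have [_ oSp] := oS S HS.
  by rewrite -oSp (cardsD1 1 S) group1.
apply/subset_leq_card/subsetP=> x /bigcupP[_ /imsetP[S HS ->]].
rewrite !inE => /andP[x1 xS]; have [sSG oSp] := oS S HS.
rewrite (subsetP sSG) //=; have := order_dvdG xS; rewrite oSp.
by case/primeP: pp => _ /[apply]; rewrite order_eq1 (negPf x1).
Qed.

(** A Sylow 7-subgroup S is its own centralizer, and an involution inverting it would be odd; so its
    normalizer has odd order, 7 or 21. The number of Sylow 7-subgroups divides 24 and is 1 modulo 7;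
    it is not 1, as G has even order, so it is 8. If G had order 56, the 48 elements of order 7
    would leave room for one Sylow 2-subgroup only, which would be normal of order prime to 7 and
    hence trivial by [normal_degree7]. *)
Lemma order168 (gT : finGroupType) (G : {group gT}) (f : {morphism G >-> 'S_7}) (g : gT) :
  'injm f -> (forall x, x \in G -> ~~ odd_perm (f x)) -> 7 %| #|G| -> #|G| %| 168 ->
  g \in G -> #[g] = 2 -> #|G| = 168.
Proof.
move=> injf evf G7 G168 Gg og.
have [S sylS] := Sylow_exists 7 G; have sSG := pHall_sub sylS.
have oS : #|S| = 7.
  rewrite (card_Hall sylS) p_part; have G0 := cardG_gt0 G.
  suff -> : logn 7 #|G| = 1%N by [].
  apply/eqP; rewrite eqn_leq -pfactor_dvdn // expn1 G7 andbT.
  exact: (dvdn_leq_log 7 _ G168).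
have [x Dx] : exists x, S :=: <[x]> by apply/cyclicP; rewrite prime_cyclic ?oS.
have Sx : x \in S by rewrite Dx cycle_id.
have Gx : x \in G := subsetP sSG _ Sx.
have ofx : #[f x] = 7 by rewrite order_injm // orderE -Dx.
have cSG : 'C_G(S) = S.
  apply/eqP; rewrite eqEsubset subsetI sSG /= -/(abelian S) Dx cycle_abelian andbT -Dx.
  apply/subsetP=> y /setIP[Gy Cy].
  have cxy : commute (f x) (f y).
    by rewrite /commute -!morphM // (centP Cy x Sx).
  have /cycleP[k Dk] := centralizer_order7 ofx cxy.
  rewrite -morphX // in Dk; rewrite (injmP injf _ _ Gy (groupX k Gx) Dk).
  by rewrite groupX.
have l7 : logn 7 #|G| = 1%N.
  have G0 := cardG_gt0 G.
  apply/eqP; rewrite eqn_leq -pfactor_dvdn // expn1 G7 andbT.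
  exact: (dvdn_leq_log 7 _ G168).
have n7d := card_Syl sylS; have := Lagrange (subsetIl G 'N(S)); rewrite -n7d => LG.
have n7m := card_Syl_mod G (isT : prime 7).
have G2 : 2 %| #|G| by rewrite -og order_dvdG.
have nodd : ~~ (2 %| #|'N_G(S)|).
  apply/negP => /(Cauchy (isT : prime 2))[u /setIP[Gu Nu] ou].
  have ox : #[x] = 7 by rewrite orderE -Dx.
  have [k Dk] : exists k, x ^ u = x ^+ k.
    by apply/cycleP; rewrite -Dx memJ_norm.
  have xu2 : (x ^ u) ^ u = x.
    by rewrite -conjgM -[u * u]/(u ^+ 2) -ou expg_order conjg1.
  have k1 : k * k = 1 %[mod 7].
    apply/eqP; rewrite -ox -eq_expg_mod_order expgM -Dk -conjXg -Dk.
    by rewrite xu2 expg1.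
  have : (k %% 7 == 1)%N || (k %% 7 == 6)%N.
    move: k1; rewrite -modnMm; have : (k %% 7 < 7)%N by apply: ltn_pmod.
    by case: (k %% 7)%N => [|[|[|[|[|[|[|]]]]]]].
  have Dk' : x ^ u = x ^+ (k %% 7) by rewrite Dk; have := expg_mod_order x k; rewrite ox => ->.
  case/orP=> /eqP kE; rewrite kE in Dk'.
    have : u \in 'C_G(S).
      have xu : x * u = u * x by rewrite conjgC Dk' expg1.
      by rewrite inE Gu Dx cent_cycle; apply/cent1P.
    by rewrite cSG => /order_dvdG; rewrite ou oS.
  have xi : x ^ u = x^-1.
    rewrite Dk'; apply: (mulIg x); rewrite mulVg -expgSr.
    by have := expg_order x; rewrite ox.
  case/negP: (evf u Gu); apply: (inverting_odd ofx).
  by rewrite -morphJ // xi morphV.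
have N21 : #|'N_G(S)| %| 21.
  have := cardSg (subsetIl G 'N(S)) => /dvdn_trans/(_ G168).
  by rewrite (_ : 168 = 2 ^ 3 * 21)%N // Gauss_dvdr // coprimeXr // coprime_sym prime_coprime.
have N7 : 7 %| #|'N_G(S)|.
  by rewrite -oS cardSg // subsetI sSG normG.
have n24 : #|'Syl_7(G)| %| 24.
  rewrite -(dvdn_pmul2l (isT : 0 < 7)%N); apply: dvdn_trans G168.
  by rewrite -LG; apply: dvdn_mul.
have n8 : #|'Syl_7(G)| = 8.
  have : (#|'Syl_7(G)| <= 24)%N by apply: dvdn_leq.
  move: n7m n24 LG; move: #|'Syl_7(G)| => n n7m n24 LG le24.
  have /allP/(_ n) : all (fun n => (n %% 7 == 1)%N ==> (n \in [:: 1; 8; 15; 22]%N)) (iota 0 25) by [].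
  rewrite mem_iota ltnS le24 => /(_ isT)/implyP; rewrite n7m => /(_ isT).
  rewrite !inE => /or4P[] /eqP nE; rewrite nE // in n24 LG *.
  by case/negP: nodd; rewrite -LG muln1 in G2.
rewrite n8 in LG.
have /orP[/eqP N_7|/eqP N_21] : (#|'N_G(S)| == 7)%N || (#|'N_G(S)| == 21)%N.
- have le21 : (#|'N_G(S)| <= 21)%N by apply: dvdn_leq.
  have /allP/(_ #|'N_G(S)|) : all (fun n => (7 %| n) && (n %| 21) ==> (n == 7) || (n == 21)) (iota 0 22) by [].
  by rewrite mem_iota ltnS le21 N7 N21 => /(_ isT).
- have G56 : #|G| = 56 by rewrite -LG N_7.
  have [P sylP] := Sylow_exists 2 G; have sPG := pHall_sub sylP.
  have oP : #|P| = 8 by rewrite (card_Hall sylP) p_part G56.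
  pose X := [set y in G | #[y] == 7].
  have cX : (48 <= #|X|)%N.
    by have := card_order_prime (isT : prime 7) l7; rewrite n8.
  have PE : P :=: G :\: X.
    apply/eqP; rewrite eqEcard oP cardsDS; last by apply/subsetP=> y; rewrite inE => /andP[].
    rewrite G56 leq_subLR (leq_trans _ (leq_add cX (leqnn 8))) // andbT.
    apply/subsetP=> y Py; rewrite !inE (subsetP sPG) // andbT.
    by apply: contraTN Py => /andP[_ /eqP oy]; apply/negP => /order_dvdG; rewrite oy oP.
  have nP : P <| G.
    rewrite /normal sPG; apply/subsetP=> y Gy; rewrite inE PE; apply/subsetP=> z.
    rewrite mem_conjg !inE orderJ => /andP[].
    by rewrite groupJr ?groupV // => + Gz; rewrite Gz /= andbT.
  have /(normal_degree7 Gx ofx nP) fP1 : ~~ (7 %| #|P|) by rewrite oP.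
  have P1 : P :=: 1.
    apply/trivgP/subsetP=> y Py; rewrite inE; apply/eqP.
    by apply: (injmP injf); rewrite ?group1 ?(subsetP sPG) // morph1 fP1.
  by rewrite P1 cards1 in oP.
by rewrite -LG N_21.
Qed.

Lemma card_even_perms7 (gT : finGroupType) (G : {group gT}) (f : {morphism G >-> 'S_7}) :
  'injm f -> (forall x, x \in G -> ~~ odd_perm (f x)) -> #|G| %| 2520.
Proof.
move=> injf evf; rewrite -(card_injm injf) //.
have : f @* G \subset 'Alt_('I_7).
  apply/subsetP=> _ /morphimP[x Gx _ ->]; rewrite Alt_even; exact: evf.
move/cardSg/dvdn_trans; apply.
have : (2 * #|'Alt_('I_7)|)%N = 5040 by rewrite card_Alt card_ord.
by rewrite -[5040]/(2 * 2520)%N => /eqP; rewrite eqn_pmul2l // => /eqP->.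
Qed.

(** A permutation that commutes with a transitive group is determined by the image of one point;
    this applies to the centralizer of E and, E being abelian, to E itself. *)
Lemma regular_abelian (gT : finGroupType) (G E : {group gT}) (T : finType) (i0 : T)
    (f : {morphism G >-> {perm T}}) :
  'injm f -> E \subset G -> abelian E -> (forall i j, same_orbit E f i j) ->
  #|E| = #|T| /\ 'C_G(E) = E.
Proof.
move=> injf sEG abE tr.
have key c e : c \in 'C_G(E) -> e \in E -> f c i0 = f e i0 -> c = e.
  move=> /setIP[Gc Cc] Ee ce; have Ge := subsetP sEG e Ee.
  apply: (injmP injf) => //; apply/permP=> k.
  have [d Ed <-] := tr i0 k; have Gd := subsetP sEG d Ed.
  rewrite -!permM -!morphM // -(centP Cc d Ed) (centsP abE d Ed e Ee).
  by rewrite !morphM // !permM ce.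
have sEC : E \subset 'C_G(E) by rewrite subsetI sEG.
split.
  rewrite -(@card_in_imset _ _ (fun e => f e i0) E); last first.
    by move=> e d Ee Ed; apply: key; rewrite ?(subsetP sEC).
  rewrite -cardsT; apply: eq_card => j; rewrite inE; apply/imsetP.
  by have [e Ee <-] := tr i0 j; exists e.
apply/eqP; rewrite eqEsubset sEC andbT; apply/subsetP=> c Cc.
by have [e Ee ce] := tr i0 (f c i0); rewrite (key c e).
Qed.

Lemma quotient_abelem_GL3 (gT : finGroupType) (G E : {group gT}) :
  E <| G -> 2.-abelem E -> #|E| = 8 -> 'C_G(E) = E ->
  exists f : {morphism G >-> {'GL_3['F_2]}}, 'ker f = E.
Proof.
move=> nE abE oE CE.
have ntE : E :!=: 1 by rewrite -cardG_gt1 oE.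
have nEG := normal_norm nE.
(* [abelem_dim'] is the predecessor of the dimension, so 2 stands for dimension 3. *)
have dimE : abelem_dim' E = 2%N.
  by apply/eqP; rewrite -eqSS; apply/eqP; rewrite (dim_abelemE abE ntE) oE.
pose rG := abelem_repr abE ntE nEG.
have kerE : rker rG = E by rewrite rker_abelem.
move: rG kerE; rewrite dimE => rG kerE.
by exists [morphism of reprGLm rG]; rewrite ker_reprGLm.
Qed.

Lemma card_GL3_2 : #|'GL_3(2)| = 168.
Proof. by rewrite card_GL // card_Fp // unlock. Qed.

Lemma quotient_GL3 (gT : finGroupType) (G E : {group gT}) :
  E <| G -> 2.-abelem E -> #|E| = 8 -> 'C_G(E) = E ->
  #|G / E| %| 168 /\ (#|G / E| = 168 -> G / E \isog 'GL_3(2)).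
Proof.
move=> nE abE oE CE; have [f kf] := quotient_abelem_GL3 nE abE oE CE.
have iso := first_isog f; rewrite kf in iso; have sub := subsetT (f @* G).
split; first by rewrite (card_isog iso) -card_GL3_2 cardSg.
move=> o168; rewrite (_ : 'GL_3(2) = f @* G) //.
by apply/esym/eqP; rewrite eqEcard sub card_GL3_2 -(card_isog iso) o168.
Qed.

End PermutationGroups.

(** * The octic and its Galois group *)

Definition octp (R : comNzRingType) (t : R) : {poly R} :=
  Poly [:: -29 - 9 * t; -63 - 12 * t; -9 - 4 * t; 66; 42; -10; -12; 0; 1].

Lemma horner_octp (R : comNzRingType) (t y : R) : (octp t).[y] = octE t y.
Proof. by rewrite /octp horner_Poly /= /octE; ring. Qed.

Lemma deriv_octp (R : comNzRingType) (t y : R) : (octp t)^`().[y] = oct'E t y.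
Proof. by rewrite /octp deriv_Poly_nth horner_Poly /= /oct'E; ring. Qed.

Lemma map_octp (R S : comNzRingType) (f : {rmorphism R -> S}) (t : R) :
  map_poly f (octp t) = octp (f t).
Proof.
apply/polyP=> i; rewrite coef_map /octp !coef_Poly.
by do 9![case: i => [|i] /=; first by (rewrite rmorphB rmorphN rmorphM !rmorph_nat
    || rewrite rmorphN rmorph_nat || rewrite rmorph_nat || rewrite rmorph0 || rewrite rmorph1)];
    rewrite !nth_nil rmorph0.
Qed.

(** The factor A + v B of the octic A^2 - (w + 1) B^2, where v is a square root of w + 1; the other
    factor is [block (- v)]. Each has four of the eight roots. *)
Definition block (F : fieldType) (v : F) : {poly F} :=
  let w := v ^+ 2 - 1 in
  Poly [:: (w ^- 2 + 7 / w + 5 - 3 * w) / 2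
           + v * ((w ^- 2 + 3 / w + 14 + 6 * w - 3 * w ^+ 2) / 2 / (w + 1));
           (2 / w - 1 + 2 * w) + v * ((- w^-1 + 6 + 5 * w - w ^+ 2) / (w + 1));
           (2 * w - 4) - v * (1 + w^-1); - (2 * v); 1].

Lemma horner_block (F : fieldType) (v y : F) :
  (block v).[y] = qA (v ^+ 2 - 1) y + v * qB (v ^+ 2 - 1) y.
Proof. by rewrite /block horner_Poly /= /qA /qB; ring. Qed.

Lemma octp_block (F : fieldType) (t v : F) : [pchar F] =i pred0 ->
  root (sept (1 - 4 * t)) (v ^+ 2 - 1) -> octp t = block v * block (- v).
Proof.
move=> F0 rv; apply: pchar0_polyP => // y.
rewrite horner_octp (octic_split _ _ rv); last by rewrite (proj1 (pcharf0P F) F0).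
by rewrite hornerM !horner_block sqrrN subrK; ring.
Qed.

Lemma monic_block (F : fieldType) (v : F) : size (block v) = 5 /\ block v \is monic.
Proof. by rewrite /block; apply: (Poly_rcons1 [:: _; _; _; _]). Qed.

Lemma map_block (F F' : fieldType) (f : {rmorphism F -> F'}) v :
  map_poly f (block v) = block (f v).
Proof.
have fw : f (v ^+ 2 - 1) = f v ^+ 2 - 1 by rewrite rmorphB rmorphXn rmorph1.
apply/polyP=> i; rewrite coef_map /block !coef_Poly -fw; move: (v ^+ 2 - 1) => w.
have f2 : f 2 = 2 by rewrite rmorph_nat.
do 5?[case: i => [|i] /=]; last by rewrite !nth_nil rmorph0.
- by rewrite !(rmorph_nat, rmorph1, rmorphB, rmorphD, rmorphM, fmorphV, rmorphXn).
- by rewrite !(rmorph_nat, rmorph1, rmorphB, rmorphN, rmorphD, rmorphM, fmorphV, rmorphXn).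
- by rewrite !(rmorph_nat, rmorph1, rmorphB, rmorphD, rmorphM, fmorphV, rmorphXn).
- by rewrite rmorphN rmorphM rmorph_nat.
by rewrite rmorph1.
Qed.

Lemma uniq_splits_deriv (F : fieldType) (p : {poly F}) (rs : seq F) :
  splits p rs -> {in rs, forall y, p^`().[y] != 0} -> uniq rs.
Proof.
move=> -> ; elim: rs => //= a r IH nz; have := nz a (mem_head _ _).
rewrite big_cons derivM derivXsubC mul1r hornerD hornerM hornerXsubC subrr mul0r addr0.
rewrite -rootE root_prod_XsubC => -> /=; apply: IH => y yr.
have := nz y; rewrite inE yr orbT => /(_ isT); apply: contra => /eqP dy.
rewrite big_cons derivM derivXsubC mul1r hornerD hornerM dy mulr0 addr0 -rootE.
by rewrite root_prod_XsubC.
Qed.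

Lemma uniq_map_inj (T1 T2 : eqType) (f : T1 -> T2) s :
  uniq (map f s) -> {in s &, injective f}.
Proof.
move=> Us x y xs ys fxy; rewrite -(nth_index x xs) -(nth_index x ys).
congr nth; apply/eqP; rewrite -(nth_uniq (f x) _ _ Us) ?size_map ?index_mem //.
by rewrite !(nth_map x) ?index_mem // !nth_index ?fxy.
Qed.

Section Octic.
Variables (L : splittingFieldType rat) (t : int) (ws : 7.-tuple L) (ys : 8.-tuple L).
Hypotheses (Dws : splits (sept (1 - 4 * t%:~R)) ws) (Dys : splits (octp t%:~R) ys)
  (P0 : 0 <= sqrt_disc (4 * t)).
Let K : {subfield L} := <<1 & ws>>%AS.
Let M : {subfield L} := <<K & ys>>%AS.
Let F0 := @pchar_numfield L.

Lemma sqrt_disc_neq0 : sqrt_disc (4 * t%:~R) != 0 :> L.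
Proof.
have [N [DN N7]] := sqrt_disc_mod8 P0.
have -> : sqrt_disc (4 * t%:~R) = N%:R :> L.
  by rewrite -[RHS]/(N%:Z%:~R) -DN (sqrt_disc_rmorph intr); congr sqrt_disc; rewrite rmorphM rmorph_nat.
by rewrite numfield_natr_eq0; case: N N7 {DN}.
Qed.

Let oys y : y \in ys -> octE t%:~R y = 0.
Proof. by rewrite -root_prod_XsubC -Dys rootE horner_octp => /eqP. Qed.

Let doct y : y \in ys -> oct'E t%:~R y != 0.
Proof.
move=> yy; have [|y0 E] := sqrt_disc_oct _ (oys yy); first by rewrite numfield_natr_eq0.
apply: contraNneq sqrt_disc_neq0 => o0; rewrite o0 expr0n mul0r in E.
by have/eqP := E; rewrite mulf_eq0 expf_eq0 /= (negPf y0) orbF.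
Qed.

Lemma octic_uniq : uniq ys.
Proof. by apply: (uniq_splits_deriv Dys) => y yy; rewrite deriv_octp doct. Qed.

Let wsK w : w \in ws -> w \in K. Proof. by move=> ?; rewrite seqv_sub_adjoin. Qed.

Let sKM : (K <= M)%VS. Proof. exact: subv_adjoin_seq. Qed.

Let ysM y : y \in ys -> y \in M. Proof. by move=> ?; rewrite seqv_sub_adjoin. Qed.

Let rws w : w \in ws -> root (sept (1 - 4 * t%:~R)) w.
Proof. by rewrite -root_prod_XsubC -Dws. Qed.

(** At a root y of the octic A^2 = (w + 1) B^2, so v = A / B will do. If B vanished at y, so would
    A, and y would be a multiple root. *)
Let sqrt_dual w : w \in ws -> exists2 v, v \in M & v ^+ 2 = w + 1.
Proof.
move=> ww; set y := tnth ys ord0; have yy : y \in ys by apply: mem_tnth.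
have n2 : 2 != 0 :> L by rewrite numfield_natr_eq0.
have B0 : qB w y != 0.
  apply: contraNneq (doct yy) => B0.
  have A0 : qA w y = 0.
    have /eqP := oys yy; rewrite (octic_split _ n2 (rws ww)) B0 expr0n mulr0 subr0.
    by rewrite sqrf_eq0 => /eqP.
  pose pA : {poly L} := Poly [:: (w ^- 2 + 7 / w + 5 - 3 * w) / 2; 2 / w - 1 + 2 * w; 2 * w - 4; 0; 1].
  pose pB : {poly L} := Poly [:: (w ^- 2 + 3 / w + 14 + 6 * w - 3 * w ^+ 2) / 2 / (w + 1);
    (- w^-1 + 6 + 5 * w - w ^+ 2) / (w + 1); - (1 + w^-1); -2].
  have pAE z : pA.[z] = qA w z by rewrite /pA horner_Poly /= /qA; ring.
  have pBE z : pB.[z] = qB w z by rewrite /pB horner_Poly /= /qB; ring.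
  have E : octp t%:~R = pA * pA - (w + 1)%:P * (pB * pB).
    apply: pchar0_polyP => // z; rewrite horner_octp (octic_split _ n2 (rws ww)).
    by rewrite hornerD hornerN !hornerM hornerC pAE pBE !expr2.
  rewrite -deriv_octp E derivB !derivM derivC mul0r add0r.
  rewrite hornerD hornerN !(hornerM, hornerD) pAE pBE A0 B0.
  by rewrite !(mulr0, mul0r, addr0, subr0).
exists (qA w y / qB w y).
  have yM := ysM yy; have wM := subvP sKM _ (wsK ww).
  have wiM : w^-1 \in M by rewrite rpredV.
  have nM n : n%:R \in M by rewrite rpred_nat.
  have nVM n : n%:R^-1 \in M by rewrite rpredV.
  have w1M : (w + 1)^-1 \in M by rewrite rpredV rpredD ?rpred1.
  have w2M : w ^- 2 \in M by rewrite rpredV rpredX.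
  by rewrite rpredM ?rpredV // /qA /qB; mem_tac.
have /eqP := oys yy; rewrite (octic_split _ n2 (rws ww)) subr_eq0 => /eqP E.
by rewrite exprMn exprVn E mulfK // sqrf_eq0.
Qed.

Lemma block_roots v : v ^+ 2 - 1 \in ws ->
  exists r, [/\ splits (block v) r, {subset r <= ys}, uniq r, size r = 4 & 2 * v = \sum_(y <- r) y].
Proof.
move=> vw; have E := octp_block F0 (rws vw).
have [|r Dr sr] := splits_monic_dvd Dys (monic_block v).2; first by rewrite E dvdp_mulr.
have szr : size r = 4 by have := (monic_block v).1; rewrite [block v]Dr size_prod_XsubC => -[].
exists r; split=> //.
  rewrite -separable_prod_XsubC -[X in separable_poly X]Dr.
  apply: (@dvdp_separable _ (octp t%:~R)); first by rewrite E dvdp_mulr.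
  by rewrite Dys separable_prod_XsubC octic_uniq.
case: r szr Dr {sr} => [|a [|b [|c [|d []]]]] // _ Dr.
have [_ _ _ e] := splits_quartic F0 Dr.
by rewrite !big_cons big_nil addr0 -[LHS]opprK e opprK !addrA.
Qed.

Lemma block_disjoint v y : v ^+ 2 - 1 \in ws -> y \in ys -> root (block v) y ->
  ~~ root (block (- v)) y.
Proof.
move=> vw yy rv; apply/negP => rv'.
have E := octp_block F0 (rws vw).
have := doct yy; rewrite -deriv_octp E derivM hornerD !hornerM.
by rewrite (eqP rv) (eqP rv') mulr0 mul0r addr0 eqxx.
Qed.

(** The coefficient of X^3 in [block v] shows v as half the sum of four roots of the octic, and w =
    v^2 - 1. So M is generated by the roots of the octic alone, and its Galois group acts faithfully
    on them. *)
Lemma ws_sub_ys : {subset ws <= <<1 & ys>>%VS}.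
Proof.
move=> w ww; have [v _ vw] := sqrt_dual ww.
have n2 : 2 != 0 :> L by rewrite numfield_natr_eq0.
have vws : v ^+ 2 - 1 \in ws by rewrite vw addrK.
have [r [_ sr _ _ E]] := block_roots vws.
have -> : w = ((\sum_(y <- r) y) / 2) ^+ 2 - 1.
  by rewrite -E mulrC mulKf // vw addrK.
rewrite rpredB ?rpred1 // rpredX // rpredM ?rpredV ?rpred_nat // big_seq rpred_sum // => y yr.
by rewrite seqv_sub_adjoin // sr.
Qed.

Lemma octic_field_eq : M = <<1 & ys>>%AS.
Proof.
apply/val_inj/eqP; rewrite /= eqEsubv; apply/andP; split.
  apply/Fadjoin_seqP; split; last by move=> y yy; apply: seqv_sub_adjoin.
  by apply/Fadjoin_seqP; split; [exact: sub1v | exact: ws_sub_ys].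
apply/Fadjoin_seqP; split; first exact: sub1v.
by move=> y yy; apply: seqv_sub_adjoin.
Qed.

Lemma octp_in_alg : octp t%:~R = map_poly (in_alg L) (octp t%:~R).
Proof. by rewrite map_octp rmorph_int. Qed.

Lemma galois_octic : galois 1 M.
Proof. by rewrite octic_field_eq; apply: (@galois_splits L (octp t%:~R)) octic_uniq; rewrite -octp_in_alg. Qed.

Lemma gal_ys (g : gal_of M) y : y \in ys -> g y \in ys.
Proof.
rewrite -!root_prod_XsubC -Dys => ry.
by have := ry; rewrite -(fmorph_root (gal_repr g)) octp_in_alg -map_poly_comp;
  congr (root _ _); apply: eq_map_poly => a /=; rewrite rmorph_alg.
Qed.

(** The negatives complete the list to the fourteen roots of the septic composed with X^2 - 1, so
    that the field they generate is Galois over Q. They are distinct because no w is -1. *)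
Lemma exists_sqrt_dual : exists vs : seq L, [/\ [seq v ^+ 2 - 1 | v <- vs] = ws,
  {subset vs <= M} & uniq (vs ++ [seq - v | v <- vs])].
Proof.
have [vs Dvs sM] : exists2 vs : seq L, [seq v ^+ 2 - 1 | v <- vs] = ws & {subset vs <= M}.
  suff lift (r : seq L) : {subset r <= ws} ->
      exists2 vs : seq L, [seq v ^+ 2 - 1 | v <- vs] = r & {subset vs <= M} by apply: lift.
  elim: r => [_|w r IH sub]; first by exists [::].
  have [|vs Dvs sM] := IH; first by move=> x xr; apply: sub; rewrite inE xr orbT.
  have [v vM vw] := sqrt_dual (sub w (mem_head _ _)).
  exists (v :: vs); first by rewrite /= Dvs vw addrK.
  by move=> x; rewrite inE => /predU1P[->|/sM].
exists vs; split=> //; have Uws := dual_uniq Dws; rewrite -Dvs in Uws.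
rewrite cat_uniq (map_inj_uniq oppr_inj) (map_uniq Uws) andbT /=.
apply/hasPn => _ /mapP[v vvs ->]; apply/negP => Nvs.
have vE : - v = v by apply: (uniq_map_inj Uws) => //; rewrite sqrrN.
have v0 : v = 0.
  by apply/eqP; move/eqP: vE; rewrite eq_sym -subr_eq0 opprK -mulr2n -mulr_natr mulf_eq0 numfield_natr_eq0 orbF.
have := map_f (fun v => v ^+ 2 - 1) vvs; rewrite Dvs => /rws; rewrite rootE horner_sept => /eqP/sept_param[_ /eqP w1 _]; apply: w1.
by rewrite v0 expr0n subrK.
Qed.

End Octic.

Lemma gal_perm_injm (L : splittingFieldType rat) (K : {subfield L}) n (rs : n.-tuple L)
    (f : {morphism 'Gal(K / 1)%g >-> 'S_n}) : K = <<1 & rs>>%AS ->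
  {in 'Gal(K / 1)%g, forall (g : gal_of K) i, tnth rs (f g i) = g (tnth rs i)} ->
  ('injm f)%g.
Proof.
move=> DK fE; apply/subsetP=> g /morphpreP[Gg]; rewrite inE => /eqP fg1; rewrite inE.
have sK : {subset rs <= K} by move=> x xr; rewrite DK; apply: seqv_sub_adjoin.
have gfix : {in rs, forall x, g x = x}.
  by move=> _ /tnthP[i ->]; rewrite -fE // fg1 perm1.
have DV : <<1 & rs>>%VS = K by rewrite [in RHS]DK.
have := gal_fix_adjoin sK gfix; rewrite DV => gKK.
apply/gal_eqP => a aK; rewrite (fixed_gal (subvv K) gKK aK).
by rewrite gal_id.
Qed.

Section SquareRoots.
Variables (L : splittingFieldType rat) (t : int) (ws : 7.-tuple L) (ys : 8.-tuple L).
Hypotheses (Dws : splits (sept (1 - 4 * t%:~R)) ws) (Dys : splits (octp t%:~R) ys)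
  (P0 : 0 <= sqrt_disc (4 * t)).
Let K : {subfield L} := <<1 & ws>>%AS.
Let M : {subfield L} := <<K & ys>>%AS.
Let F0 := @pchar_numfield L.
Variable vs : seq L.
Hypotheses (Dvs : [seq v ^+ 2 - 1 | v <- vs] = ws) (svsM : {subset vs <= M})
  (Uvs : uniq (vs ++ [seq - v | v <- vs])).
Let W : {subfield L} := <<1 & vs ++ [seq - v | v <- vs]>>%AS.

Lemma sqrt_mem v : v \in vs -> v ^+ 2 - 1 \in ws.
Proof. by move=> vv; have := map_f (fun v => v ^+ 2 - 1) vv; rewrite Dvs. Qed.

Lemma sqrt_sub : (W <= M)%VS.
Proof.
apply/Fadjoin_seqP; split; first exact: sub1v.
move=> x; rewrite mem_cat => /orP[/svsM //|/mapP[v /svsM vM ->]].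
by rewrite rpredN.
Qed.

Lemma sqrt_galois : galois 1 W.
Proof.
apply: (@galois_splits L (sept (1 - 4 * t%:~R) \Po ('X^2 - 1)) _ _ Uvs).
rewrite map_comp_poly -dual_alg rmorphB /= map_polyXn rmorph1 Dws /splits big_cat big_map /=.
apply: pchar0_polyP => // x; rewrite horner_comp !hornerM !horner_prod -Dvs big_map -big_split /=.
apply: eq_bigr => v _; rewrite !(hornerXsubC, hornerD, hornerN, hornerXn).
by rewrite -[1]/(1%:P) hornerC; ring.
Qed.

Lemma gal_octic_order7 : exists x : gal_of M,
  x \in 'Gal(M / 1)%g /\ #[x]%g = 7.
Proof.
have galM : galois 1 M by apply: (galois_octic Dws Dys P0).
have d7 : (7 %| #|'Gal(M / 1)%g|)%N.
  rewrite -galois_dim // dimv1 divn1.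
  by apply: dvdn_trans (dual_dim Dws) _; apply: field_dimS; apply: subv_adjoin_seq.
by have [x Mx ox] := Cauchy (isT : prime 7) d7; exists x.
Qed.

Lemma ys_sub : {subset ys <= M}.
Proof. by move=> y yy; rewrite seqv_sub_adjoin. Qed.

Lemma gal_ys_perm : exists2 f : {morphism 'Gal(M / 1)%g >-> 'S_8}, ('injm f)%g &
  {in 'Gal(M / 1)%g, forall (g : gal_of M) i, tnth ys (f g i) = g (tnth ys i)}.
Proof.
have [|f fE] := @gal_perm L M 8 ys (octic_uniq Dys P0) ys_sub.
  by move=> g _ i; rewrite (gal_ys Dys) // mem_tnth.
by exists f => //; apply: gal_perm_injm fE; apply: (octic_field_eq Dws Dys P0).
Qed.

Lemma block_gal (g : gal_of M) v y : v \in M -> g v = v -> root (block v) y -> root (block v) (g y).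
Proof.
by move=> vM gv ry; have := ry; rewrite -(fmorph_root (gal_repr g)) map_block [X in block X]gv.
Qed.

Lemma block_index v i0 : v ^+ 2 - 1 \in ws -> exists2 i, i != i0 & root (block v) (tnth ys i).
Proof.
move=> vw; have [r [Dr sr Ur szr _]] := block_roots Dws Dys P0 vw.
have : ~~ all (pred1 (tnth ys i0)) r.
  case: r szr Ur {Dr sr} => [|a [|b r]] //= _; apply: contraL => /and3P[/eqP-> /eqP-> _].
  by rewrite inE eqxx.
case/allPn => y yr /= yi0; have /tnthP[i Di] := sr y yr.
by exists i; [apply: contraNneq yi0 => <-; rewrite Di | rewrite -Di Dr root_prod_XsubC].
Qed.

(** The octic is [block v * block (- v)] over W, so no orbit of this normal subgroup meets the roots
    of both factors. Each factor has a root other than any prescribed point, which rules out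
    transitivity on eight and on seven roots. *)
Lemma gal_sqrt_trivial : 'Gal(M / W)%g = 1%g.
Proof.
have sub1W : (1 <= W <= M)%VS by rewrite sub1v sqrt_sub.
have nW : ('Gal(M / W) <| 'Gal(M / 1))%g.
  by apply: (normalField_normal sub1W); case/and3P: sqrt_galois.
have [f injf fE] := gal_ys_perm; have [x [Gx ox]] := gal_octic_order7.
have oy : #[f x]%g = 7 by rewrite order_injm.
have [v vvs] : exists v, v \in vs.
  by case: (vs) Dvs => [|v vs'] E; [have := size_tuple ws; rewrite -E | exists v; rewrite mem_head].
have vw := sqrt_mem vvs; have vw' : (- v) ^+ 2 - 1 \in ws by rewrite sqrrN.
have key i j : root (block v) (tnth ys i) -> root (block (- v)) (tnth ys j) ->
    ~ same_orbit 'Gal(M / W) f i j.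
  move=> ri rj [g Wg gij]; have Gg := subsetP (normal_sub nW) g Wg.
  have gv : g v = v.
    by apply: (fixed_gal sqrt_sub Wg); rewrite seqv_sub_adjoin // mem_cat vvs.
  have := block_gal (svsM vvs) gv ri; rewrite -fE // gij => rv.
  by have := block_disjoint Dws Dys P0 vw (mem_tnth j ys) rv; rewrite rj.
case: (normal_degree8 Gx oy nW) => [fix_f|[y0 _ tr]|tr].
- apply/trivgP/subsetP=> g Wg; have Gg := subsetP (normal_sub nW) g Wg.
  by rewrite inE; apply/eqP/(injmP injf); rewrite ?group1 // fix_f ?morph1.
- have [i i0 ri] := block_index y0 vw; have [j j0 rj] := block_index y0 vw'.
  by case: (key i j ri rj); apply: tr.
have [i i0 ri] := block_index ord0 vw; have [j j0 rj] := block_index ord0 vw'.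
by case: (key i j ri rj); apply: tr.
Qed.

Lemma octic_field_eq_sqrt : M = W.
Proof.
have galM : galois 1 M by apply: (galois_octic Dws Dys P0).
have galWM : galois W M by apply: galoisS galM; rewrite sub1v sqrt_sub.
have := galois_dim galWM; rewrite gal_sqrt_trivial cards1 => d1.
have := field_dimS sqrt_sub; rewrite -(divnK (field_dimS sqrt_sub)) d1 mul1n => _.
by apply/val_inj/eqP; rewrite eq_sym eqEdim sqrt_sub -(divnK (field_dimS sqrt_sub)) d1 mul1n /=.
Qed.

Lemma gal_octic_abelem : (2.-abelem)%g 'Gal(M / K)%g.
Proof.
have sKM : (K <= M)%VS by apply: subv_adjoin_seq.
apply: exponent2_abelem; apply/exponentP => e Ke.
suff: (e * e)%g \in 'Gal(M / W)%g by rewrite gal_sqrt_trivial => /set1P; rewrite expgS expg1.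
have ev v : v \in vs -> e (e v) = v.
  move=> vv; have vM := svsM vv.
  have /eqP : (e v) ^+ 2 = v ^+ 2.
    rewrite -rmorphXn; apply: (fixed_gal sKM Ke).
    by rewrite -[v ^+ 2](subrK 1) rpredD ?rpred1 // seqv_sub_adjoin // sqrt_mem.
  by rewrite eqf_sqr => /orP[/eqP E|/eqP E]; rewrite E ?E // rmorphN /= E opprK.
apply: gal_fix_adjoin => [x xr|x xr].
  by apply: (subvP sqrt_sub); apply: seqv_sub_adjoin.
have xM : x \in M by apply: (subvP sqrt_sub); apply: seqv_sub_adjoin.
rewrite galM //; move: xr; rewrite mem_cat => /orP[/ev //|/mapP[v /ev E ->]].
by rewrite !rmorphN /= E.
Qed.

End SquareRoots.

(* The octic at t = 0 takes the value 1 / 256 at - 3 / 2, so that 2 z + 3 is a unit. *)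
Lemma octic_int_root (t z : int) : octE t z = 0 -> (t == 0) || (t == 13).
Proof.
move=> o0.
have u1 : (2 * z + 3) * (256 * t * (2 * z + 3) - (128 * z ^+ 7 - 192 * z ^+ 6 - 1248 * z ^+ 5
   + 592 * z ^+ 4 + 4488 * z ^+ 3 + 1716 * z ^+ 2 - 3726 * z - 2475)) = 1.
  by rewrite -[LHS]addr0 -(mulr0 256) -o0 /octE; ring.
have /orP[/eqP z1|/eqP z1] : (2 * z + 3 == 1) || (2 * z + 3 == -1).
  have := congr1 absz u1; rewrite abszM => /eqP; rewrite muln_eq1 => /andP[/eqP A _].
  by move: A; clear; lia.
- have E : z = -1 by move: z1; clear; lia.
  move: o0; have -> : octE t z = - t by rewrite E /octE; ring.
  by move/eqP; rewrite oppr_eq0 => ->.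
have E : z = -2 by move: z1; clear; lia.
move: o0; have -> : octE t z = 13 - t by rewrite E /octE; ring.
by move/eqP; rewrite subr_eq0 [13 == _]eq_sym orbC => ->.
Qed.

Lemma involution_pairs (T : eqType) (s : T -> T) (r : seq T) : uniq r ->
  {in r, forall x, [/\ s x \in r, s x != x & s (s x) = x]} ->
  exists q, perm_eq r (q ++ map s q).
Proof.
elim: {r}(size r) {-2}r (leqnn (size r)) => [|n IH] [|a r] //= szr; try by exists [::].
case/andP=> ar Ur sr; have [] := sr a (mem_head _ _).
rewrite inE => /predU1P[-> /eqP //|sar sa ssa].
have Ur' : uniq (rem (s a) r) by apply: rem_uniq.
have [||q sqrt_disc] := IH (rem (s a) r) _ Ur'.
- by rewrite size_rem //; apply: leq_trans (leq_pred _) _.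
- move=> x; rewrite mem_rem_uniq // inE => /andP[xa xr].
  have [] := sr x; first by rewrite inE xr orbT.
  rewrite inE mem_rem_uniq // => /predU1P[sxa|sxr] nx ssx.
    by case/eqP: xa; rewrite -sxa ssx.
  split=> //; rewrite inE sxr andbT; apply: contraNneq ar => E.
  by rewrite -ssa -E ssx.
exists (a :: q); rewrite /= perm_cons (permPl (perm_to_rem sar)).
rewrite perm_sym (perm_catCA q [:: s a]) /= perm_cons perm_sym.
exact: sqrt_disc.
Qed.

Lemma algint_oct (L : fieldExtType rat) (t : int) (y : L) : octE t%:~R y = 0 -> algint y.
Proof.
move=> oy; exists (octp t).
  by have [] := @Poly_rcons1 int [:: -29 - 9 * t; -63 - 12 * t; -9 - 4 * t; 66; 42; -10; -12; 0].
by rewrite map_octp rootE horner_octp oy.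
Qed.

Section ExcludeTrivial.
Variables (L : splittingFieldType rat) (t : int) (ws : 7.-tuple L) (ys : 8.-tuple L).
Hypotheses (Dws : splits (sept (1 - 4 * t%:~R)) ws) (Dys : splits (octp t%:~R) ys)
  (vdm_ws : vdm ws ^+ 2 = sqrt_disc (4 * t%:~R) ^+ 2) (P0 : 0 <= sqrt_disc (4 * t)).
Let K : {subfield L} := <<1 & ws>>%AS.
Let F0 := @pchar_numfield L.
Let quartic (a b c d : L) := Poly [:: a * b * c * d;
  - (a * b * c + a * b * d + a * c * d + b * c * d);
  a * b + a * c + a * d + b * c + b * d + c * d; - (a + b + c + d); 1].

Let quarticE (a b c d : L) : \prod_(x <- [:: a; b; c; d]) ('X - x%:P) = quartic a b c d.
Proof.
rewrite !big_cons big_nil mulr1.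
by apply: pchar0_polyP => // x; rewrite !hornerM !hornerXsubC horner_Poly /=; ring.
Qed.

Let oct_coefs (q0 q1 q2 q3 r0 r1 r2 r3 s : L) :
  octp s = Poly [:: q0; q1; q2; q3; 1] * Poly [:: r0; r1; r2; r3; 1] ->
  [/\ q3 + r3 = 0, q2 + q3 * r3 + r2 = -12, q1 + q2 * r3 + q3 * r2 + r1 = -10
    & q0 * r3 + q1 * r2 + q2 * r1 + q3 * r0 = 66].
Proof.
have -> : Poly [:: q0; q1; q2; q3; 1] * Poly [:: r0; r1; r2; r3; 1] =
  Poly [:: q0 * r0; q0 * r1 + q1 * r0; q0 * r2 + q1 * r1 + q2 * r0;
    q0 * r3 + q1 * r2 + q2 * r1 + q3 * r0; q0 + q1 * r3 + q2 * r2 + q3 * r1 + r0;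
    q1 + q2 * r3 + q3 * r2 + r1; q2 + q3 * r3 + r2; q3 + r3; 1].
  by apply: pchar0_polyP => // x; rewrite hornerM !horner_Poly /=; ring.
move/polyP=> E; have := (E 3, E 5, E 6, E 7).
by rewrite /octp !coef_Poly /= => -[[[-> ->] ->] ->].
Qed.

(* The octic is the product of two quartics that are conjugate under g, hence
   congruent modulo m; but comparing the coefficients of 'X^7, 'X^6, 'X^5 and 'X^3 of
   the octic with those of a square yields 6 in m. *)
Lemma pairing_contradiction p m (q : seq L) (g : gal_of K) : prime p ->
  p \notin [:: 2; 3; 11; 17]%N -> prime_over p m ->
  (forall c : L, c \in K -> algint c -> m (g c - c)) ->
  {subset q <= K} -> perm_eq ys (q ++ map g q) -> False.
Proof.
move=> pp pN mP gI qK Dq; have [mp m1 mD mMl mM] := mP.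
have szq : size q = 4.
  have := perm_size Dq; rewrite size_tuple size_cat size_map addnn.
  by move/(congr1 half); rewrite doubleK.
have Oq x : x \in q -> algint x.
  move=> xq; apply: (@algint_oct _ t); rewrite -horner_octp; apply/eqP.
  by rewrite -rootE Dys root_prod_XsubC (perm_mem Dq) mem_cat xq.
move: Dys; rewrite /splits (perm_big _ Dq) big_cat big_map /=.
case: q szq Oq qK {Dq} => [|a [|b [|c [|d []]]]] // _ Oq qK.
rewrite -(big_map g xpredT (fun x => 'X - x%:P)) /= !quarticE /quartic => /oct_coefs.
have [Oa Ob Oc Od] : [/\ algint a, algint b, algint c & algint d].
  by split; apply: Oq; rewrite !inE eqxx ?orbT.
have [aK bK cK dK] : [/\ a \in K, b \in K, c \in K & d \in K].
  by split; apply: qK; rewrite !inE eqxx ?orbT.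
set q0 := a * b * c * d; set q1 := - (a * b * c + _ + _ + _); set q2 := a * b + _ + _ + _ + _ + _.
set q3 := - (a + b + c + d).
have -> : g a * g b * g c * g d = g q0 by rewrite /q0 !rmorphM.
have -> : - (g a * g b * g c + g a * g b * g d + g a * g c * g d + g b * g c * g d) = g q1.
  by rewrite /q1 !(rmorphN, rmorphD, rmorphM).
have -> : g a * g b + g a * g c + g a * g d + g b * g c + g b * g d + g c * g d = g q2.
  by rewrite /q2 !(rmorphD, rmorphM).
have -> : - (g a + g b + g c + g d) = g q3 by rewrite /q3 !(rmorphN, rmorphD).
have O0 : algint q0 by rewrite /q0; algint_tac.
have O1 : algint q1 by rewrite /q1; algint_tac.
have O2 : algint q2 by rewrite /q2; algint_tac.
have O3 : algint q3 by rewrite /q3; algint_tac.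
have d0 : m (g q0 - q0) by apply: gI => //; rewrite /q0; mem_tac.
have d1 : m (g q1 - q1) by apply: gI => //; rewrite /q1; mem_tac.
have d2 : m (g q2 - q2) by apply: gI => //; rewrite /q2; mem_tac.
have d3 : m (g q3 - q3) by apply: gI => //; rewrite /q3; mem_tac.
have Og x : algint x -> algint (g x) by apply: (algint_rmorph (gal_repr g)).
move: (Og _ O0) (Og _ O1) (Og _ O2) (Og _ O3) => Oa0 Oa1 Oa2 Oa3.
(* From here on the conjugate coefficients are only known as e_i + q_i with e_i in m. *)
move: (g q0 - q0) (g q1 - q1) (g q2 - q2) (g q3 - q3) (subrK q0 (g q0)) (subrK q1 (g q1))
  (subrK q2 (g q2)) (subrK q3 (g q3)) d0 d1 d2 d3 Oa0 Oa1 Oa2 Oa3.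
move: q0 q1 q2 q3 O0 O1 O2 O3 => q0 q1 q2 q3 O0 O1 O2 O3 e0 e1 e2 e3 <- <- <- <- m0 m1' m2 m3 Or0 Or1 Or2 Or3.
have n2 x : algint x -> m (2 * x) -> m x.
  move=> Ox /mM[||/(prime_over_int (n := 2) pp mP)|//]; first exact: integral_nat.
    by [].
  rewrite dvdzE /= dvdn_prime2 // => /eqP p2; move: pN; by rewrite p2.
have mC x y : algint y -> m x -> m (x * y) by move=> Oy mx; rewrite mulrC; apply: (mMl).
have mN := prime_overN mP.
case=> E3 E2 E1 E0.
have q3m : m q3.
  apply: n2 => //; have -> : 2 * q3 = q3 + (e3 + q3) - e3 by ring.
  by rewrite E3 sub0r; apply: mN.
have q3m' : m (e3 + q3) by apply: mD.
have u2 : m (q2 + 6).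
  apply: n2; first by algint_tac.
  have -> : 2 * (q2 + 6) = q2 + q3 * (e3 + q3) + (e2 + q2) + 12 - q3 * (e3 + q3) - e2 by ring.
  by rewrite E2 addNr sub0r; apply: (mD); apply: mN => //; apply: (mMl).
have u1 : m (q1 + 5).
  apply: n2; first by algint_tac.
  have -> : 2 * (q1 + 5) = q1 + q2 * (e3 + q3) + q3 * (e2 + q2) + (e1 + q1) + 10
     - q2 * (e3 + q3) - q3 * (e2 + q2) - e1 by ring.
  rewrite E1 addNr sub0r; apply: (mD); last by apply: mN.
  by apply: (mD); apply: mN; [apply: (mMl) | apply: mC].
(* Modulo m, q3 = 0, q2 = -6 and q1 = -5, so the coefficient 66 of X^3 is congruent to 2 q1 q2 =
   60. *)
have : m 6%:R.
  have -> : 6 = q0 * (e3 + q3) + q3 * (e0 + q0) + q1 * e2 + q2 * e1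
     + (2 * ((q1 + 5) * (q2 + 6)) - 12 * (q1 + 5) - 10 * (q2 + 6))
     - (q0 * (e3 + q3) + q1 * (e2 + q2) + q2 * (e1 + q1) + q3 * (e0 + q0) - 66) :> L by ring.
  rewrite E0 subrr subr0.
  have on n : algint (n%:R : L) by apply: integral_nat.
  have O5 : algint (q1 + 5) by algint_tac.
  apply: (mD); first (apply: (mD); first (apply: (mD); first apply: (mD))).
  - exact: (mMl).
  - exact: mC.
  - exact: (mMl).
  - exact: (mMl).
  apply: (mD); last by apply: mN; apply: (mMl).
  apply: (mD); last by apply: mN; apply: (mMl).
  by apply: (mMl) => //; apply: (mMl).
move/(prime_over_int (n := 6) pp mP); rewrite dvdzE /= (@Euclid_dvdM 2 3) // !dvdn_prime2 //.
by move: pN; rewrite !inE => /norP[/negPf-> /norP[/negPf-> _]].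
Qed.

Lemma gal_dual_perm : exists h : {morphism 'Gal(K / 1)%g >-> 'S_7}, [/\ ('injm h)%g,
  {in 'Gal(K / 1)%g, forall (g : gal_of K) i, tnth ws (h g i) = g (tnth ws i)} &
  forall g, g \in 'Gal(K / 1)%g -> ~~ odd_perm (h g)].
Proof.
have Uws := dual_uniq Dws.
have wsK : {subset ws <= K} by move=> y yy; apply: seqv_sub_adjoin.
have [|h hE] := @gal_perm L K 7 ws Uws wsK.
  move=> g _ i; have := mem_tnth i ws; move: (tnth ws i) => w.
  rewrite -!root_prod_XsubC -Dws => rx; have := rx.
  by rewrite -(fmorph_root (gal_repr g)) map_sept rmorphB rmorph1 rmorphM rmorph_nat rmorph_int.
exists h; split=> //; first exact: gal_perm_injm (erefl K) hE.
apply: (gal_perm_even Uws hE); move/eqP: vdm_ws; rewrite eqf_sqr.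
have PQ1 : sqrt_disc (4 * t%:~R) \in (1%VS : {vspace L}).
  by rewrite -(rmorph_int (in_alg L)) -(rmorph_nat (in_alg L)) -rmorphM -sqrt_disc_rmorph rpredZ // rpred1.
by case/orP=> /eqP->; rewrite ?rpredN.
Qed.

Lemma dual_involution (g : gal_of K) : g != 1%g -> {in ws, forall w, g (g w) = w} ->
  (g * g = 1)%g /\ #[g]%g = 2.
Proof.
move=> g1 ggw; have gg : (g * g = 1)%g.
  have gKK : (g * g)%g \in 'Gal(K / K)%g.
    apply: gal_fix_adjoin => w ww; first exact: seqv_sub_adjoin.
    by rewrite galM ?ggw // seqv_sub_adjoin.
  by apply/eqP/gal_eqP => a aK; rewrite (fixed_gal (subvv K) gKK aK) gal_id.
split=> //; apply/eqP; rewrite eqn_leq order_gt1 g1 andbT dvdn_leq //.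
by rewrite order_dvdn expgS expg1 gg.
Qed.

Lemma octic_not_split_dual : t != 0 -> t != 13 -> K <> <<1 & ys>>%AS.
Proof.
move=> t0 t13 DK; set G := 'Gal(K / 1)%G.
have galK : galois 1 K := dual_galois Dws.
have ysK : {subset ys <= K} by move=> y yy; rewrite DK; apply: seqv_sub_adjoin.
have oys y : y \in ys -> octE t%:~R y = 0.
  by rewrite -root_prod_XsubC -Dys rootE horner_octp => /eqP.
have gys (g : gal_of K) y : y \in ys -> g y \in ys.
  rewrite -!root_prod_XsubC -Dys => ry; have := ry.
  by rewrite -(fmorph_root (gal_repr g)) map_octp rmorph_int.
have Uys := octic_uniq Dys P0.
have [|f fE] := @gal_perm L K 8 ys Uys ysK.
  by move=> g _ i; rewrite gys ?mem_tnth.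
have injf := gal_perm_injm DK fE.
have [h [injh hE evh]] := gal_dual_perm.
have d2520 := card_even_perms7 injh evh.
have d7 : (7 %| #|G|)%N by rewrite -galois_dim // dimv1 divn1; apply: (dual_dim Dws).
have [x Gx ox] := Cauchy (isT : prime 7) d7.
have oy : #[f x]%g = 7 by rewrite order_injm.
case: (normal_degree8 Gx oy (normal_refl G)) => [fix_f|[y0 fy0 _]|tr].
- by have := oy; rewrite fix_f // order1.
- have /(algint_rat (algint_oct (oys _ (mem_tnth y0 ys))))[z Dz] : tnth ys y0 \in 1%VS.
    rewrite -(galois_fixedField galK); apply/fixedFieldP; first by rewrite ysK ?mem_tnth.
    by move=> g Gg; rewrite -fE // fy0.
  have := oys _ (mem_tnth y0 ys); rewrite Dz => /eqP.
  have -> : octE t%:~R z%:~R = (octE t z)%:~R :> L.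
    by rewrite -!horner_octp -horner_map /= map_octp.
  have intr0 (n : int) : (n%:~R == 0 :> L) = (n == 0).
    by rewrite -(rmorph_int (in_alg L)) fmorph_eq0 intr_eq0.
  by rewrite intr0 => /eqP/octic_int_root; rewrite (negPf t0) (negPf t13).
have [p [m [pp pN mP [g Gg [g1 gI ggw]]]]] := inertial_involution Dws vdm_ws P0.
have [gg og] := dual_involution g1 ggw.
(* Otherwise a point stabilizer of this transitive group on 8 letters has even order, and 16 divides
   [#|G|], which divides 7!/2 = 2520. *)
have nfix i : f g i != i.
  apply/negP=> /eqP gi; pose H := (f @* G)%G.
  have oH : #|H| = #|G| by apply: card_injm.
  have orb : #|orbit 'P H i| = 8.
    rewrite -[RHS](card_ord 8) -cardsT; apply: eq_card => j; rewrite inE; apply/orbitP.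
    by have [u Gu uj] := tr i j; exists (f u); first exact: mem_morphim.
  have stab : f g \in 'C_H[i | 'P]%g.
    by rewrite inE mem_morphim //=; apply/astab1P.
  have o2 : #[f g]%g = 2 by rewrite order_injm.
  have := card_orbit_stab 'P H i; rewrite orb oH => oG.
  have := order_dvdG stab; rewrite o2 => /dvdnP[k Dk].
  suff: (16 %| 2520)%N by [].
  by apply: dvdn_trans d2520; rewrite -oG Dk mulnCA dvdn_mull.
have [q Dq] : exists q, perm_eq ys (q ++ map g q).
  apply: involution_pairs => // _ /tnthP[i ->]; split; rewrite ?gys ?mem_tnth //.
    apply: contra (nfix i) => /eqP E; apply/eqP/(tuple_uniqP _ Uys).
    by rewrite fE.
  by rewrite -galM ?ysK ?mem_tnth // gg gal_id.
apply: (pairing_contradiction pp pN mP gI _ Dq) => y yq.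
by rewrite ysK // (perm_mem Dq) mem_cat yq.
Qed.

End ExcludeTrivial.

(** * The Galois groups of K over Q and of M over K *)

Section GaloisGroups.
Variables (L : splittingFieldType rat) (t : int) (ws : 7.-tuple L) (ys : 8.-tuple L).
Hypotheses (Dws : splits (sept (1 - 4 * t%:~R)) ws) (Dys : splits (octp t%:~R) ys)
  (vdm_ws : vdm ws ^+ 2 = sqrt_disc (4 * t%:~R) ^+ 2) (P0 : 0 <= sqrt_disc (4 * t))
  (t0 : t != 0) (t13 : t != 13).
Let K : {subfield L} := <<1 & ws>>%AS.
Let M : {subfield L} := <<K & ys>>%AS.

Lemma galois_groups : [/\ ('Gal(K / 1) \isog 'GL_3(2))%g, (2.-abelem 'Gal(M / K))%g
  & #|'Gal(M / K)%g| = 8].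
Proof.
have galM : galois 1 M := galois_octic Dws Dys P0.
have galK : galois 1 K := dual_galois Dws.
have sKM : (K <= M)%VS by apply: subv_adjoin_seq.
have s1KM : (1 <= K <= M)%VS by rewrite sub1v.
have nK : normalField 1 K by case/and3P: galK.
have nE := normalField_normal s1KM nK.
have [vs [Dvs vsM Uvs]] := exists_sqrt_dual Dws Dys P0.
have abE : (2.-abelem 'Gal(M / K))%g := gal_octic_abelem Dws Dys P0 Dvs vsM Uvs.
have [f injf fE] := gal_ys_perm Dws Dys P0.
have [x [Gx ox]] := gal_octic_order7 Dws Dys P0.
have oy : #[f x]%g = 7 by rewrite order_injm.
have galKM : galois K M by apply: galoisS galM.
have [oE CE] : #|'Gal(M / K)%g| = 8 /\ ('C_('Gal(M / 1))('Gal(M / K)) = 'Gal(M / K))%g.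
  case: (normal_degree8 Gx oy nE) => [fix_f|[y0 fy0 tr]|tr].
  - have E1 : 'Gal(M / K)%g = 1%g.
      apply/trivgP/subsetP=> g Eg; have Gg := subsetP (normal_sub nE) g Eg.
      by rewrite inE; apply/eqP/(injmP injf); rewrite ?group1 // fix_f ?morph1.
    case: (octic_not_split_dual Dws Dys vdm_ws P0 t0 t13).
    rewrite -(octic_field_eq Dws Dys P0); apply/val_inj/eqP; rewrite eqEdim sKM /=.
    have := galois_dim galKM; rewrite E1 cards1 => d1.
    by rewrite -(divnK (field_dimS sKM)) d1 mul1n.
  (* Here the remaining seven points form one orbit, whose length cannot divide the order of a
     2-group. *)
  - have [i0 i00] : exists i0, i0 != y0.
      have [->|] := eqVneq y0 ord0; first by exists ord_max.
      by rewrite eq_sym; exists ord0.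
    have orb : orbit 'P (f @* 'Gal(M / K)) i0 = ~: [set y0].
      apply/setP=> j; rewrite !inE; apply/orbitP/idP => [[_ /morphimP[g Gg Eg ->] <-]|jy0].
        by apply: contra i00 => /eqP /= E; rewrite -(inj_eq (@perm_inj _ (f g))) fy0 // -E.
      have [g Eg gj] := tr _ _ i00 jy0; exists (f g) => //.
      exact: (mem_morphim f (subsetP (normal_sub nE) g Eg) Eg).
    have := dvdn_orbit 'P (f @* 'Gal(M / K))%G i0.
    rewrite orb cardsC1 card_ord => d7.
    have /pgroupP := abelem_pgroup abE.
    by move=> /(_ 7 isT (dvdn_trans d7 (dvdn_morphim _ _))).
  have := regular_abelian ord0 injf (normal_sub nE) (abelem_abelian abE) tr.
  by rewrite card_ord.
have [div168 iso168] := quotient_GL3 nE abE oE CE.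
have iso := normalField_isog galM s1KM nK.
split=> //.
apply: isog_trans (iso168 _); first by rewrite isog_sym.
rewrite (card_isog iso).
have [h [injh _ evh]] := gal_dual_perm Dws vdm_ws.
have [p [m [_ _ _ [g Gg [g1 _ ggw]]]]] := inertial_involution Dws vdm_ws P0.
apply: (order168 injh evh _ _ Gg (dual_involution g1 ggw).2).
  by rewrite -galois_dim // dimv1 divn1; apply: (dual_dim Dws).
by rewrite -(card_isog iso).
Qed.

End GaloisGroups.

(** * Ramification *)

(** Newton's identities. With the inverses of the roots of the septic as [rs], the product is the
    septic up to a constant, so its lowest coefficients give the power sums. *)
Lemma power_sums_coef (F : fieldType) (rs : seq F) :
  let q := \prod_(r <- rs) (1 - r *: 'X) in
  [/\ q`_0 = 1, \sum_(r <- rs) r ^+ 2 = q`_1 ^+ 2 - 2 * q`_2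
    & \sum_(r <- rs) r ^+ 3 = - q`_1 ^+ 3 + 3 * q`_1 * q`_2 - 3 * q`_3].
Proof.
elim: rs => [|r rs [q0 p2 p3]] /=.
  by rewrite !big_nil !coefC /=; split=> //; ring.
rewrite !big_cons p2 p3; move: (\prod_(_ <- _) _) q0 => q q0 {p2 p3}.
by rewrite mulrBl mul1r -scalerAl !(coefB, coefZ, coefXM) /= q0; split; ring.
Qed.

(* The inverses of the roots have second power sum 10 and third power sum 12 t - 10. *)
Lemma septic_real_bound (F : numFieldType) (t : int) (xs : seq F) :
  splits (sept (4 * t%:~R)) xs -> {in xs, forall x, x \is Num.real} ->
  -40 <= 12 * t - 10 <= 40.
Proof.
move=> Dxs xsR; pose q := \prod_(r <- [seq x^-1 | x <- xs]) (1 - r *: 'X).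
have nz : {in xs, forall x, x != 0}.
  move=> x; rewrite -root_prod_XsubC -Dxs; apply: contraTneq => ->.
  rewrite rootE horner_sept; have -> : septE (4 * t%:~R) 0 = -1 :> F by rewrite /septE; ring.
  by rewrite oppr_eq0 oner_eq0.
have [q0 p2 p3] := power_sums_coef [seq x^-1 | x <- xs].
have E : sept (4 * t%:~R) = (\prod_(x <- xs) - x) *: q.
  rewrite Dxs /q big_map -scaler_prod big_seq [RHS]big_seq; apply: eq_bigr => x xx.
  by rewrite scalerBr scalerA mulNr divff ?nz // !scaleNr scale1r opprK addrC alg_polyC.
set c := \prod_(x <- xs) - x in E.
have c1 : c = -1.
  by have /polyP/(_ 0) := E; rewrite coefZ q0 mulr1 /sept coef_Poly.
have Dq i : q`_i = - (sept (4 * t%:~R))`_i by rewrite E c1 scaleN1r coefN opprK.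
rewrite -/q !Dq /sept !coef_Poly /= in p2 p3.
have {}p2 : \sum_(r <- [seq x^-1 | x <- xs]) r ^+ 2 = 10 by rewrite p2; ring.
have {}p3 : \sum_(r <- [seq x^-1 | x <- xs]) r ^+ 3 = (12 * t - 10)%:~R.
  by rewrite p3 rmorphB rmorphM !rmorph_nat /=; ring.
have rR r : r \in [seq x^-1 | x <- xs] -> r \is Num.real.
  by case/mapP=> x xx ->; rewrite rpredV xsR.
(* For real r the squares add up to 10, so r^2 <= 10 <= 16; hence the sum of the r^3 is at most 4 *
   10 in absolute value. *)
have r4 r : r \in [seq x^-1 | x <- xs] -> `|r| <= 4.
  move=> rr; rewrite -(@ler_pXn2r _ 2) ?nnegrE // real_normK ?rR //.
  apply: (@le_trans _ _ 10); last by rewrite -natrX ler_nat.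
  rewrite -p2 (big_rem r) //= lerDl big_seq sumr_ge0 // => y yr.
  by rewrite -realEsqr rR // (mem_rem yr).
have E40 : 40%:~R = \sum_(r <- [seq x^-1 | x <- xs]) 4 * r ^+ 2 :> F.
  by rewrite -mulr_sumr p2 -natrM.
rewrite -!(ler_int F) rmorphN /= E40 -p3 -sumrN.
apply/andP; split; rewrite big_seq [leRHS]big_seq; apply: ler_sum => r rr;
  have := r4 r rr; rewrite real_ler_norml ?rR // => /andP[r1 r2];
  have r0 : 0 <= r ^+ 2 by rewrite -realEsqr rR.
  by rewrite -mulNr exprS ler_wpM2r.
by rewrite exprS ler_wpM2r.
Qed.

Lemma dual_unramified_infinite (L : fieldExtType rat) (t : int) (K M : {subfield L})
    (xs : seq L) : (K <= M)%VS -> {subset xs <= K} -> splits (sept (4 * t%:~R)) xs ->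
  ~~ (-40 <= 12 * t - 10 <= 40) -> unramified_infinite K M.
Proof.
move=> sKM xsK Dxs tb s sR; case/negP: tb.
have xsM x : x \in xs -> x \in M by move=> /xsK/(subvP sKM).
have DM : splits (sept (4 * t%:~R)) [seq vsproj M x | x <- xs].
  apply: (map_poly_inj vsval); rewrite map_sept rmorphM rmorph_nat rmorph_int Dxs.
  rewrite rmorph_prod big_map big_seq [RHS]big_seq; apply: eq_bigr => x xx.
  by rewrite /= rmorphB /= map_polyX map_polyC /= vsprojK // xsM.
apply: (@septic_real_bound _ t [seq s (vsproj M x) | x <- xs]).
  have /(congr1 (map_poly s)) := DM; rewrite map_sept rmorphM rmorph_nat rmorph_int => ->.
  rewrite rmorph_prod /splits !big_map; apply: eq_bigr => x _.
  by rewrite rmorphB /= map_polyX map_polyC.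
by move=> _ /mapP[x xx ->]; apply: sR; rewrite vsprojK ?xsM ?xsK.
Qed.

(** From u (u - 2) >= 80 * 78 = 6240 the quartic is at least 6000 u^2 + 5994 u - 1417. The threshold
    80 is far from sharp. *)
Lemma sqrt_disc_ge0 (u : int) : 80 <= `|u| -> 0 <= sqrt_disc u.
Proof.
move=> u80.
have uu : 6240 <= u * (u - 2).
  by case: (ler0P u) u80 => u0 u80; nia.
have {}uu : 6000 <= 27 * (u * (u - 2)) - 5967 by lia.
have -> : sqrt_disc u = u ^+ 2 * (27 * (u * (u - 2)) - 5967) + 5994 * u - 1417 by rewrite /sqrt_disc; ring.
have u2 : 0 <= u ^+ 2 + u - 1 by nia.
have {}uu: 0 <= u ^+ 2 * (27 * (u * (u - 2)) - 5967 - 6000).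
  by apply: mulr_ge0; [exact: sqr_ge0 | rewrite subr_ge0; exact: uu].
have u3 : 0 <= u ^+ 2 := sqr_ge0 u.
have key (a b : int) : 0 <= a - b * 6000 -> 0 <= b -> 0 <= b + u - 1 ->
    0 <= a + 5994 * u - 1417 by clear; lia.
rewrite mulrBr in uu; exact (key _ _ uu u3 u2).
Qed.

(** * Normalized valuations and quadratic extensions *)

Section Valuation.
Variables (L : fieldExtType rat) (M : {subfield L}) (v : L -> int).
Hypothesis Vv : normalized_valuation M v.

Let vM x y : x \in M -> y \in M -> x != 0 -> y != 0 -> v (x * y) = v x + v y.
Proof. by case: Vv => H _ _; apply: H. Qed.

(* The junk value of v at 0 is replaced by +oo. *)
Definition val_ge (n : int) (x : L) := (x == 0) || (n <= v x).

Let v1 : v 1 = 0.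
Proof.
have : v (1 * 1) = v 1 + v 1 by apply: vM; rewrite ?rpred1 ?oner_neq0.
by rewrite mulr1 -[LHS]addr0 => /addrI.
Qed.

Let vN1 : v (-1) = 0.
Proof.
have : v (-1 * -1) = v (-1) + v (-1) by apply: vM; rewrite ?rpredN1 // oppr_eq0 oner_neq0.
by rewrite mulrNN mulr1 v1; move: (v (-1)) => a; lia.
Qed.

Lemma val_geM m n x y : x \in M -> y \in M -> val_ge m x -> val_ge n y -> val_ge (m + n) (x * y).
Proof.
move=> xM yM; rewrite /val_ge mulf_eq0.
case: eqVneq => //= x0; case: eqVneq => //= y0 mx ny.
by rewrite vM // lerD.
Qed.

Lemma val_geW m n x : m <= n -> val_ge n x -> val_ge m x.
Proof. by rewrite /val_ge => mn /orP[->//|nx]; rewrite (le_trans mn nx) orbT. Qed.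

Lemma val_geD n x y : x \in M -> y \in M -> val_ge n x -> val_ge n y -> val_ge n (x + y).
Proof.
move=> xM yM; rewrite /val_ge; case: eqVneq => [->|x0] /=; first by rewrite add0r.
case: eqVneq => [->|y0] /=; first by rewrite addr0 (negPf x0).
case: eqVneq => //= xy0 nx ny; case: Vv => _ vD _.
by apply: le_trans (vD _ _ xM yM x0 y0 xy0); rewrite le_min nx ny.
Qed.

Lemma val_geN n x : x \in M -> val_ge n x -> val_ge n (- x).
Proof.
move=> xM nx; rewrite -mulN1r -[n]add0r; apply: val_geM => //; first exact: rpredN1.
by rewrite /val_ge vN1 lexx orbT.
Qed.

Lemma val_ge0 n : val_ge n 0. Proof. by rewrite /val_ge eqxx. Qed.

Lemma val_geX (n : int) k x : x \in M -> val_ge n x -> val_ge (n *+ k) (x ^+ k).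
Proof.
move=> xM nx; elim: k => [|k IH]; first by rewrite mulr0n /val_ge expr0 v1 lexx orbT.
by rewrite exprS mulrS; apply: val_geM; rewrite ?rpredX.
Qed.

Lemma val_ge_sum n (I : Type) (r : seq I) (P : pred I) (F : I -> L) :
  (forall i, P i -> F i \in M /\ val_ge n (F i)) -> val_ge n (\sum_(i <- r | P i) F i).
Proof.
move=> FM; suff: \sum_(i <- r | P i) F i \in M /\ val_ge n (\sum_(i <- r | P i) F i) by case.
elim/big_rec: _ => [|i x Pi [xM nx]]; first by rewrite rpred0 val_ge0.
by have [iM ni] := FM i Pi; split; [apply: rpredD | apply: val_geD].
Qed.

Lemma val_ge_int (n : int) : val_ge 0 n%:~R.
Proof.
have nat k : val_ge 0 k%:R.
  elim: k => [|k IH]; first exact: val_ge0.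
  by rewrite -natr1; apply: val_geD; rewrite ?rpred_nat ?rpred1 // /val_ge v1 lexx orbT.
by case: n => k; rewrite ?NegzE ?mulrNz -?pmulrn ?nat //; apply: val_geN; rewrite ?rpred_nat ?nat.
Qed.

Lemma valX x k : x \in M -> x != 0 -> v (x ^+ k) = v x *+ k.
Proof.
move=> xM x0; elim: k => [|k IH]; first by rewrite v1.
by rewrite exprS mulrS vM ?rpredX ?expf_neq0 // IH.
Qed.

(** If x had negative value, the leading term of a monic integral equation for x would have smaller
    value than all the others. *)
Lemma val_ge_algint x : x \in M -> algint x -> val_ge 0 x.
Proof.
move=> xM [p mp /eqP px]; rewrite /val_ge; case: eqVneq => //= x0; rewrite leNgt; apply/negP => vx.
have szp : size (map_poly (intr : int -> L) p) = size p by apply: size_map_poly_id0; rewrite (monicP mp) oner_neq0.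
have sz0 : (0 < size p)%N by rewrite lt0n size_poly_eq0 monic_neq0.
case Dn: (size p) sz0 => [//|n] _.
move: px; rewrite horner_coef szp Dn big_ord_recr /= coef_map /=.
have -> : p`_n = 1 by rewrite -(monicP mp) /lead_coef Dn.
rewrite mul1r => /eqP; rewrite addrC addr_eq0 => /eqP E.
case: n E Dn => [|n] E Dn; first by move: E; rewrite big_ord0 oppr0 expr0 => /eqP; rewrite oner_eq0.
have : val_ge (v x *+ n) (x ^+ n.+1).
  rewrite E; apply: val_geN; first by rewrite rpred_sum // => i _; rewrite rpredM ?rpredX ?coef_map ?rpred_int.
  apply: val_ge_sum => i _; split; first by rewrite rpredM ?rpredX ?coef_map ?rpred_int.
  rewrite -[_ *+ n]add0r; apply: val_geM; rewrite ?rpredX ?coef_map ?rpred_int ?val_ge_int //.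
  apply: (@val_geW _ (v x *+ i)); last by rewrite /val_ge valX // lexx orbT.
  by rewrite ler_wnMn2l ?ltW // -ltnS.
by rewrite /val_ge expf_eq0 (negPf x0) andbF /= valX // mulrS lerDr leNgt vx.
Qed.

Lemma val_add_gt x y : x \in M -> y \in M -> x != 0 -> val_ge (v x + 1) y ->
  x + y != 0 /\ v (x + y) = v x.
Proof.
move=> xM yM x0 ny; have xyM : x + y \in M by rewrite rpredD.
have nx n : val_ge n x = (n <= v x) by rewrite /val_ge (negPf x0).
have xy0 : x + y != 0.
  rewrite addrC addr_eq0; apply: contraTneq ny => ->; apply/negP => H.
  have : val_ge (v x + 1) (- - x) by apply: val_geN; rewrite ?rpredN.
  by rewrite opprK nx; lia.
split=> //; have le1 : val_ge (v x) (x + y).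
  by apply: val_geD; rewrite ?nx ?lexx // (val_geW _ ny) // lerDl.
have : ~~ val_ge (v x + 1) (x + y).
  apply/negP => H; have : val_ge (v x + 1) (x + y - y).
    by apply: val_geD; rewrite ?rpredN // val_geN.
  by rewrite addrK nx; lia.
by move: le1; rewrite /val_ge (negPf xy0) /=; lia.
Qed.

Lemma val_unit x y : x \in M -> y \in M -> val_ge 0 x -> val_ge 0 y -> x * y = 1 -> v x = 0.
Proof.
move=> xM yM vx vy xy1.
have: x * y != 0 by rewrite xy1 oner_neq0.
rewrite mulf_eq0 negb_or => /andP[x0 y0].
have := vM xM yM x0 y0; move: vx vy; rewrite /val_ge xy1 v1 (negPf x0) (negPf y0) /=; lia.
Qed.

Lemma val_surj_1 (F : {subfield L}) : (F <= M)%VS ->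
  (exists x, [/\ x \in F, x != 0 & v x = 1]) ->
  forall n : int, exists x, [/\ x \in F, x != 0 & v x = n].
Proof.
move=> sFM [x [xF x0 vx]]; have xM := subvP sFM _ xF.
have nat k : v (x ^+ k) = k by rewrite valX // vx natz.
case=> k; first by exists (x ^+ k); rewrite rpredX ?expf_neq0 ?nat.
exists (x ^- k.+1); rewrite rpredV rpredX ?invr_eq0 ?expf_neq0 //; split=> //.
have := vM (rpredX k.+1 xM) (rpredVr (rpredX k.+1 xM)) (expf_neq0 _ x0).
by rewrite invr_eq0 expf_neq0 // divff ?expf_neq0 // v1 nat => /(_ isT); lia.
Qed.

End Valuation.

Section QuadraticStep.
Variables (L : fieldExtType rat) (M F : {subfield L}) (v : L -> int) (b a c : L).
Hypothesis (Vv : normalized_valuation M v) (sFM : (<<F; b>> <= M)%VS).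
Hypotheses (aF : a \in F) (cF : c \in F) (va : val_ge v 0 a) (vc : val_ge v 0 c).
Hypotheses (Db : b ^+ 2 = a ^+ 2 + 4 * c) (b0 : b != 0) (vb : v b = 0).

(* If b is in F then x has several conjugates; this is harmless. *)
Definition conjugates (F : {subfield L}) (b x y : L) := exists p q,
  [/\ p \in F, q \in F, x = p + q * b & y = p - q * b].

Let b2F : b ^+ 2 \in F.
Proof. by rewrite Db rpredD ?rpredX // rpredM // rpred_nat. Qed.

Let FM x : x \in F -> x \in M.
Proof. by move=> xF; apply: (subvP sFM); apply: (subvP (subv_adjoin _ _)). Qed.

Let bM : b \in M. Proof. by apply: (subvP sFM); apply: memv_adjoin. Qed.

Lemma conj_in x y : conjugates F b x y -> x \in M /\ y \in M.
Proof.
by case=> p [q [/FM pM /FM qM -> ->]]; rewrite rpredD ?rpredB ?rpredM ?bM.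
Qed.

Lemma conjD x x' y y' : conjugates F b x x' -> conjugates F b y y' ->
  conjugates F b (x + y) (x' + y').
Proof.
move=> [p [q [pF qF -> ->]]] [r [s [rF sF -> ->]]].
by exists (p + r), (q + s); split; rewrite ?rpredD //; ring.
Qed.

Lemma conjM x x' y y' : conjugates F b x x' -> conjugates F b y y' ->
  conjugates F b (x * y) (x' * y').
Proof.
move=> [p [q [pF qF -> ->]]] [r [s [rF sF -> ->]]].
exists (p * r + q * s * b ^+ 2), (p * s + q * r).
have qsF : q * s * b ^+ 2 \in F by rewrite [X in X \in _]mulrC rpredM // rpredM.
split; [by rewrite rpredD // rpredM | by rewrite rpredD ?rpredM | ring | ring].
Qed.

Lemma conjF x : x \in F -> conjugates F b x x.
Proof. by move=> xF; exists x, 0; split; rewrite ?rpred0 //; ring. Qed.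

Lemma conjX x y n : conjugates F b x y -> conjugates F b (x ^+ n) (y ^+ n).
Proof.
move=> xy; elim: n => [|n IH]; first by apply: conjF; apply: rpred1.
by rewrite !exprS; apply: conjM.
Qed.

Lemma conj_norm x y : conjugates F b x y -> x * y \in F.
Proof.
case=> p [q [pF qF -> ->]]; have -> : (p + q * b) * (p - q * b) = p ^+ 2 - q ^+ 2 * b ^+ 2 by ring.
by apply: rpredB; [apply: rpredX | apply: rpredM => //; apply: rpredX].
Qed.

Lemma conj_sym x y : conjugates F b x y -> conjugates F b y x.
Proof. by case=> p [q [pF qF -> ->]]; exists p, (- q); rewrite rpredN; split=> //; ring. Qed.

Lemma adjoin_conj x : x \in <<F; b>>%VS -> exists y, conjugates F b x y.
Proof.
case/Fadjoin_polyP=> p /polyOverP pF ->; rewrite horner_coef.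
elim/big_rec: _ => [|i z _ [y zy]]; first by exists 0; apply: conjF; apply: rpred0.
exists (p`_i * (- b) ^+ i + y); apply: conjD => //; apply: conjM; first exact: conjF.
by apply: conjX; exists 0, 1; rewrite rpred0 rpred1; split=> //; ring.
Qed.

Let th : L := (b - a) / 2.
Let th' : L := (- b - a) / 2.

Let conj_th : conjugates F b th th'.
Proof.
have n2 : 2 != 0 :> L by rewrite numfield_natr_eq0.
have h2 : 2^-1 \in F by rewrite rpredV rpred_nat.
exists (- a / 2), 2^-1; split=> //; first by rewrite rpredM ?rpredN.
  by rewrite /th; field.
by rewrite /th'; field.
Qed.

Let vM x y : x \in M -> y \in M -> x != 0 -> y != 0 -> v (x * y) = v x + v y.
Proof. by case: Vv => H _ _; apply: H. Qed.

Let natL0 n : n.+1%:R != 0 :> L.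
Proof. by rewrite numfield_natr_eq0. Qed.

Let vth : val_ge v 0 th.
Proof.
have thM := (conj_in conj_th).1.
rewrite /val_ge; case: eqVneq => //= t0; rewrite leNgt; apply/negP => vt.
have E : th ^+ 2 = c - a * th.
  have n2 := natL0 1; apply: (mulfI (natL0 3)).
  have -> : 4%:R * th ^+ 2 = b ^+ 2 - 2 * a * b + a ^+ 2 by rewrite /th; field.
  by rewrite Db /th; field.
have : val_ge v (v th) (th ^+ 2).
  have vtt : val_ge v (v th) th by rewrite /val_ge lexx orbT.
  have atM : a * th \in M by apply: rpredM => //; apply: FM.
  rewrite E; apply: (val_geD Vv); [exact: FM | by rewrite rpredN | exact: val_geW (ltW vt) vc |].
  by apply: (val_geN Vv) => //; rewrite -[v th]add0r; apply: (val_geM Vv) => //; apply: FM.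
rewrite /val_ge expf_eq0 (negPf t0) andbF /= (valX Vv) //; move: vt; move: (v th) => n; clear; lia.
Qed.

(* Let th = (b - a) / 2, a root of X^2 + a X - c, whose difference b with the other
   root is a unit.  Either th is congruent to no element of F, and then
   v (p + q th) = min (v p) (v q) is a value of v on F; or th is congruent to some
   c0, and then c0 - th and its conjugate serve to modify x into an element of
   value 1 whose conjugate has value 0, the norm of which has value 1. *)
Lemma quadratic_unramified : (exists x, [/\ x \in <<F; b>>%VS, x != 0 & v x = 1]) ->
  exists x, [/\ x \in F, x != 0 & v x = 1].
Proof.
case=> x [xFb x0 vx]; have [y xy] := adjoin_conj xFb; have [xM yM] := conj_in xy.
have [thM thM'] := conj_in conj_th; have n2 := natL0 1.
have [[c0 [c0F vc0 vtc]]|noc] := boolp.pselect (exists c0, [/\ c0 \in F, val_ge v 0 c0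
    & val_ge v 1 (c0 - th)]).
  have c0M := FM c0F.
  have DA : c0 - th' = b + (c0 - th) by rewrite /th /th'; field.
  have cAB : conjugates F b (c0 - th) (c0 - th').
    rewrite -[c0 - th]add0r -[c0 - th']add0r; case: conj_th => p [q [pF qF -> ->]].
    by exists (c0 - p), (- q); rewrite rpredN rpredB //; split=> //; ring.
  have [BM AM] := conj_in cAB.
  have [A0 vA] : c0 - th' != 0 /\ v (c0 - th') = 0.
    by rewrite DA -vb; apply: (val_add_gt Vv) => //; rewrite vb.
  move: (c0 - th') (c0 - th) AM BM cAB A0 vA vtc {DA} => A B AM BM cAB A0 vA vB.
  have vAX k : v (A ^+ k) = 0 by rewrite (valX Vv) // vA mul0rn.
  have vBX (k : nat) : val_ge v k (B ^+ k) by have := val_geX Vv k BM vB; rewrite natz.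
  (* The conjugate y of x may have a pole, of order at most m. The factor A^(m+1) keeps the value 1
     of x, while in the conjugate y B^(m+1) + A^2 of x A^(m+1) + B^2 the first term then has
     positive value. *)
  have [m vy] : exists m : nat, val_ge v (- m%:Z) y.
    exists `|v y|%N; rewrite /val_ge; apply/orP; right; move: (v y) => n; clear; lia.
  have [z0 vz] : x * A ^+ m.+1 + B ^+ 2 != 0 /\ v (x * A ^+ m.+1 + B ^+ 2) = 1.
    have vxA : v (x * A ^+ m.+1) = 1 by rewrite vM ?rpredX ?expf_neq0 // vAX vx.
    rewrite -[in X in _ /\ X]vxA; apply: (val_add_gt Vv); rewrite ?rpredM ?rpredX ?mulf_neq0 ?expf_neq0 //.
    by rewrite vxA; apply: (vBX 2).
  have [z0' vz'] : A ^+ 2 + y * B ^+ m.+1 != 0 /\ v (A ^+ 2 + y * B ^+ m.+1) = 0.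
    rewrite -[in X in _ /\ X](vAX 2); apply: (val_add_gt Vv); rewrite ?rpredM ?rpredX ?expf_neq0 //.
    rewrite vAX add0r (_ : 1 = - m%:Z + m.+1%:Z); last by clear; lia.
    by apply: (val_geM Vv); rewrite ?rpredX.
  exists ((x * A ^+ m.+1 + B ^+ 2) * (A ^+ 2 + y * B ^+ m.+1)); split; last 1 first.
  - by rewrite vM ?vz ?vz' // ?rpredD ?rpredM ?rpredX.
  - rewrite [A ^+ 2 + _]addrC; apply: conj_norm; apply: conjD; first apply: conjM => //;
      by apply: conjX => //; apply: conj_sym.
  by rewrite mulf_neq0.
have [p [q [pF qF Dx _]]] := xy; have aM := FM aF.
have {}Dx : x = (p + q * a) + 2 * q * th by rewrite Dx /th; field.
have PF : p + q * a \in F by rewrite rpredD ?rpredM.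
have QF : 2 * q \in F by rewrite rpredM ?rpred_nat.
move: (p + q * a) (2 * q) PF QF Dx => P Q PF QF Dx.
have [Q0|Q0] := eqVneq Q 0.
  by move: Dx; rewrite Q0 mul0r addr0 => Dx; exists P; rewrite -Dx; split=> //; rewrite Dx.
pose r := P / Q; have rF : r \in F by rewrite rpredM ?rpredV.
have rM := FM rF; have QM := FM QF.
have {}Dx : x = Q * (r + th) by rewrite Dx /r; field. clearbody r.
have rt0 : r + th != 0 by apply: contraNneq x0 => E; rewrite Dx E mulr0.
have vQ : v x = v Q + v (r + th) by rewrite Dx vM ?rpredD.
have [vr|nvr] := boolP (val_ge v 0 r).
  exists Q; split=> //; rewrite -vx vQ.
  suff -> : v (r + th) = 0 by rewrite addr0.
  have : val_ge v 0 (r + th) by apply: (val_geD Vv).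
  have : ~~ val_ge v 1 (r + th).
    apply/negP => H; apply: noc; exists (- r); rewrite rpredN; split=> //.
      exact: (val_geN Vv).
    by rewrite -opprD; apply: (val_geN Vv); rewrite ?rpredD.
  by rewrite /val_ge (negPf rt0) /=; move: (v _) => n; clear; lia.
have [r0 vr] : r != 0 /\ v r < 0.
  by move: nvr; rewrite /val_ge negb_or -ltNge => /andP[].
exists (Q * r); rewrite rpredM ?mulf_neq0 ?vM //; split=> //.
rewrite -vx vQ; congr (_ + _); apply/esym; have [|//] := val_add_gt Vv rM thM r0.
by apply: val_geW vth; move: vr; move: (v r) => n; clear; lia.
Qed.

End QuadraticStep.

Lemma tower_unramified (L : fieldExtType rat) (K M : {subfield L}) (v : L -> int) (bs : seq L) :
  normalized_valuation M v -> (<<K & bs>> <= M)%VS ->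
  {in bs, forall b, [/\ b != 0, v b = 0 & exists a c, [/\ a \in K, c \in K,
     val_ge v 0 a, val_ge v 0 c & b ^+ 2 = a ^+ 2 + 4 * c]]} ->
  (exists x, [/\ x \in <<K & bs>>%VS, x != 0 & v x = 1]) ->
  exists x, [/\ x \in K, x != 0 & v x = 1].
Proof.
move=> Vv; elim/last_ind: bs => [|bs b IH]; first by rewrite Fadjoin_nil.
rewrite adjoin_rcons => sM bsP ex1; apply: IH.
- by apply: subv_trans sM; apply: subv_adjoin.
- by move=> x xb; apply: bsP; rewrite mem_rcons inE xb orbT.
have [|b0 vb [a [c [aK cK va vc E]]]] := bsP b; first by rewrite mem_rcons mem_head.
have sK := subvP (subv_adjoin_seq K bs).
by apply: (@quadratic_unramified _ M <<K & bs>>%AS v b a c) => //; apply: sK.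
Qed.

(** Modulo 2 and the septic, w^8 = w^2 + w + 1, so that w + w^4 is a square root of w + 1. Since a
    modulo 2 determines a^2 modulo 4, it is the natural candidate modulo 4, and it works. *)
Lemma dual_congruence (R : comNzRingType) (t w : R) :
  w + 1 = (w + w ^+ 4) ^+ 2 + 4 * - (7 * w ^+ 6 + (2 + t) * w ^+ 5 + (6 * t - 13) * w ^+ 4
    + (5 * t - 8) * w ^+ 3 + 5 * w ^+ 2 + 5 * w + 1) - (w + 5) * septE (1 - 4 * t) w.
Proof. by rewrite /septE; ring. Qed.

Lemma dual_unramified_finite (L : splittingFieldType rat) (t : int) (ws : 7.-tuple L)
    (ys : 8.-tuple L) : splits (sept (1 - 4 * t%:~R)) ws -> splits (octp t%:~R) ys ->
  0 <= sqrt_disc (4 * t) -> unramified_finite <<1 & ws>>%AS <<<<1 & ws>>%AS & ys>>%AS.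
Proof.
move=> Dws Dys P0 v Vv n; rewrite dvd1z; split=> // _.
set K := <<1 & ws>>%AS; set M := <<K & ys>>%AS in Vv.
have sKM : (K <= M)%VS by apply: subv_adjoin_seq.
have [vs [Dvs vsM Uvs]] := exists_sqrt_dual Dws Dys P0.
have DM := octic_field_eq_sqrt Dws Dys P0 Dvs vsM Uvs.
have wsK w : w \in ws -> w \in K by move=> ?; rewrite seqv_sub_adjoin.
apply: (val_surj_1 Vv sKM); apply: (tower_unramified (bs := vs) Vv).
- by apply/Fadjoin_seqP; split.
- move=> b bvs; have := map_f (fun v => v ^+ 2 - 1) bvs; rewrite Dvs.
  move: (b ^+ 2 - 1) (subrK 1 (b ^+ 2)) => w Dw ww; have bM := vsM b bvs.
  have rw : septE (1 - 4 * t%:~R) w = 0.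
    by apply/eqP; rewrite -horner_sept -rootE Dws root_prod_XsubC.
  have Ow : algint w.
    by apply: (@algint_sept _ (1 - 4 * t)); rewrite rmorphB rmorph1 rmorphM rootE horner_sept rw.
  have wK := wsK w ww; have wM := subvP sKM _ wK.
  have Ot : algint (t%:~R : L) by apply: (integral_id intr).
  have tK : t%:~R \in K by rewrite rpred_int.
  have nK k : k%:R \in K by rewrite rpred_nat.
  have [_] := sept_units rw; rewrite Dw.
  set u := (X in _ * X) => bu.
  have uM : u \in M by apply: (subvP sKM); rewrite /u; mem_tac.
  have vu : val_ge v 0 u by apply: (val_ge_algint Vv) => //; rewrite /u; algint_tac.
  have vw1 : val_ge v 0 (b ^+ 2).
    by rewrite -Dw; apply: (val_ge_algint Vv); [rewrite rpredD ?rpred1 | algint_tac].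
  have b20 := val_unit Vv (rpredX 2 bM) uM vw1 vu bu.
  have b0 : b != 0.
    by apply: contra_eq_neq bu => ->; rewrite expr0n mul0r eq_sym oner_neq0.
  split=> //.
    by have := valX Vv 2 bM b0; rewrite b20; move: (v b) => k; clear; lia.
  have := dual_congruence t%:~R w; rewrite rw mulr0 subr0 Dw => E.
  eexists; eexists; split; last exact: E.
  - by mem_tac.
  - by mem_tac.
  - by apply: (val_ge_algint Vv); [apply: (subvP sKM); mem_tac | algint_tac].
  by apply: (val_ge_algint Vv); [apply: (subvP sKM); mem_tac | algint_tac].
have [_ _ /(_ 1)[x [xM x0 vx]]] := Vv; exists x; split=> //.
have {DM}sub : (M <= <<1 & vs ++ [seq - v | v <- vs]>>)%VS.
  by have DV := congr1 val DM; rewrite -[X in (_ <= X)%VS]DV.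
move: x xM {x0 vx}; apply/subvP; apply: subv_trans sub _; apply/Fadjoin_seqP; split; first exact: sub1v.
move=> z; rewrite mem_cat => /orP[zv|/mapP[z' zv ->]]; rewrite ?rpredN; exact: seqv_sub_adjoin.
Qed.

(** * Passage to the given polynomials, and the exceptional values of t *)

Lemma septic_sept t : septic t = sept (4 * t%:~R).
Proof.
apply: pchar0_polyP => [|x]; first exact: pchar_num.
rewrite horner_sept /septE /septic -(rmorph_int polyC) -!(rmorph_nat polyC) /= -polyC1.
by rewrite !(hornerD, hornerN, hornerM, hornerX, hornerXn, hornerC); ring.
Qed.

Lemma octic_octp t : octic t = octp t%:~R.
Proof.
apply: pchar0_polyP => [|x]; first exact: pchar_num.
rewrite horner_octp /octE /octic -(rmorph_int polyC) -!(rmorph_nat polyC) /= -polyC1.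
by rewrite !(hornerD, hornerN, hornerM, hornerX, hornerXn, hornerC, horner_exp); ring.
Qed.

Theorem theorem16 :
  exists S : seq int, forall t : int, t \notin S ->
  forall (L : splittingFieldType rat) (xs ys : seq L),
    is_root_list (septic t) xs -> is_root_list (octic t) ys ->
    let K : {subfield L} := <<1 & xs>>%AS in
    let M : {subfield L} := <<K & ys>>%AS in
    [/\ galois 1 K, 'Gal(K / 1) \isog 'GL_3(2),
        galois K M,
        (2.-abelem)%g 'Gal(M / K) /\ #|'Gal(M / K)%g| = (2 ^ 3)%N
      & unramified K M].
Proof.
(* The integers from -20 to 20: they include 0, 13, all t with |4 t| < 80, and all t with |12 t -
   10| <= 40. *)
exists [seq i%:Z - 20 | i <- iota 0 41] => t tS L xs ys.
have t20 : 20 < `|t|.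
  rewrite ltNge; apply: contra tS; rewrite ler_norml => /andP[t1 t2].
  apply/mapP; exists (absz (t + 20)); first by rewrite mem_iota; lia.
  by lia.
have P0 : 0 <= sqrt_disc (4 * t) by apply: sqrt_disc_ge0; rewrite normrM; move: t20; move: `|t| => n; lia.
have [t0 t13] : t != 0 /\ t != 13 by split; apply: contraTneq t20 => ->.
have tb : ~~ (-40 <= 12 * t - 10 <= 40) by apply/negP; lia.
rewrite /is_root_list septic_sept octic_octp map_sept map_octp !rmorph_int rmorphM rmorph_nat rmorph_int.
move=> Dxs Dys.
have [ws0 [Dws0 ws0K]] := dual_roots Dxs.
have [x xx] : exists x, x \in xs.
  case: xs Dxs {ws0K} => [|x xs] Dxs; last by exists x; rewrite mem_head.
  by have := size_sept (4 * t%:~R : L); rewrite Dxs big_nil size_poly1.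
have rx : root (sept (4 * t%:~R)) x by rewrite Dxs root_prod_XsubC.
have [ws [Dws vdm_ws]] := vdm_sept rx Dws0.
have szy : size ys == 8.
  have := (@Poly_rcons1 L [:: -29 - 9 * t%:~R; -63 - 12 * t%:~R; -9 - 4 * t%:~R; 66; 42; -10; -12; 0]).1.
  by rewrite -[Poly _]/(octp t%:~R) Dys size_prod_XsubC => -[->].
(* Both inclusions come from [dual_roots], since s -> 1 - s is an involution. *)
have DK : <<1 & xs>>%AS = <<1 & ws>>%AS.
  apply/val_inj/eqP; rewrite /= eqEsubv; apply/andP; split; apply/Fadjoin_seqP; split; rewrite ?sub1v //.
    have [xs' [Dxs' xs'K]] := dual_roots Dws.
    move=> z zx; apply: xs'K; rewrite -root_prod_XsubC -[X in root X]Dxs' subKr.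
    by rewrite Dxs root_prod_XsubC.
  move=> z zw; apply: ws0K; rewrite -root_prod_XsubC -[X in root X]Dws0.
  by rewrite Dws root_prod_XsubC.
have xsK : {subset xs <= <<1 & xs>>%AS} by move=> z zx; apply: seqv_sub_adjoin.
move: xsK; rewrite DK => xsK.
set K := <<1 & ws>>%AS => {DK}; set M := <<K & ys>>%AS => /=.
pose yt : 8.-tuple L := Tuple szy.
have Dyt : splits (octp t%:~R) yt by [].
have galM : galois 1 M := galois_octic Dws Dyt P0.
have sKM : (K <= M)%VS by apply: subv_adjoin_seq.
have [isoK abE oE] := galois_groups Dws Dyt vdm_ws P0 t0 t13.
split=> //.
- exact: (dual_galois Dws).
- by apply: galoisS galM; rewrite sub1v.
split; first exact: (dual_unramified_finite Dws Dyt P0).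
exact: (dual_unramified_infinite sKM xsK Dxs tb).
Qed.
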